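(* Let $n\ge 2$ and let $M$ be a connected submanifold of $\mathbb{C}H^n$ of real dimension $2n-k$ whose normal bundle $\nu M\subset T\mathbb{C}H^n$ has constant Kähler angle $\varphi\in(0,\pi/2]$. For $\xi\in\nu M$ let $P\xi$ denote the component of $J\xi$ tangent to $M$. Assume that there exists a unit vector field $Z$ on $M$, tangent to the maximal complex distribution $\mathfrak{C}=TM\cap J(TM)$ on $M$, such that the second fundamental form $II$ of $M$ is given by the trivial symmetric bilinear extension of $$2\,II(Z,P\xi)=\sin^2(\varphi)\,\xi\qquad\text{for all }\xi\in\nu M .$$ Then $M$ is holomorphically congruent to an open part of the submanifold $W^{2n-k}_\varphi$ of $\mathbb{C}H^n$. Conversely, the second fundamental form of $W^{2n-k}_\varphi$ is of this form.
   Context: $\mathbb{C}H^n$ is complex hyperbolic space with its metric $\langle\cdot,\cdot\rangle$ of constant holomorphic sectional curvature $-1$ and complex structure $J$. Kähler angle: a real linear subspace $V$ of a complex vector space with compatible inner product has constant Kähler angle $\varphi\in[0,\pi/2]$ if for every nonzero $v\in V$ the orthogonal projection of $Jv$ onto $V$ has length $\cos(\varphi)\|v\|$. The normal bundle $\nu M$ has constant Kähler angle $\varphi$ if each normal space $\nu_pM\subset T_p\mathbb{C}H^n$ has constant Kähler angle $\varphi$ (the same $\varphi$ for all $p$). For $\varphi>0$ the tangent bundle splits orthogonally as $TM=\mathfrak{C}\oplus P(\nu M)$, and $P:\nu M\to P(\nu M)$ is a bundle isomorphism. ''Trivial symmetric bilinear extension'' means: $II$ is the symmetric bilinear form with $2\,II(Z,P\xi)=\sin^2(\varphi)\xi$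 for all $\xi\in\nu M$ which vanishes on all other pairs from the orthogonal splitting $TM=\mathbb{R}Z\oplus(\mathfrak{C}\ominus\mathbb{R}Z)\oplus P(\nu M)$, i.e. $II(xZ+U+P\xi,\;yZ+V+P\eta)=\tfrac12\sin^2(\varphi)(y\xi+x\eta)$ for $x,y\in\mathbb{R}$, $U,V\in\mathfrak{C}\ominus\mathbb{R}Z$, $\xi,\eta\in\nu M$. Definition of $W^{2n-k}_\varphi$: fix $o\in\mathbb{C}H^n$ and a point $x$ in the ideal boundary $\mathbb{C}H^n(\infty)$, and let $SU(1,n)=KAN$ be the corresponding Iwasawa decomposition ($K$ the isotropy group at $o$; $A\cdot o$ the geodesic through $o$ converging to $x$; the orbits of $N$ the horospheres centered at $x$). $AN$ acts simply transitively on $\mathbb{C}H^n$, so $\mathbb{C}H^n$ is identified with $AN$ with a left-invariant metric and left-invariant $J$, and its Lie algebra $\mathfrak{a}+\mathfrak{n}=\mathfrak{a}+\mathfrak{g}_\alpha+\mathfrak{g}_{2\alpha}$ (orthogonal sum) with $T_o\mathbb{C}H^n$. Here $\mathfrak{a}=\mathbb{R}B$ with $B$ the unit vector at $o$ pointing to $x$, $\mathfrak{g}_{2\alpha}=\mathbb{R}JB$, $\mathfrak{g}_\alpha\cong\mathbb{C}^{n-1}$ is $J$-invariant, and with $Z_0=JB$ the nontrivial brackets are $[B,Z_0]=Z_0$, $2[B,U]=U$, $[U,V]=\langle JU,V\rangle Z_0$ for $U,V\in\mathfrak{g}_\alpha$. Let $\mathfrak{w}\subset\mathfrak{g}_\alpha$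 be a real linear subspace whose orthogonal complement $\mathfrak{w}^\perp=\mathfrak{g}_\alpha\ominus\mathfrak{w}$ has real dimension $k$ and constant Kähler angle $\varphi$. Then $\mathfrak{s}=\mathfrak{a}+\mathfrak{w}+\mathfrak{g}_{2\alpha}$ is a subalgebra; let $S\subset AN$ be the connected closed subgroup with Lie algebra $\mathfrak{s}$. Then $W^{2n-k}_\varphi:=S\cdot o$. Up to holomorphic congruence it does not depend on the choices. Two submanifolds are holomorphically congruent if a holomorphic isometry of $\mathbb{C}H^n$ maps one onto the other. *)

(* Defs.v *)
From HB Require Import structures.
From mathcomp Require Import all_boot all_order all_algebra.
From mathcomp Require Import all_classical all_reals all_analysis.
From mathcomp Require Import ring lra.

Set Implicit Arguments.
Unset Strict Implicit.
Unset Printing Implicit Defensive.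

Import Order.TTheory GRing.Theory Num.Theory.
Import numFieldNormedType.Exports.

Local Open Scope classical_set_scope.
Local Open Scope ring_scope.

(* C^oo on U: all iterated directional derivatives exist and are
   differentiable (hence continuous) at every point of U. *)
Definition smooth_on (R : realType) (V W : normedModType R)
    (U : set V) (f : V -> W) : Prop :=
  forall (vs : seq V) (p : V), U p ->
    differentiable (foldr (fun v (h : V -> W) => 'D_v h) f vs) p.

Definition ip_norm (R : realType) (E : lmodType R) (ip : E -> E -> R) (v : E) : R :=
  Num.sqrt (ip v v).

(* Orthogonal projection onto S; it is only used for finite-dimensional linear
   subspaces S and inner products ip, where y exists and is unique. *)
Definition orth_proj (R : realType) (E : lmodType R) (ip : E -> E -> R)
    (S : set E) (x : E) : E :=
  xget 0 [set y | S y /\ forall s, S s -> ip (x - y) s = 0].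

Definition const_kahler_angle (R : realType) (E : lmodType R)
    (ip : E -> E -> R) (J : E -> E) (S : set E) (phi : R) : Prop :=
  forall v, S v -> v != 0 ->
    ip_norm ip (orth_proj ip S (J v)) = cos phi * ip_norm ip v.

(* A Riemannian metric on a vector space V is given as g p u v, the inner
   product of u, v in T_p V = V; an almost complex structure as J p v. *)

(* Koszul formula for constant (hence commuting) vector fields u, v, w: this is
   nabla_u v at p for the Levi-Civita connection nabla of g. *)
Definition christoffel (R : realType) (V : normedModType R)
    (g : V -> V -> V -> R) (p u v : V) : V :=
  xget 0 [set x | forall w,
    2 * g p x w = 'D_u (fun q => g q v w) p + 'D_v (fun q => g q u w) p
                  - 'D_w (fun q => g q u v) p].

Definition holomorphic_isometry (R : realType) (V : normedModType R)
    (g : V -> V -> V -> R) (J : V -> V -> V) (f : V -> V) : Prop :=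
  [/\ smooth_on setT f,
      exists f', [/\ smooth_on setT f', cancel f f' & cancel f' f],
      forall p u v, g (f p) ('D_u f p) ('D_v f p) = g p u v &
      forall p v, 'D_(J p v) f p = J (f p) ('D_v f p)].

(* An m-dimensional submanifold of V is a topological space M with an injective
   map iota into V which, in suitable local parametrizations h of M, is a smooth
   immersion. M need not carry the topology induced by V; embedded submanifolds
   are the case where it does. *)

Definition local_param (R : realType) (V : normedModType R) (M : topologicalType)
    (m : nat) (iota : M -> V) (O : set 'rV[R]_m) (h : 'rV[R]_m -> M) : Prop :=
  [/\ open O,
      forall x y, O x -> O y -> h x = h y -> x = y,
      forall x, O x -> {for x, continuous h},
      forall O', open O' -> O' `<=` O -> open (h @` O') &
      smooth_on O (iota \o h) /\
      forall x, O x -> injective ('d (iota \o h) x)].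

Definition submanifold (R : realType) (V : normedModType R) (M : topologicalType)
    (m : nat) (iota : M -> V) : Prop :=
  injective iota /\
  forall q, exists (O : set 'rV[R]_m) h x,
    [/\ local_param iota O h, O x & h x = q].

(* Differentiability of c at the single parameter 0 is enough: such curves have
   the same velocities as smooth ones. *)
Definition has_velocity (R : realType) (V : normedModType R) (M : topologicalType)
    (iota : M -> V) (c : R -> M) (q : M) (v : V) : Prop :=
  [/\ c 0 = q, {for 0, continuous c} & is_derive (0 : R) 1 (iota \o c) v].

Definition tangent (R : realType) (V : normedModType R) (M : topologicalType)
    (iota : M -> V) (q : M) : set V :=
  [set v | exists c : R -> M, has_velocity iota c q v].

Definition normal (R : realType) (V : normedModType R) (M : topologicalType)
    (g : V -> V -> V -> R) (iota : M -> V) (q : M) : set V :=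
  [set xi | forall v, tangent iota q v -> g (iota q) xi v = 0].

(* The maximal complex distribution TM /\ J(TM). *)
Definition max_complex (R : realType) (V : normedModType R) (M : topologicalType)
    (J : V -> V -> V) (iota : M -> V) (q : M) : set V :=
  tangent iota q `&` (J (iota q) @` tangent iota q).

(* P xi, the tangential component of J xi. *)
Definition tangential_J (R : realType) (V : normedModType R) (M : topologicalType)
    (g : V -> V -> V -> R) (J : V -> V -> V) (iota : M -> V) (q : M) (xi : V) : V :=
  orth_proj (g (iota q)) (tangent iota q) (J (iota q) xi).

(* Y : M -> V is a V-valued vector field along iota, smooth on the open set U. *)
Definition smooth_field (R : realType) (V : normedModType R) (M : topologicalType)
    (m : nat) (iota : M -> V) (U : set M) (Y : M -> V) : Prop :=
  forall q, U q -> exists (O : set 'rV[R]_m) h x,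
    [/\ local_param iota O h, O x, h x = q & smooth_on O (Y \o h)].

(* II(v, Y) is the normal component of nabla_v Y, for local tangent fields Y;
   nabla_v Y is computed along a curve c with velocity v. Only the values of II
   on tangent vectors are constrained. *)
Definition is_second_ff (R : realType) (V : normedModType R) (M : topologicalType)
    (m : nat) (g : V -> V -> V -> R) (iota : M -> V)
    (II : M -> V -> V -> V) : Prop :=
  forall (U : set M) (Y : M -> V),
    open U -> smooth_field m iota U Y ->
    (forall q, U q -> tangent iota q (Y q)) ->
    forall q c v a, U q -> has_velocity iota c q v ->
      is_derive (0 : R) 1 (Y \o c) a ->
      II q v (Y q) =
        orth_proj (g (iota q)) (normal g iota q)
          (a + christoffel g (iota q) v (Y q)).

Definition unit_complex_field (R : realType) (V : normedModType R)
    (M : topologicalType) (m : nat) (g : V -> V -> V -> R) (J : V -> V -> V)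
    (iota : M -> V) (Z : M -> V) : Prop :=
  [/\ smooth_field m iota setT Z,
      forall q, max_complex J iota q (Z q) &
      forall q, g (iota q) (Z q) (Z q) = 1].

(* II is the trivial symmetric bilinear extension of
   2 II(Z, P xi) = sin^2(phi) xi. *)
Definition trivial_extension (R : realType) (V : normedModType R)
    (M : topologicalType) (g : V -> V -> V -> R) (J : V -> V -> V)
    (iota : M -> V) (phi : R) (Z : M -> V) (II : M -> V -> V -> V) : Prop :=
  forall (q : M) (x y : R) (U V' xi eta : V),
    max_complex J iota q U -> g (iota q) U (Z q) = 0 ->
    max_complex J iota q V' -> g (iota q) V' (Z q) = 0 ->
    normal g iota q xi -> normal g iota q eta ->
    II q (x *: Z q + U + tangential_J g J iota q xi)
         (y *: Z q + V' + tangential_J g J iota q eta)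
    = (2^-1 * sin phi ^+ 2) *: (y *: xi + x *: eta).

Definition const_kahler_normal (R : realType) (V : normedModType R)
    (M : topologicalType) (g : V -> V -> V -> R) (J : V -> V -> V)
    (iota : M -> V) (phi : R) : Prop :=
  forall q, const_kahler_angle (g (iota q)) (J (iota q)) (normal g iota q) phi.

Definition second_ff_of_this_form (R : realType) (V : normedModType R)
    (M : topologicalType) (m : nat) (g : V -> V -> V -> R) (J : V -> V -> V)
    (iota : M -> V) (phi : R) : Prop :=
  exists (Z : M -> V) (II : M -> V -> V -> V),
    [/\ unit_complex_field m g J iota Z, is_second_ff m g iota II &
        trivial_extension g J iota phi Z II].

(* A holomorphic isometry f identifies M, with its topology, with an open part
   of W. *)
Definition congruent_to_open_part (R : realType) (V : normedModType R)
    (M : topologicalType) (g : V -> V -> V -> R) (J : V -> V -> V)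
    (iota : M -> V) (W : set V) : Prop :=
  exists f, holomorphic_isometry g J f /\
    forall A : set M, open A ->
      exists B : set V, open B /\ (f \o iota) @` A = B `&` W.

(* g_alpha = C^(n-1), written as pairs (real part, imaginary part). *)
Notation galpha R n := ('rV[R]_n.-1 * 'rV[R]_n.-1)%type.

Definition dot_galpha (R : realType) (n : nat) (u v : galpha R n) : R :=
  \sum_i (u.1 0 i * v.1 0 i + u.2 0 i * v.2 0 i).

Definition J_galpha (R : realType) (n : nat) (u : galpha R n) : galpha R n :=
  (- u.2, u.1).

Lemma dot_galphaC (R : realType) (n : nat) (u v : galpha R n) :
  dot_galpha u v = dot_galpha v u.
Proof. by apply: eq_bigr => i _; ring. Qed.

Lemma dot_galphaDl (R : realType) (n : nat) (u v w : galpha R n) :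
  dot_galpha (u + v) w = dot_galpha u w + dot_galpha v w.
Proof.
rewrite /dot_galpha -big_split /=.
by apply: eq_bigr => i _; rewrite !mxE; ring.
Qed.

Lemma dot_galphaZl (R : realType) (n : nat) (a : R) (u w : galpha R n) :
  dot_galpha (a *: u) w = a * dot_galpha u w.
Proof.
rewrite /dot_galpha mulr_sumr.
by apply: eq_bigr => i _; rewrite !mxE; ring.
Qed.

Lemma dot_galphaDr (R : realType) (n : nat) (u v w : galpha R n) :
  dot_galpha w (u + v) = dot_galpha w u + dot_galpha w v.
Proof. by rewrite dot_galphaC dot_galphaDl !(dot_galphaC w). Qed.

Lemma dot_galphaZr (R : realType) (n : nat) (a : R) (u w : galpha R n) :
  dot_galpha w (a *: u) = a * dot_galpha w u.
Proof. by rewrite dot_galphaC dot_galphaZl dot_galphaC. Qed.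

Lemma dot_galpha0r (R : realType) (n : nat) (u : galpha R n) : dot_galpha u 0 = 0.
Proof. by rewrite -(scale0r (0 : galpha R n)) dot_galphaZr mul0r. Qed.

Lemma J_galphaD (R : realType) (n : nat) (u v : galpha R n) :
  J_galpha (u + v) = J_galpha u + J_galpha v.
Proof. by congr (_, _); rewrite /= opprD. Qed.

Lemma J_galphaZ (R : realType) (n : nat) (a : R) (u : galpha R n) :
  J_galpha (a *: u) = a *: J_galpha u.
Proof. by congr (_, _); rewrite /= scalerN. Qed.

Lemma dot_galphaJC (R : realType) (n : nat) (u v : galpha R n) :
  dot_galpha (J_galpha u) v = - dot_galpha (J_galpha v) u.
Proof.
rewrite /dot_galpha -sumrN.
by apply: eq_bigr => i _; rewrite /= !mxE; ring.
Qed.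

Lemma dot_galphaJ (R : realType) (n : nat) (u : galpha R n) :
  dot_galpha (J_galpha u) u = 0.
Proof. by have := dot_galphaJC u u; lra. Qed.

(* (a, u, b) stands for a B + u + b Z_0 in the Lie algebra a + g_alpha + g_2alpha,
   and also for exp(u + b Z_0) exp(a B) in AN, a global chart in which o = 0.
   CH^n is AN with the left-invariant metric and complex structure. *)
Notation CH R n := (R * galpha R n * R)%type.

Definition dot_an (R : realType) (n : nat) (X Y : CH R n) : R :=
  X.1.1 * Y.1.1 + dot_galpha X.1.2 Y.1.2 + X.2 * Y.2.

Definition J_an (R : realType) (n : nat) (X : CH R n) : CH R n :=
  (- X.2, J_galpha X.1.2, X.1.1).

Definition bracket_an (R : realType) (n : nat) (X Y : CH R n) : CH R n :=
  (0,
   (X.1.1 / 2) *: Y.1.2 - (Y.1.1 / 2) *: X.1.2,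
   X.1.1 * Y.2 - Y.1.1 * X.2 + dot_galpha (J_galpha X.1.2) Y.1.2).

Definition mul_AN (R : realType) (n : nat) (p q : CH R n) : CH R n :=
  (p.1.1 + q.1.1,
   p.1.2 + expR (p.1.1 / 2) *: q.1.2,
   p.2 + expR p.1.1 * q.2
     + 2^-1 * expR (p.1.1 / 2) * dot_galpha (J_galpha p.1.2) q.1.2).

Definition inv_AN (R : realType) (n : nat) (p : CH R n) : CH R n :=
  (- p.1.1, - (expR (- p.1.1 / 2) *: p.1.2), - (expR (- p.1.1) * p.2)).

Lemma mul_ANA (R : realType) (n : nat) (p q r : CH R n) :
  mul_AN p (mul_AN q r) = mul_AN (mul_AN p q) r.
Proof.
case: p q r => [[a u] s] [[b v] t] [[c w] x]; rewrite /mul_AN /=.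
congr (_, _, _); first by rewrite addrA.
  by rewrite scalerDr scalerA -expRD -mulrDl addrA.
rewrite J_galphaD J_galphaZ !dot_galphaDl !dot_galphaDr !dot_galphaZl !dot_galphaZr.
have -> : (a + b) / 2 = a / 2 + b / 2 by rewrite mulrDl.
have Ea : expR a = expR (a / 2) * expR (a / 2) by rewrite -expRD -splitr.
rewrite !expRD Ea.
set A := expR (a / 2); set B := expR (b / 2); ring.
Qed.

Lemma mul_AN0 (R : realType) (n : nat) (p : CH R n) : mul_AN p 0 = p.
Proof.
case: p => [[a u] s]; rewrite /mul_AN /= !addr0 scaler0 mulr0 addr0.
by rewrite dot_galpha0r mulr0 !addr0.
Qed.

Lemma mul_VAN (R : realType) (n : nat) (p : CH R n) : mul_AN (inv_AN p) p = 0.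
Proof.
case: p => [[a u] s]; rewrite /mul_AN /inv_AN /= addNr addNr.
rewrite -(scaleNr _ u) J_galphaZ dot_galphaZl dot_galphaJ !mulr0 addr0.
by rewrite !addNr.
Qed.

(* The left-invariant vector field with value X at o. *)
Definition left_inv (R : realType) (n : nat) (X p : CH R n) : CH R n :=
  'D_X (mul_AN p) 0.

Lemma cvg_CH (R : realType) (n : nat) (F : set_system R) {FF : Filter F}
    (f1 f3 : R -> R) (f2 : R -> galpha R n) (l1 l3 : R) (l2 : galpha R n) :
  f1 @ F --> l1 -> f2 @ F --> l2 -> f3 @ F --> l3 ->
  (fun h => (f1 h, f2 h, f3 h) : CH R n) @ F --> ((l1, l2, l3) : CH R n).
Proof. by move=> c1 c2 c3; exact: (cvg_pair (cvg_pair c1 c2) c3). Qed.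

Lemma left_invE (R : realType) (n : nat) (X p : CH R n) :
  left_inv X p = (X.1.1, expR (p.1.1 / 2) *: X.1.2,
    expR p.1.1 * X.2
      + 2^-1 * expR (p.1.1 / 2) * dot_galpha (J_galpha p.1.2) X.1.2).
Proof.
rewrite /left_inv /derive; apply: (@cvg_lim (CH R n : normedModType R)); first exact: norm_hausdorff.
apply: (@cvg_near_cst _ _ _ _ (0^')).
near=> h.
have h0 : h != 0 by near: h; exact: nbhs_dnbhs_neq.
rewrite /= addr0 mul_AN0.
case: X p => [[a x] b] [[t u] s] /=; rewrite /mul_AN /=.
congr (_, _, _) => /=.
- by rewrite addrC addKr /GRing.scale /= mulKf.
- by rewrite addrC addKr !scalerA mulrAC mulVf // mul1r.
- rewrite dot_galphaZr; set e := expR (t / 2); set E := expR t.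
  rewrite /GRing.scale /=; by field.
Unshelve. all: by end_near.
Qed.

(* The Lie algebra bracket of left-invariant fields: [B, Z_0] = Z_0,
   2 [B, U] = U, [U, V] = <JU, V> Z_0. *)
Lemma left_inv_bracket (R : realType) (n : nat) (X Y : CH R n) :
  'D_X (left_inv Y) 0 - 'D_Y (left_inv X) 0 = bracket_an X Y.
Proof.
have D X' Y' : 'D_X' (left_inv Y') 0 = (0 : R, (X'.1.1 / 2) *: Y'.1.2,
    X'.1.1 * Y'.2 + 2^-1 * dot_galpha (J_galpha X'.1.2) Y'.1.2) :> CH R n.
  move: X' Y' => [[a x] b] [[a' x'] b'] /=.
  set d := dot_galpha _ _.
  pose f2 (h : R) := expR (h * a / 2).
  pose f3 (h : R) := expR (h * a) * b' + 2^-1 * expR (h * a / 2) * (h * d).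
  have F2 : is_derive (0 : R) 1 f2 (a / 2).
    rewrite /f2; apply: is_derive_eq; rewrite /GRing.scale /=.
    by rewrite !(mul0r, expR0); ring.
  have F3 : is_derive (0 : R) 1 f3 (a * b' + 2^-1 * d).
    rewrite /f3; apply: is_derive_eq; rewrite /GRing.scale /=.
    by rewrite !(mul0r, expR0); ring.
  have Q (f : R -> R) l : is_derive (0 : R) 1 f l ->
      h^-1 * (f h - f 0) @[h --> 0^'] --> l.
    move=> [df <-]; have := df; rewrite /derivable => /cvg_ex[l' c].
    have -> : 'D_1 f 0 = l' by rewrite /derive; apply: cvg_lim.
    apply: cvg_trans c; apply: near_eq_cvg; near=> h => /=.
    by rewrite /GRing.scale /= mulr1 addr0.
  rewrite /derive; apply: (@cvg_lim (CH R n : normedModType R)); first exact: norm_hausdorff.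
  apply: (@cvg_trans _ ((0 : R, (h^-1 * (f2 h - f2 0)) *: x',
                         h^-1 * (f3 h - f3 0)) @[h --> 0^'])).
    apply: near_eq_cvg; near=> h; rewrite /= !left_invE addr0 /=.
    congr (_, _, _) => /=.
    - by rewrite subrr scaler0.
    - by rewrite /f2 !mul0r -scalerBl scalerA.
    - rewrite J_galphaZ dot_galphaZl -/d /f3 /GRing.scale /= !mul0r.
      by rewrite -(scale0r (0 : galpha R n)) J_galphaZ dot_galphaZl !mul0r mulr0.
  have K2 : (h^-1 * (f2 h - f2 0)) *: x' @[h --> 0^'] --> (a / 2) *: x'.
    by apply: cvgZr_tmp; exact: Q.
  have K1 : (fun=> 0 : R) h @[h --> (0 : R)^'] --> (0 : R) by exact: cvg_cst.
  exact: (cvg_CH K1 K2 (Q _ _ F3)).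
apply: etrans (congr2 (fun A B : CH R n => A - B) (D X Y) (D Y X)) _.
case: X Y {D} => [[a x] b] [[a' x'] b'] /=; congr (_, _, _) => /=.
- by rewrite subrr.
- by rewrite (dot_galphaJC x' x); field.
Unshelve. all: by end_near.
Qed.

(* The left translate to T_o of a tangent vector v at p. *)
Definition maurer_cartan (R : realType) (n : nat) (p v : CH R n) : CH R n :=
  'D_v (mul_AN (inv_AN p)) p.

Definition metric (R : realType) (n : nat) (p u v : CH R n) : R :=
  dot_an (maurer_cartan p u) (maurer_cartan p v).

Definition cplx (R : realType) (n : nat) (p v : CH R n) : CH R n :=
  left_inv (J_an (maurer_cartan p v)) p.

Definition subgroup_AN (R : realType) (n : nat) (H : set (CH R n)) : Prop :=
  [/\ H 0, forall p q, H p -> H q -> H (mul_AN p q) &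
      forall p, H p -> H (inv_AN p)].

Definition one_param (R : realType) (n : nat) (c : R -> CH R n) (X : CH R n) : Prop :=
  (forall s t, c (s + t) = mul_AN (c s) (c t)) /\ is_derive (0 : R) 1 c X.

(* The connected Lie subgroup of AN with Lie algebra s, as the subgroup generated
   by the one-parameter subgroups of AN tangent to s. *)
Definition connected_subgroup (R : realType) (n : nat) (s : set (CH R n)) :
    set (CH R n) :=
  [set p | forall H, subgroup_AN H ->
     (forall c X, one_param c X -> s X -> forall t, H (c t)) -> H p].

(* w is a real subspace of g_alpha whose orthogonal complement wperp has
   dimension k and constant Kaehler angle phi. *)
Definition admissible (R : realType) (n k : nat) (phi : R)
    (w : {vspace galpha R n}) : Prop :=
  exists wperp : {vspace galpha R n},
    [/\ forall u, u \in wperp <-> (forall v, v \in w -> dot_galpha u v = 0),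
        \dim wperp = k &
        const_kahler_angle (@dot_galpha R n) (@J_galpha R n)
          [set` wperp] phi].

(* W = S . o, where S has Lie algebra a + w + g_2alpha. *)
Definition W_sub (R : realType) (n : nat) (w : {vspace galpha R n}) : set (CH R n) :=
  [set mul_AN p 0 | p in connected_subgroup [set X : CH R n | X.1.2 \in w]].

(* Main.v *)
From HB Require Import structures.
Require Import Defs.
From mathcomp Require Import all_boot all_order all_algebra.
From mathcomp Require Import all_classical all_reals all_analysis.
From mathcomp Require Import ring lra zify.

Set Implicit Arguments.
Unset Strict Implicit.
Unset Printing Implicit Defensive.

Import Order.TTheory GRing.Theory Num.Theory.
Import numFieldNormedType.Exports.

Local Open Scope classical_set_scope.
Local Open Scope ring_scope.


(** Left translation identifies all tangent spaces of CH^n = AN with the Lie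
algebra, and the Levi-Civita connection becomes an explicit bilinear map. The
hypothesis on II says that the connection [nabla_X Y + 1/2 (<X,Z> JY + <Y,Z> JX)]
preserves TM. Comparing its curvature with that of CH^n on vectors X, JX with JX
not tangent forces [nabla_X Z = - 1/2 (JX + <X,Z> JZ + <X,JZ> Z)], which is the
equation satisfied by the left-invariant field Z_0. A holomorphic isometry f, built
from left translations and the inversion of the Siegel domain, maps Z to Z_0 at one
point; as the equation determines Z along curves and is preserved by isometries,
Gronwall's lemma and connectedness give f_* Z = Z_0 everywhere. The connection above then shows
that the g_alpha-parts of the translated tangent spaces of f(M) all equal one subspace
w, so that f(M) lies, after a translation, in W = {(a, u, b) | u in w}, and it is open
there by an inverse function argument. Subspaces of equal dimension and constant
Kaehler angle are exchanged by a unitary map of g_alpha, by Witt's theorem, and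
unitary maps extend to holomorphic isometries of CH^n. *)

(** * Smooth maps *)

(** The connection has its origin in the fact that the normal part of [J (P xi)] is [- sin^2 phi]
    times [xi]. This turns the hypothesis into: [II(X, Y)] is minus the normal part of
    [1/2 (<X,Z> JY + <Y,Z> JX)], so adding that correction to nabla cancels II. In the curvature of
    the corrected connection every term with J carries a factor measuring the failure of the
    equation for Z, which is why one vector X with JX not tangent suffices to force the equation.
    Such a vector comes from a nonzero normal vector, so codimension zero is treated apart; there M
    is open in CH^n. The inversion is indispensable: left translations by AN have identity
    differential in the trivialization and unitary maps of g_alpha fix B and Z_0, so neither moves
    the point at infinity that Z singles out. Differential equations are used only for uniqueness,
    along segments in a chart, and openness in W is obtained by minimizing a distance. As M need not
    carry the induced topology, tangent vectors, defined by curves in M, must be shown to form the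
    range of the differential of a chart. *)

Section Differentiation.
Variable R : realType.
Implicit Types U V W E : normedModType R.

Lemma near_eq_differentiable V W (f g : V -> W) (p : V) :
  (\near p, f p = g p) -> differentiable f p -> differentiable g p.
Proof.
move=> fg df.
have fgp : f p = g p by exact: nbhs_singleton fg.
apply/diff_locallyP; suff H : continuous ('d f p) /\
  g \o shift p = cst (g p) + 'd f p +o_ 0 id.
  have e := @diff_unique _ _ _ g ('d f p) p H.1 H.2.
  by rewrite e.
split; first exact: diff_continuous.
apply/eqaddoP => _/posnumP[e].
have := diff_locally df; move=> /eqaddoP /(_ _ (gt0 e)) h.
have fg0 : \forall x \near (0 : V), f (x + p) = g (x + p).
  by move: fg; rewrite (near_shift 0 p) subr0.
apply: filterS2 h fg0 => x /=; rewrite !fctE /= => h <-.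
by rewrite -fgp.
Qed.

Lemma derive_lin V W E (L : W -> E) (f : V -> W) (p v : V) :
  linear L -> continuous L -> differentiable f p ->
  differentiable (L \o f) p /\ 'D_v (L \o f) p = L ('D_v f p).
Proof.
move=> lL cL df; pose LM := GRing.isLinear.Build _ _ _ _ _ lL.
pose L' : {linear W -> E} := HB.pack L LM.
have dL : differentiable L (f p) by apply: (@linear_differentiable _ _ _ L').
have dc : differentiable (L \o f) p by exact: differentiable_comp.
split => //; rewrite !deriveE //; rewrite diff_comp //=.
by rewrite (@diff_lin _ _ _ L').
Qed.

Lemma derive_pair V W E (f : V -> W) (g : V -> E) (p v : V) :
  differentiable f p -> differentiable g p ->
  differentiable (fun x => (f x, g x)) p /\
  'D_v (fun x => (f x, g x)) p = ('D_v f p, 'D_v g p).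
Proof.
move=> df dg; have d := differentiable_pair df dg.
by split => //; rewrite !deriveE // diff_pair.
Qed.

(** Unbundled, so that [dot_an], [lc] and scaling qualify as plain functions; joint continuity takes
    the place of a norm bound. *)
Definition bounded_bilinear U V W (B : U -> V -> W) :=
  [/\ forall u, linear (B u), forall v, linear (B^~ v) &
      continuous (fun q : U * V => B q.1 q.2)].

Lemma derive_bil U V W E (B : V -> W -> E) (f : U -> V) (g : U -> W) (p v : U) :
  bounded_bilinear B -> differentiable f p -> differentiable g p ->
  differentiable (fun x => B (f x) (g x)) p /\
  'D_v (fun x => B (f x) (g x)) p = B ('D_v f p) (g p) + B (f p) ('D_v g p).
Proof.
move=> [lr ll cB] df dg.
have bB : bilinear_for
    (GRing.Scale.Law.clone _ _ *:%R _) (GRing.Scale.Law.clone _ _ *:%R _) B.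
  by split=> [u'|u] a x y /=; [rewrite ll|rewrite lr].
pose BM := bilinear_isBilinear.Build R V W E _ _ B bB.
pose B' : {bilinear V -> W -> E} := HB.pack B BM.
have dB := @differentiable_bilin _ _ _ _ B' (f p, g p) cB.
have [dP dE] := derive_pair v df dg.
have e : (fun x => B (f x) (g x)) = (fun q => B' q.1 q.2) \o (fun x => (f x, g x)) by [].
have d : differentiable (fun x => B (f x) (g x)) p by rewrite e; exact: differentiable_comp.
split => //; rewrite (deriveE v d) e diff_comp //.
rewrite -[LHS]/('d (fun q => B' q.1 q.2) (f p, g p) ('d (fun x => (f x, g x)) p v)).
by rewrite diff_bilin // -deriveE // dE /= addrC.
Qed.

Lemma derive_comp_real V (F : R -> R) (f : V -> R) (dF : R) (p v : V) :
  is_derive (f p) 1 F dF -> differentiable f p ->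
  differentiable (F \o f) p /\ 'D_v (F \o f) p = 'D_v f p * dF.
Proof.
move=> [dF1 dF2] df; have dF' : differentiable F (f p) by apply/derivable1_diffP.
have d : differentiable (F \o f) p by exact: differentiable_comp.
split => //; rewrite !deriveE // diff_comp //= deriv1E //.
by rewrite derive1E dF2.
Qed.

Lemma derive_addf V W (f g : V -> W) (p v : V) :
  differentiable f p -> differentiable g p ->
  differentiable (fun x => f x + g x) p /\
  'D_v (fun x => f x + g x) p = 'D_v f p + 'D_v g p.
Proof.
move=> df dg; split; first exact: differentiableD.
by have := @deriveD _ _ _ f g p v (diff_derivable df) (diff_derivable dg).
Qed.

(** Finite stages of [smooth_on]. Closure under products and compositions goes by induction on k for
    all functions at once, because the Leibniz and chain rules produce new factors at every
    order. *)
Fixpoint Ck (k : nat) V W (U : set V) (f : V -> W) : Prop :=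
  (forall p, U p -> differentiable f p) /\
  (if k is k'.+1 then forall v, Ck k' U ('D_v f) else True).

Lemma smooth_onP V W (U : set V) (f : V -> W) :
  smooth_on U f <-> forall k, Ck k U f.
Proof.
split=> [h k|h].
  elim: k f h => [|k IH] f h /=; split=> //; try by move=> p; exact: (h [::]).
  (* [foldr] applies the last direction of the list first, so differentiating f itself appends v at
     the end. *)
  move=> v; apply: IH => vs p; have := h (rcons vs v) p.
  by rewrite foldr_rcons.
move=> vs p Up; elim/last_ind: vs f h => [|vs v IH] f h /=.
  by have [H _] := h 0; exact: H.
rewrite foldr_rcons; apply: IH => k; by have [_ /=] := h k.+1; apply.
Qed.

Lemma Ck_le k V W (U : set V) (f : V -> W) : Ck k.+1 U f -> Ck k U f.
Proof.
elim: k f => [|k IH] f; first by case.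
by move=> [d h]; split=> // v; apply: IH; exact: h.
Qed.

Lemma Ck_ext k V W (U : set V) (f g : V -> W) : open U ->
  (forall x, U x -> f x = g x) -> Ck k U f -> Ck k U g.
Proof.
move=> oU; elim: k f g => [|k IH] f g fg [d h].
  by split=> // p Up; apply: near_eq_differentiable (d p Up); move: (oU);
     rewrite openE => /(_ p Up); apply: filterS.
have nr p : U p -> \near p, f p = g p.
  by move=> Up; move: (oU); rewrite openE => /(_ p Up); apply: filterS.
split=> [p Up|v]; first exact: near_eq_differentiable (nr p Up) (d p Up).
apply: IH (h v) => p Up; apply: near_eq_derive.
exact: nr.
Qed.

Lemma smooth_on_ext V W (U : set V) (f g : V -> W) : open U ->
  (forall x, U x -> f x = g x) -> smooth_on U f -> smooth_on U g.
Proof. by move=> oU fg /smooth_onP h; apply/smooth_onP => k; exact: Ck_ext (h k). Qed.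

Lemma smooth_on_sub V W (U U' : set V) (f : V -> W) :
  U' `<=` U -> smooth_on U f -> smooth_on U' f.
Proof. by move=> s h vs p /s; exact: h. Qed.

Lemma smooth_on_diff V W (U : set V) (f : V -> W) p :
  smooth_on U f -> U p -> differentiable f p.
Proof. by move=> h; exact: (h [::]). Qed.

Lemma smooth_on_derive V W (U : set V) (f : V -> W) v :
  smooth_on U f -> smooth_on U ('D_v f).
Proof. by move=> h vs p; rewrite -foldr_rcons; exact: h. Qed.

Lemma smooth_on_cst V W (U : set V) (c : W) : smooth_on U (fun=> c).
Proof.
apply/smooth_onP => k; elim: k c => [|k IH] c; split=> //; try by
  move=> p _; exact: differentiable_cst.
move=> v; have -> : 'D_v (fun=> c : W) = (fun=> 0 : W) :> (V -> W); last exact: IH.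
by apply/funext => x; rewrite derive_cst.
Qed.

Lemma Ck_lin k V W E (U : set V) (L : W -> E) (f : V -> W) : open U ->
  linear L -> continuous L -> Ck k U f -> Ck k U (L \o f).
Proof.
move=> oU lL cL; elim: k f => [|k IH] f [d h]; split=> //; try by
  move=> p /d dp; have [] := derive_lin 0 lL cL dp.
move=> v; apply: (@Ck_ext _ _ _ _ (L \o 'D_v f)) => //; last exact: IH (h v).
by move=> p /d dp; have [] := derive_lin v lL cL dp.
Qed.

Lemma smooth_on_lin V W E (U : set V) (L : W -> E) (f : V -> W) : open U ->
  linear L -> continuous L -> smooth_on U f -> smooth_on U (L \o f).
Proof. by move=> ? ? ? /smooth_onP h; apply/smooth_onP => k; exact: Ck_lin. Qed.

Lemma smooth_on_id V (U : set V) : open U -> smooth_on U (id : V -> V).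
Proof.
move=> oU; apply/smooth_onP => -[|k]; split=> //; try by move=> p _; exact: ex_diff.
move=> v; have -> : 'D_v (id : V -> V) = (fun=> v) by apply/funext => x; rewrite derive_id.
by move/smooth_onP: (@smooth_on_cst V V U v).
Qed.

Lemma Ck_pair k V W E (U : set V) (f : V -> W) (g : V -> E) : open U ->
  Ck k U f -> Ck k U g -> Ck k U (fun x => (f x, g x)).
Proof.
move=> oU; elim: k f g => [|k IH] f g [df hf] [dg hg]; split=> //; try by
  move=> p Up; have [] := derive_pair 0 (df p Up) (dg p Up).
move=> v; apply: (@Ck_ext _ _ _ _ (fun x => ('D_v f x, 'D_v g x))) => //;
  last exact: IH (hf v) (hg v).
by move=> p Up; have [] := derive_pair v (df p Up) (dg p Up).
Qed.

Lemma smooth_on_pair V W E (U : set V) (f : V -> W) (g : V -> E) : open U ->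
  smooth_on U f -> smooth_on U g -> smooth_on U (fun x => (f x, g x)).
Proof.
by move=> ? /smooth_onP h /smooth_onP h'; apply/smooth_onP => k; exact: Ck_pair.
Qed.

Lemma Ck_add k V W (U : set V) (f g : V -> W) : open U ->
  Ck k U f -> Ck k U g -> Ck k U (fun x => f x + g x).
Proof.
move=> oU; elim: k f g => [|k IH] f g [df hf] [dg hg]; split=> //; try by
  move=> p Up; have [] := derive_addf 0 (df p Up) (dg p Up).
move=> v; apply: (@Ck_ext _ _ _ _ (fun x => 'D_v f x + 'D_v g x)) => //;
  last exact: IH (hf v) (hg v).
by move=> p Up; have [] := derive_addf v (df p Up) (dg p Up).
Qed.

Lemma smooth_on_add V W (U : set V) (f g : V -> W) : open U ->
  smooth_on U f -> smooth_on U g -> smooth_on U (fun x => f x + g x).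
Proof.
by move=> ? /smooth_onP h /smooth_onP h'; apply/smooth_onP => k; exact: Ck_add.
Qed.

Lemma Ck_bil k U V W E (O : set U) (B : V -> W -> E) (f : U -> V) (g : U -> W) :
  open O -> bounded_bilinear B -> Ck k O f -> Ck k O g ->
  Ck k O (fun x => B (f x) (g x)).
Proof.
move=> oU bB; elim: k f g => [|k IH] f g F G; move: (F) (G) => [df hf] [dg hg];
  split=> //; try by
  move=> p Up; have [] := derive_bil 0 bB (df p Up) (dg p Up).
move=> v; apply: (@Ck_ext _ _ _ _
    (fun x => B ('D_v f x) (g x) + B (f x) ('D_v g x))) => //.
  by move=> p Up; have [] := derive_bil v bB (df p Up) (dg p Up).
(* In each summand one factor has been differentiated; the other has an order to spare, which
   [Ck_le] drops. *)
by apply: Ck_add => //; apply: IH; [exact: hf|exact: Ck_le G|exact: Ck_le F|exact: hg].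
Qed.

Lemma smooth_on_bil U V W E (O : set U) (B : V -> W -> E) (f : U -> V) (g : U -> W) :
  open O -> bounded_bilinear B -> smooth_on O f -> smooth_on O g ->
  smooth_on O (fun x => B (f x) (g x)).
Proof.
by move=> ? ? /smooth_onP h /smooth_onP h'; apply/smooth_onP => k; exact: Ck_bil.
Qed.

Lemma bounded_bilinear_scale V : bounded_bilinear (fun (a : R) (v : V) => a *: v).
Proof.
split=> [a b u v|v b x y|]; last exact: scale_continuous.
  by rewrite scalerDr !scalerA mulrC.
by rewrite scalerDl scalerA.
Qed.

Lemma smooth_on_scale V W (U : set V) (f : V -> R) (g : V -> W) : open U ->
  smooth_on U f -> smooth_on U g -> smooth_on U (fun x => f x *: g x).
Proof. by move=> oU; apply: smooth_on_bil => //; exact: bounded_bilinear_scale. Qed.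

Lemma smooth_on_mul V (U : set V) (f g : V -> R) : open U ->
  smooth_on U f -> smooth_on U g -> smooth_on U (fun x => f x * g x).
Proof. exact: (@smooth_on_scale V R). Qed.

Lemma smooth_on_opp V W (U : set V) (f : V -> W) : open U ->
  smooth_on U f -> smooth_on U (fun x => - f x).
Proof.
move=> oU; apply: (@smooth_on_lin _ _ _ _ -%R) => //; last exact: opp_continuous.
by move=> a x y; rewrite opprD scalerN.
Qed.

Lemma smooth_on_sub_fun V W (U : set V) (f g : V -> W) : open U ->
  smooth_on U f -> smooth_on U g -> smooth_on U (fun x => f x - g x).
Proof. by move=> oU sf sg; apply: smooth_on_add => //; exact: smooth_on_opp. Qed.

(** The derivative is ['D_v f] times the function itself, so the induction on k feeds on the same
    statement one order lower. [smooth_on_inv] follows the same pattern. *)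
Lemma smooth_on_exp V (U : set V) (f : V -> R) : open U ->
  smooth_on U f -> smooth_on U (fun x => expR (f x)).
Proof.
move=> oU /smooth_onP sf; apply/smooth_onP => k.
have D v p : U p -> differentiable (expR \o f) p /\
    'D_v (expR \o f) p = 'D_v f p * expR (f p).
  move=> Up; apply: derive_comp_real; last by have [d _] := sf 0; exact: d.
elim: k => [|k IH]; split=> //; try by move=> p /(D 0)[].
move=> v.
apply: (@Ck_ext _ _ _ _ (fun x => 'D_v f x * expR (f x))) => //.
  by move=> p /(D v)[].
apply: (@Ck_bil _ _ _ _ _ _ _ ('D_v f) (expR \o f) _ (bounded_bilinear_scale R)) => //.
by have [_ h] := sf k.+1; exact: h.
Qed.

Lemma smooth_on_inv V (U : set V) (f : V -> R) : open U ->
  (forall x, U x -> f x != 0) ->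
  smooth_on U f -> smooth_on U (fun x => (f x)^-1).
Proof.
move=> oU f0 /smooth_onP sf; apply/smooth_onP => k.
have D v p : U p -> differentiable (GRing.inv \o f) p /\
    'D_v (GRing.inv \o f) p = 'D_v f p * - ((f p)^-1 * (f p)^-1).
  move=> Up; apply: derive_comp_real; last by have [d _] := sf 0; exact: d.
  have fp := f0 _ Up; split.
    by apply: (@derivableV _ _ (id : R -> R)) => //; exact: derivable_id.
  have di : derivable (id : R -> R) (f p) 1 by exact: derivable_id.
  by rewrite (@deriveV _ _ (id : R -> R) (f p) 1 fp di) derive_id /GRing.scale /= mulr1 -invfM.
elim: k => [|k IH]; split=> //; try by move=> p /(D 0)[].
move=> v.
apply: (@Ck_ext _ _ _ _ (fun x => 'D_v f x * - ((f x)^-1 * (f x)^-1))) => //.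
  by move=> p /(D v)[].
have M (g h : V -> R) : Ck k U g -> Ck k U h -> Ck k U (fun x => g x * h x).
  by apply: (@Ck_bil _ _ _ _ _ _ _ g h _ (bounded_bilinear_scale R)).
apply: (M); first by have [_ h] := sf k.+1; exact: h.
apply: (@Ck_lin _ _ _ _ _ -%R); [exact: oU| |exact: opp_continuous|exact: M].
by move=> a x y; rewrite opprD scalerN.
Qed.

Lemma smooth_on_ln V (U : set V) (f : V -> R) : open U ->
  (forall x, U x -> 0 < f x) ->
  smooth_on U f -> smooth_on U (fun x => ln (f x)).
Proof.
move=> oU f0 sf; apply/smooth_onP => k.
have D v p : U p -> differentiable (@ln R \o f) p /\
    'D_v (@ln R \o f) p = 'D_v f p * (f p)^-1.
  move=> Up; apply: derive_comp_real; last exact: smooth_on_diff sf Up.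
  by apply: is_derive1_ln; exact: f0.
case: k => [|k]; split=> //; try by move=> p /(D 0)[].
move=> v.
apply: (@Ck_ext _ _ _ _ (fun x => 'D_v f x * (f x)^-1)) => //.
  by move=> p /(D v)[].
move: k; apply/smooth_onP; apply: smooth_on_mul => //; first exact: smooth_on_derive.
by apply: smooth_on_inv => // x /f0; rewrite lt_neqAle eq_sym => /andP[].
Qed.

End Differentiation.

(** * The Lie algebra of AN *)

Section Algebra.
Variables (R : realType) (n : nat).
Implicit Types (u v w t : galpha R n) (x y z : CH R n) (a b : R).
Local Notation Jg := (@J_galpha R n).
Local Notation "<| u , v |>" := (dot_galpha u v).

Lemma dot_galphaNl u v : <|- u, v|> = - <|u, v|>.
Proof. by rewrite -scaleN1r dot_galphaZl mulN1r. Qed.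

Lemma dot_galphaNr u v : <|u, - v|> = - <|u, v|>.
Proof. by rewrite dot_galphaC dot_galphaNl dot_galphaC. Qed.

Lemma dot_galpha0l u : <|0, u|> = 0.
Proof. by rewrite dot_galphaC dot_galpha0r. Qed.

Lemma J_galphaN u : Jg (- u) = - Jg u.
Proof. by rewrite -(scaleN1r u) J_galphaZ scaleN1r. Qed.

Lemma J_galphaK u : Jg (Jg u) = - u.
Proof. by case: u. Qed.

Lemma dot_galphaJr u v : <|u, Jg v|> = - <|Jg u, v|>.
Proof. by rewrite dot_galphaC dot_galphaJC. Qed.

Lemma dot_galphaJJ u v : <|Jg u, Jg v|> = <|u, v|>.
Proof. by rewrite dot_galphaJr J_galphaK dot_galphaNl opprK. Qed.

Lemma dot_galpha_ge0 u : 0 <= <|u, u|>.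
Proof. by apply: sumr_ge0 => i _; rewrite addr_ge0 // -expr2 sqr_ge0. Qed.

Lemma dot_galpha_eq0 u : <|u, u|> = 0 -> u = 0.
Proof.
move=> h; have {}h i : u.1 0 i * u.1 0 i + u.2 0 i * u.2 0 i = 0.
  apply: (psumr_eq0P _ h) => // j _; by rewrite addr_ge0 // -expr2 sqr_ge0.
have k i : u.1 0 i = 0 /\ u.2 0 i = 0.
  have := h i; split; nra.
case: u h k => u1 u2 /= _ k; congr pair; apply/rowP => i; rewrite mxE;
  by have [] := k i.
Qed.

Definition dot_galphaE := (dot_galphaDl, dot_galphaDr, dot_galphaZl,
  dot_galphaZr, dot_galphaNl, dot_galphaNr, dot_galpha0l, dot_galpha0r).
Definition J_galphaE := (J_galphaD, J_galphaZ, J_galphaN, J_galphaK).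

Local Notation "<< x , y >>" := (dot_an x y).
Local Notation J := (@J_an R n).

Lemma dot_anC x y : << x, y >> = << y, x >>.
Proof. by rewrite /dot_an (dot_galphaC x.1.2); ring. Qed.

Lemma dot_anDl x y z : << x + y, z >> = << x, z >> + << y, z >>.
Proof. by rewrite /dot_an /= dot_galphaDl; ring. Qed.

Lemma dot_anZl a x z : << a *: x, z >> = a * << x, z >>.
Proof. by rewrite /dot_an /= dot_galphaZl /GRing.scale /=; ring. Qed.

Lemma dot_anDr x y z : << z, x + y >> = << z, x >> + << z, y >>.
Proof. by rewrite dot_anC dot_anDl !(dot_anC z). Qed.

Lemma dot_anZr a x z : << z, a *: x >> = a * << z, x >>.
Proof. by rewrite dot_anC dot_anZl dot_anC. Qed.

Lemma dot_anNl x z : << - x, z >> = - << x, z >>.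
Proof. by rewrite -scaleN1r dot_anZl mulN1r. Qed.

Lemma dot_anNr x z : << z, - x >> = - << z, x >>.
Proof. by rewrite dot_anC dot_anNl dot_anC. Qed.

Lemma dot_an0l x : << 0, x >> = 0.
Proof. by rewrite -(scale0r (0 : CH R n)) dot_anZl mul0r. Qed.

Lemma dot_an0r x : << x, 0 >> = 0.
Proof. by rewrite dot_anC dot_an0l. Qed.

Definition dot_anE := (dot_anDl, dot_anDr, dot_anZl,
  dot_anZr, dot_anNl, dot_anNr, dot_an0l, dot_an0r).

Lemma dot_an_ge0 x : 0 <= << x, x >>.
Proof. by rewrite /dot_an !addr_ge0 ?dot_galpha_ge0 // -expr2 sqr_ge0. Qed.

Lemma dot_an_eq0 x : << x, x >> = 0 -> x = 0.
Proof.
have := dot_galpha_ge0 x.1.2.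
case: x => [[a u] b]; rewrite /dot_an /= => h e.
have a0 : a = 0 by nra.
have b0 : b = 0 by nra.
by move: e; rewrite a0 b0 !mul0r add0r addr0 => /dot_galpha_eq0 ->.
Qed.

(** Testing against an arbitrary vector turns identities in the Lie algebra into scalar ones, within
    reach of [ring] and [field]. *)
Lemma dot_an_ext x y : (forall z, << x, z >> = << y, z >>) -> x = y.
Proof.
move=> h; apply/eqP; rewrite -subr_eq0; apply/eqP/dot_an_eq0.
by rewrite dot_anDl dot_anNl h subrr.
Qed.

Lemma dot_an_CS x y : << x, y >> ^+ 2 <= << x, x >> * << y, y >>.
Proof.
have [y0|/eqP yn0] := eqVneq << y, y >> 0.
  by rewrite (dot_an_eq0 y0) !dot_an0r mulr0 expr0n.
have := dot_an_ge0 (<< y, y >> *: x - << x, y >> *: y).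
rewrite !dot_anE (dot_anC y x) => h.
have yp : 0 < << y, y >> by rewrite lt_neqAle dot_an_ge0 andbT eq_sym; apply/eqP.
move: h; set p := << x, x >>; set q := << y, y >>; set r := << x, y >>.
move=> h; have : 0 <= q * (p * q - r ^+ 2) by lra.
by rewrite pmulr_rge0 // subr_ge0.
Qed.

Lemma J_anD x y : J (x + y) = J x + J y.
Proof. by congr (_, _, _) => /=; rewrite ?opprD ?J_galphaD. Qed.

Lemma J_anZ a x : J (a *: x) = a *: J x.
Proof.
by congr (_, _, _) => /=; rewrite ?J_galphaZ // /GRing.scale /= mulrN.
Qed.

Lemma J_anN x : J (- x) = - J x.
Proof. by rewrite -(scaleN1r x) J_anZ scaleN1r. Qed.

Lemma J_an0 : J 0 = 0.
Proof. by rewrite -{1}(scale0r (0 : CH R n)) J_anZ scale0r. Qed.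

Lemma J_anK x : J (J x) = - x.
Proof. by case: x => [[a u] b]; rewrite /J_an /= J_galphaK. Qed.

Definition J_anE := (J_anD, J_anZ, J_anN, J_anK, J_an0).

Lemma dot_anJC x y : << J x, y >> = - << J y, x >>.
Proof. by rewrite /dot_an /= (dot_galphaJC x.1.2); ring. Qed.

Lemma dot_anJr x y : << x, J y >> = - << J x, y >>.
Proof. by rewrite dot_anC dot_anJC. Qed.

Lemma dot_anJJ x y : << J x, J y >> = << x, y >>.
Proof. by rewrite dot_anJr J_anK dot_anNl opprK. Qed.

Lemma dot_anJ x : << J x, x >> = 0.
Proof. by have := dot_anJC x x; lra. Qed.

(* The Levi-Civita connection on left-invariant fields. *)
Definition lc x y : CH R n :=
  (2^-1 * <|x.1.2, y.1.2|> + x.2 * y.2,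
   - (2^-1 *: (y.1.1 *: x.1.2 + y.2 *: Jg x.1.2 + x.2 *: Jg y.1.2)),
   - (y.1.1 * x.2) + 2^-1 * <|Jg x.1.2, y.1.2|>).

Ltac an_ring := apply: dot_an_ext => ?;
  rewrite /bracket_an /lc /J_an /dot_an /= ?(dot_galphaE, J_galphaE) /GRing.scale /=.

Lemma lcDr x y z : lc x (y + z) = lc x y + lc x z.
Proof. by an_ring; ring. Qed.

Lemma lcZr a x y : lc x (a *: y) = a *: lc x y.
Proof. by an_ring; ring. Qed.

Lemma lcDl x y z : lc (x + y) z = lc x z + lc y z.
Proof. by an_ring; ring. Qed.

Lemma lcZl a x y : lc (a *: x) y = a *: lc x y.
Proof. by an_ring; ring. Qed.

Lemma lcNl x y : lc (- x) y = - lc x y.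
Proof. by rewrite -(scaleN1r x) lcZl scaleN1r. Qed.

Lemma lcNr x y : lc x (- y) = - lc x y.
Proof. by rewrite -(scaleN1r y) lcZr scaleN1r. Qed.

Definition lcE := (lcDl, lcDr, lcZl, lcZr, lcNl, lcNr).

(** Together with [lc_skew] this characterizes [lc] as the Levi-Civita connection; [lcJ] is the
    Kaehler property. *)
Lemma lc_torsion x y : lc x y - lc y x = bracket_an x y.
Proof.
an_ring; rewrite (dot_galphaJC y.1.2 x.1.2) (dot_galphaC y.1.2 x.1.2).
set A := dot_galpha _ _; set A' := dot_galpha _ _. by field.
Qed.

Lemma lc_skew x y z : << lc x y, z >> = - << y, lc x z >>.
Proof.
rewrite /lc /dot_an /= ?(dot_galphaE, J_galphaE) ?dot_galphaJr.
rewrite (dot_galphaC y.1.2 x.1.2) (dot_galphaJC y.1.2 x.1.2).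
by ring.
Qed.

Lemma lcJ x y : lc x (J y) = J (lc x y).
Proof.
by an_ring; rewrite ?(dot_galphaJr, dot_galphaE, J_galphaE); ring.
Qed.

(** The curvature tensor of constant holomorphic sectional curvature -1: for a unit vector x the
    plane of [x] and [J x] has curvature -1, which fixes the factor [4^-1]. *)
Lemma lc_curvature x y z :
  lc x (lc y z) - lc y (lc x z) - lc (bracket_an x y) z =
  - (4^-1 *: (<< y, z >> *: x - << x, z >> *: y + << J y, z >> *: J x
     - << J x, z >> *: J y - (2 * << J x, y >>) *: J z)).
Proof.
apply: dot_an_ext => t.
rewrite /bracket_an /lc /J_an /dot_an /= ?(dot_galphaE, J_galphaE) /GRing.scale /=.
rewrite ?(dot_galphaJr, dot_galphaE, J_galphaE).
case: x y z t => [[xa xu] xz] [[ya yu] yz] [[za zu] zz] [[ta tu] tz] /=.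
rewrite ?(dot_galphaC zu yu) ?(dot_galphaC zu xu) ?(dot_galphaC yu xu).
rewrite ?(dot_galphaJC zu yu) ?(dot_galphaJC zu xu) ?(dot_galphaJC yu xu).
by field.
Qed.

End Algebra.

(** * The connection that preserves the tangent bundle *)

Section ModifiedConnection.
Variables (R : realType) (n : nat).
Implicit Types (x y z w t p q : CH R n).
Local Notation J := (@J_an R n).
Local Notation "<< x , y >>" := (dot_an x y).

(* The second fundamental form hypothesis says that the torsion-free connection
   [nabla_x y + acor z x y] of the ambient bundle preserves the tangent bundle. *)
Definition acor z x y := 2^-1 *: (<< x, z >> *: J y + << y, z >> *: J x).

Definition mlc z x y := lc x y + acor z x y.

(* The covariant derivative of the model field, for which [z] is the center at
   infinity of the horospherical foliation. *)
Definition Phi z x := - (2^-1 *: (J x + << x, z >> *: J z + << x, J z >> *: z)).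

(* For a field z with flat derivatives p, q in the directions x, y, the left
   side is the curvature of [mlc z] applied to w. *)
Lemma mlc_curvature z x y w p q (N := fun x p w => << p + lc x z - Phi z x, w >>) :
  mlc z (lc y x - lc x y) w
  + 2^-1 *: (<< y, p >> *: J w + << w, p >> *: J y)
  - 2^-1 *: (<< x, q >> *: J w + << w, q >> *: J x)
  + mlc z x (mlc z y w) - mlc z y (mlc z x w) =
  2^-1 *: ((N x p y - N y q x) *: J w + N x p w *: J y - N y q w *: J x)
  - 4^-1 *: (<< y, w >> *: x - << x, w >> *: y)
  + 4^-1 *: ((<< y, z >> * << w, z >>) *: x - (<< x, z >> * << w, z >>) *: y).
Proof.
(* The curvature formula is solved for [lc x (lc y w)]; once this is substituted, the other
   second-order terms cancel. *)
have := lc_curvature x y w; rewrite -lc_torsion => /(canRL (subrK _)) /(canRL (subrK _)) C.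
rewrite /N /mlc /acor /Phi; rewrite !(lcE, lcJ) C.
apply: dot_an_ext => t.
rewrite ?(dot_anE, J_anE) ?(dot_anJr, dot_anE, J_anE, lcJ) ?lcE ?dot_anE.
rewrite ?(dot_anE, J_anE, dot_anJr) ?(lc_skew _ _ z) ?(dot_anC (J _) z) ?(dot_anC z).
rewrite !(dot_anC p) !(dot_anC q) !(dot_anC (lc x z)) !(dot_anC (lc y z)).
rewrite !(dot_anJC z) !(dot_anJC y x).
by field.
Qed.
End ModifiedConnection.

(** * Orthogonal projections and Kaehler angles *)

Section InnerProduct.
Variables (R : realType) (E : lmodType R) (ip : E -> E -> R).

Definition inner_product :=
  [/\ forall x y, ip x y = ip y x,
      forall a x y z, ip (a *: x + y) z = a * ip x z + ip y z,
      forall x, 0 <= ip x x &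
      forall x, ip x x = 0 -> x = 0].

Hypothesis ipP : inner_product.

Let ipC x y : ip x y = ip y x. Proof. by have [] := ipP. Qed.

Lemma ip_linl a x y z : ip (a *: x + y) z = a * ip x z + ip y z.
Proof. by have [] := ipP. Qed.

Lemma ip0l z : ip 0 z = 0.
Proof. by have := ip_linl 1 0 0 z; rewrite scaler0 addr0 mul1r; lra. Qed.

Lemma ipDl x y z : ip (x + y) z = ip x z + ip y z.
Proof. by rewrite -{1}(scale1r x) ip_linl mul1r. Qed.

Lemma ipZl a x z : ip (a *: x) z = a * ip x z.
Proof. by rewrite -(addr0 (a *: x)) ip_linl ip0l addr0. Qed.

Lemma ipNl x z : ip (- x) z = - ip x z.
Proof. by rewrite -scaleN1r ipZl mulN1r. Qed.

Lemma ipDr x y z : ip z (x + y) = ip z x + ip z y.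
Proof. by rewrite ipC ipDl !(ipC z). Qed.

Lemma ipZr a x z : ip z (a *: x) = a * ip z x.
Proof. by rewrite ipC ipZl ipC. Qed.

Lemma ipNr x z : ip z (- x) = - ip z x.
Proof. by rewrite ipC ipNl ipC. Qed.

Lemma ip0r z : ip z 0 = 0. Proof. by rewrite ipC ip0l. Qed.

Definition ipE := (ipDl, ipDr, ipZl, ipZr, ipNl, ipNr, ip0l, ip0r).

Lemma ip_eq0 x : ip x x = 0 -> x = 0. Proof. by have [_ _ _] := ipP; exact. Qed.

Lemma ip_gt0 x : x != 0 -> 0 < ip x x.
Proof.
move=> x0; have [_ _ h0 h] := ipP; rewrite lt_neqAle h0 andbT eq_sym.
by apply: contra x0 => /eqP /h ->.
Qed.

Definition orth (S : set E) : set E := [set x | forall s, S s -> ip x s = 0].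

(** Tangent spaces are bare sets in an [lmodType], without dimension theory. Orthogonal projections
    are what finite dimension would provide, so their existence is made part of the notion. *)
Definition projectable (S : set E) :=
  [/\ S 0, forall a x y, S x -> S y -> S (a *: x + y) &
      forall x, exists y, S y /\ forall s, S s -> ip (x - y) s = 0].

Section Projection.
Variables (S : set E).
Hypothesis SP : projectable S.
Local Notation P := (orth_proj ip S).

Let S0 : S 0. Proof. by case: SP. Qed.
Let SL a x y : S x -> S y -> S (a *: x + y). Proof. by case: SP => _ h _; exact: h. Qed.

Lemma projectableD x y : S x -> S y -> S (x + y).
Proof. by move=> Sx Sy; rewrite -(scale1r x); exact: SL. Qed.

Lemma projectableZ a x : S x -> S (a *: x).
Proof. by move=> Sx; rewrite -(addr0 (a *: x)); exact: SL. Qed.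

Lemma projectableN x : S x -> S (- x).
Proof. by move=> Sx; rewrite -scaleN1r; exact: projectableZ. Qed.

Lemma projectableB x y : S x -> S y -> S (x - y).
Proof. by move=> Sx Sy; apply: projectableD => //; exact: projectableN. Qed.

Lemma orth_proj_spec x : S (P x) /\ forall s, S s -> ip (x - P x) s = 0.
Proof.
rewrite /orth_proj; case: xgetP => [y _ [] //|] h.
by case: SP => _ _ /(_ x)[y [Sy hy]]; have := h y; case; split.
Qed.

Lemma orth_projS x : S (P x). Proof. by have [] := orth_proj_spec x. Qed.

Lemma orth_proj_orth x s : S s -> ip (x - P x) s = 0.
Proof. by have [_] := orth_proj_spec x; exact. Qed.

Lemma orth_proj_eq x y : S y -> (forall s, S s -> ip (x - y) s = 0) -> P x = y.
Proof.
move=> Sy hy; apply/eqP; rewrite -subr_eq0; apply/eqP/ip_eq0.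
have SPy : S (P x - y) by apply: projectableB => //; exact: orth_projS.
have h1 := hy _ SPy; have h2 := orth_proj_orth x SPy.
have -> : ip (P x - y) (P x - y) = ip (x - y) (P x - y) - ip (x - P x) (P x - y).
  by rewrite -ipNl -ipDl; congr (ip _ _); rewrite opprB [RHS]addrC addrA subrK.
by rewrite h1 h2 subrr.
Qed.

Lemma orth_proj_id x : S x -> P x = x.
Proof. by move=> Sx; apply: orth_proj_eq => // s _; rewrite subrr ip0l. Qed.

Lemma orth_proj_lin a x y : P (a *: x + y) = a *: P x + P y.
Proof.
apply: orth_proj_eq; first by apply: SL; exact: orth_projS.
move=> s Ss; have h1 := orth_proj_orth x Ss; have h2 := orth_proj_orth y Ss.
move: h1 h2; rewrite !ipE; nra.
Qed.

Lemma orth_proj0 : P 0 = 0. Proof. exact: orth_proj_id. Qed.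

Lemma orth_projD x y : P (x + y) = P x + P y.
Proof. by rewrite -{1}(scale1r x) orth_proj_lin scale1r. Qed.

Lemma orth_projZ a x : P (a *: x) = a *: P x.
Proof. by rewrite -{1}(addr0 (a *: x)) orth_proj_lin orth_proj0 addr0. Qed.

Lemma orth_projN x : P (- x) = - P x.
Proof. by rewrite -(scaleN1r x) orth_projZ scaleN1r. Qed.

Lemma ip_orth_proj x s : S s -> ip (P x) s = ip x s.
Proof. by move=> Ss; have := orth_proj_orth x Ss; rewrite !ipE; lra. Qed.

Lemma orth_orth x : orth (orth S) x -> S x.
Proof.
move=> h; suff -> : x = P x by exact: orth_projS.
apply/eqP; rewrite -subr_eq0; apply/eqP/ip_eq0.
have h1 : orth S (x - P x) by move=> s; exact: orth_proj_orth.
by rewrite ipDl ipNl (h _ h1) ipC (h1 _ (orth_projS x)) subrr.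
Qed.

Lemma orth_projectable : projectable (orth S).
Proof.
split=> [s _|a x y ox oy s Ss|x]; first by rewrite ip0l.
  by rewrite ip_linl ox // oy // mulr0 addr0.
exists (x - P x); split=> [s|s Ss]; first exact: orth_proj_orth.
by rewrite opprB addrC subrK ipC; apply: Ss; exact: orth_projS.
Qed.

End Projection.

Lemma orth_proj_compl S x : projectable S ->
  orth_proj ip (orth S) x = x - orth_proj ip S x.
Proof.
move=> SP; apply: orth_proj_eq; first exact: orth_projectable.
  by move=> s; exact: orth_proj_orth.
by move=> s Ss; rewrite opprB addrC subrK ipC; apply: Ss; exact: orth_projS.
Qed.

Fixpoint lspan (s : seq E) : set E :=
  if s is a :: s' then [set x | exists c y, lspan s' y /\ x = c *: a + y]
  else [set 0].

Lemma projectable_lspan s : projectable (lspan s).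
Proof.
elim: s => [|a s IH].
  split=> [//|c x y -> ->|x]; first by rewrite scaler0 addr0.
  by exists 0; split=> // t ->; rewrite ip0r.
have sub y : lspan s y -> lspan (a :: s) y.
  by move=> sy; exists 0, y; rewrite scale0r add0r.
split.
- by apply: sub; case: IH.
- move=> b x y [c [x' [sx ->]]] [d [y' [sy ->]]].
  exists (b * c + d), (b *: x' + y'); split; first by case: IH => _ h _; exact: h.
  by rewrite scalerDr scalerDl scalerA addrACA.
- move=> x; set P := orth_proj ip (lspan s).
  have PS y : lspan s (P y) by exact: orth_projS.
  have Po y t : lspan s t -> ip (y - P y) t = 0 by exact: orth_proj_orth.
  (* Gram-Schmidt: only the part [a'] of [a] orthogonal to the previous span matters, and if it
     vanishes the span has not grown. *)
  have [a' [ea oa']] : exists a', a = a' + P a /\ forall t, lspan s t -> ip a' t = 0.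
    by exists (a - P a); split; [rewrite subrK|move=> t; exact: Po].
  have [a0|an0] := eqVneq a' 0.
    exists (P x); split; first exact: sub.
    move=> t [c [y [sy ->]]]; rewrite ipDr (Po x _ sy) addr0 ipZr.
    by rewrite ea a0 add0r Po ?mulr0.
  have p0 := ip_gt0 an0.
  pose d := ip x a' / ip a' a'.
  have da : d * ip a' a' = ip x a' by rewrite /d mulfVK // gt_eqF.
  exists (P x + d *: a'); split.
    exists d, (P x - d *: P a); split.
      by apply: projectableB => //; exact: projectableZ.
    by rewrite {1}ea scalerDr addrC -addrA [_ - _]addrC addNKr addrC.
  move=> t [c [y [sy ->]]].
  rewrite ea.
  have h1 := Po x _ sy; have h2 := Po x _ (PS a).
  have h3 := oa' _ sy; have h4 := oa' _ (PS a).
  have h5 : ip (P x) a' = 0 by rewrite ipC; exact: oa'.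
  move: h1 h2; rewrite !(ipDl, ipNl) => h1 h2.
  rewrite !ipE h3 h4 h5; move: da h1 h2.
  set A := ip x y; set B := ip (P x) y; set C := ip x (P a); set D := ip (P x) (P a).
  set G := ip x a'; set K := ip a' a' => da h1 h2.
  have -> : A = B by lra.
  have -> : C = D by lra.
  rewrite -da; by ring.
Qed.

Lemma lspan_mem s x : x \in s -> lspan s x.
Proof.
elim: s => // a s IH; rewrite inE => /orP[/eqP ->|/IH sx].
  by exists 1, 0; rewrite scale1r addr0; split=> //; case: (projectable_lspan s).
by exists 0, x; rewrite scale0r add0r.
Qed.

Lemma lspan_sub s (S : set E) : S 0 -> (forall a x y, S x -> S y -> S (a *: x + y)) ->
  (forall x, x \in s -> S x) -> lspan s `<=` S.
Proof.
move=> S0 SL; elim: s => [|a s IH] h x /=; first by move=> ->.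
move=> [c [y [sy ->]]]; apply: SL; first by apply: h; rewrite inE eqxx.
by apply: IH => // z zs; apply: h; rewrite inE zs orbT.
Qed.

Lemma projectable_fin (S : set E) (s : seq E) : S 0 ->
  (forall a x y, S x -> S y -> S (a *: x + y)) ->
  (forall x, x \in s -> S x) -> S `<=` lspan s -> projectable S.
Proof.
move=> S0 SL h h'; suff -> : S = lspan s by exact: projectable_lspan.
by apply/seteqP; split=> //; exact: lspan_sub.
Qed.

Lemma projectable_image m (L : 'rV[R]_m -> E) : linear L ->
  projectable [set x | exists v, x = L v].
Proof.
move=> lL; have L0 : L 0 = 0.
  by have := lL (-1) 0 0; rewrite scaler0 addr0 scaleN1r addNr.
apply: (@projectable_fin _ [seq L (delta_mx 0 i) | i : 'I_m]).
- by exists 0; rewrite L0.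
- by move=> a x y [v ->] [w ->]; exists (a *: v + w); rewrite lL.
- by move=> x /mapP[i _ ->]; exists (delta_mx 0 i).
move=> x [v ->]; rewrite (row_sum_delta v).
have [s0 sL _] := projectable_lspan [seq L (delta_mx 0 i) | i : 'I_m].
apply: (big_ind (fun v => lspan [seq L (delta_mx 0 i) | i : 'I_m] (L v))).
- by rewrite L0.
- by move=> u w hu hw; rewrite -(scale1r u) lL; exact: sL.
- move=> i _; have := lL (v 0 i) (delta_mx 0 i) 0; rewrite !addr0 L0 addr0 => ->.
  rewrite -[_ *: _]addr0; apply: sL => //; apply: lspan_mem.
  by apply/mapP; exists i; rewrite ?mem_enum.
Qed.

Variable J : E -> E.
Hypothesis JD : forall a x y, J (a *: x + y) = a *: J x + J y.
Hypothesis JK : forall x, J (J x) = - x.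
Hypothesis JC : forall x y, ip (J x) y = - ip (J y) x.

(** The map [P J] is skew on S, so the condition on lengths polarizes to [(P J)^2 = - cos^2 phi], an
    equation that can be used under projections. The sign of [cos phi] matters for recovering a
    length from its square. *)
Lemma const_kahler_angleP (S : set E) phi : projectable S ->
  0 <= cos phi ->
  const_kahler_angle ip J S phi <-> 
  forall x, S x -> orth_proj ip S (J (orth_proj ip S (J x))) = - (cos phi ^+ 2 *: x).
Proof.
move=> SP c0; set P := orth_proj ip S.
have J0 : J 0 = 0 by have := JD (-1) 0 0; rewrite scaler0 addr0 scaleN1r addNr.
have [_ _ ge0 _] := ipP.
have PS x : S (P x) by exact: orth_projS.
have Pip x s : S s -> ip (P x) s = ip x s by exact: ip_orth_proj.
have norm x : S x -> ip (P (J x)) (P (J x)) = - ip (P (J (P (J x)))) x.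
  by move=> Sx; rewrite Pip // (Pip (J (P (J x)))) // [in RHS]JC opprK.
split=> [h x Sx|h x Sx x0]; last first.
  rewrite /ip_norm norm // h // ipNl opprK ipZl sqrtrM ?sqr_ge0 //.
  by rewrite sqrtr_sqr ger0_norm.
have h2 y : S y -> ip (P (J y)) (P (J y)) = cos phi ^+ 2 * ip y y.
  move=> Sy; have [->|y0] := eqVneq y 0.
    by rewrite J0 /P orth_proj0 // !ip0l mulr0.
  have := h y Sy y0; rewrite /ip_norm => /(congr1 (fun a => a ^+ 2)).
  by rewrite exprMn !sqr_sqrtr.
have Psum y z : P (J (y + z)) = P (J y) + P (J z).
  by rewrite -{1}(scale1r y) JD scale1r /P orth_projD.
have h3 y z : S y -> S z -> ip (P (J y)) (P (J z)) = cos phi ^+ 2 * ip y z.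
  move=> Sy Sz; have := h2 _ (projectableD SP Sy Sz).
  rewrite Psum !ipE h2 // h2 // (ipC (P (J z))) (ipC z) => e.
  by move: e; nra.
apply/eqP; rewrite -subr_eq0 opprK; apply/eqP/ip_eq0.
set q := _ + _; have Sq : S q.
  by apply: projectableD => //; exact: projectableZ.
rewrite {1}/q ipDl ipZl Pip // JC -(Pip (J q)) // h3 // (ipC q).
by rewrite addNr.
Qed.

End InnerProduct.

Section NormalSpace.
Variables (R : realType) (V : normedModType R) (M : topologicalType).
Variables (g : V -> V -> V -> R) (J : V -> V -> V) (iota : M -> V).

Lemma normal_orth q : normal g iota q = orth (g (iota q)) (tangent iota q).
Proof. by []. Qed.

Lemma const_kahler_normal_orth phi : const_kahler_normal g J iota phi -> forall q,
  const_kahler_angle (g (iota q)) (J (iota q)) (orth (g (iota q)) (tangent iota q)) phi.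
Proof. by move=> h q; rewrite -normal_orth; exact: h. Qed.

End NormalSpace.

(* [maurer_cartan] and [left_inv] in coordinates; they are locked because the
   unifier otherwise unfolds the derivatives. *)
HB.lock Definition mct (R : realType) (n : nat) (p x : CH R n) : CH R n :=
  (x.1.1, expR (- p.1.1 / 2) *: x.1.2,
   expR (- p.1.1) * (x.2 - 2^-1 * dot_galpha (J_galpha p.1.2) x.1.2)).

HB.lock Definition lft (R : realType) (n : nat) (p x : CH R n) : CH R n :=
  (x.1.1, expR (p.1.1 / 2) *: x.1.2, expR p.1.1 * x.2
     + 2^-1 * expR (p.1.1 / 2) * dot_galpha (J_galpha p.1.2) x.1.2).

(** * The left-invariant trivialization *)

Section Calculus.
Variables (R : realType) (n : nat).
Implicit Types (u v w : galpha R n) (p x y z : CH R n) (a b : R).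
Local Notation Jg := (@J_galpha R n).
Local Notation "<| u , v |>" := (dot_galpha u v).
Local Notation J := (@J_an R n).
Local Notation "<< x , y >>" := (dot_an x y).
Local Notation mc := (@mct R n).

Lemma derive_affine (V W : normedModType R) (f : V -> W) (L : V -> W) (q d : V) :
  (forall h, f (h *: d + q) - f q = h *: L d) -> 'D_d f q = L d.
Proof.
move=> fL; rewrite /derive; apply: (@cvg_lim W); first exact: norm_hausdorff.
apply: (@cvg_near_cst _ _ _ _ (0^')).
near=> h; rewrite /= fL scalerA mulVf ?scale1r //.
by near: h; exact: nbhs_dnbhs_neq.
Unshelve. all: by end_near. Qed.

Lemma left_inv_lft p x : left_inv x p = lft p x.
Proof. by rewrite lft.unlock left_invE. Qed.

(** Left translation is affine in this chart, so its difference quotients are constant. *)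
Lemma maurer_cartan_mct p x : maurer_cartan p x = mct p x.
Proof.
rewrite /maurer_cartan.
apply: (@derive_affine _ _ _ (mct p)) => h; rewrite mct.unlock.
case: p x => [[pa pu] pb] [[xa xu] xb]; rewrite /mul_AN /inv_AN /=.
rewrite !(dot_galphaE, J_galphaE).
have -> : expR (- pa) = expR (- pa / 2) * expR (- pa / 2) by rewrite -expRD -splitr.
set e := expR (- pa / 2).
congr (_, _, _) => /=.
- by rewrite /GRing.scale /=; ring.
- by rewrite scalerDr opprD addrACA subrr add0r addrK !scalerA mulrC.
- by rewrite /GRing.scale /=; ring.
Qed.

Lemma mctK p x : lft p (mct p x) = x.
Proof.
rewrite lft.unlock mct.unlock /=; case: x => [[xa xu] xb] /=.
congr (_, _, _).
  by rewrite scalerA -expRD mulNr subrr expR0 scale1r.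
rewrite dot_galphaZr mulrA -expRD subrr expR0 mul1r -mulrA (mulrA (expR (_ / 2))).
by rewrite -expRD mulNr subrr expR0 mul1r subrK.
Qed.

Lemma lftK p x : mct p (lft p x) = x.
Proof.
rewrite lft.unlock mct.unlock /=; case: x => [[xa xu] xb] /=.
congr (_, _, _).
  by rewrite scalerA -expRD mulNr addNr expR0 scale1r.
rewrite dot_galphaZr; set d := dot_galpha _ _.
have -> : expR p.1.1 = (expR (- p.1.1))^-1 by rewrite expRN invrK.
have e0 : expR (- p.1.1) != 0 by rewrite gt_eqF ?expR_gt0.
by field.
Qed.

Lemma mctD p x y : mct p (x + y) = mct p x + mct p y.
Proof.
rewrite mct.unlock; congr (_, _, _) => /=; first by rewrite scalerDr.
by rewrite dot_galphaDr; ring.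
Qed.

Lemma mctZ p a x : mct p (a *: x) = a *: mct p x.
Proof.
rewrite mct.unlock; congr (_, _, _) => /=; first by rewrite !scalerA mulrC.
by rewrite dot_galphaZr /GRing.scale /=; ring.
Qed.

Lemma mct0 p : mct p 0 = 0.
Proof. by rewrite -(scale0r (0 : CH R n)) mctZ !scale0r. Qed.

Lemma mct_inj p : injective (mct p).
Proof. by move=> x y e; rewrite -(mctK p x) e mctK. Qed.

Lemma lftD p x y : lft p (x + y) = lft p x + lft p y.
Proof. by apply: (@mct_inj p); rewrite mctD !lftK. Qed.

Lemma lftZ p a x : lft p (a *: x) = a *: lft p x.
Proof. by apply: (@mct_inj p); rewrite mctZ !lftK. Qed.

Lemma cplxE p x : cplx p x = lft p (J (mct p x)).
Proof. by rewrite /cplx maurer_cartan_mct left_inv_lft. Qed.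

Lemma metricE p x y : metric p x y = << mct p x, mct p y >>.
Proof. by rewrite /metric !maurer_cartan_mct. Qed.

Lemma fst_linear (V W : normedModType R) : linear (fst : V * W -> V).
Proof. by []. Qed.

Lemma fst_cont (V W : normedModType R) : continuous (fst : V * W -> V).
Proof. by move=> q; exact: cvg_fst. Qed.

Lemma snd_cont (V W : normedModType R) : continuous (snd : V * W -> W).
Proof. by move=> q; exact: cvg_snd. Qed.

Lemma cont_comp (T U V : topologicalType) (q : T) (f : T -> U) (g : U -> V) :
  {for q, continuous f} -> continuous g -> {for q, continuous (fun t => g (f t))}.
Proof. by move=> fc gc; exact: (cvg_comp _ _ fc (gc (f q))). Qed.

Lemma cont_pair (T U V : topologicalType) (q : T) (f : T -> U) (g : T -> V) :
  {for q, continuous f} -> {for q, continuous g} ->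
  {for q, continuous (fun t => (f t, g t))}.
Proof. by move=> fc gc; exact: (cvg_pair fc gc). Qed.

Lemma cont_add (T : topologicalType) (V : normedModType R) (q : T) (f g : T -> V) :
  {for q, continuous f} -> {for q, continuous g} ->
  {for q, continuous (fun t => f t + g t)}.
Proof. by move=> fc gc; exact: cvgD. Qed.

Lemma cont_opp (T : topologicalType) (V : normedModType R) (q : T) (f : T -> V) :
  {for q, continuous f} -> {for q, continuous (fun t => - f t)}.
Proof. by move=> fc; exact: cvgN. Qed.

Lemma cont_scale (T : topologicalType) (V : normedModType R) (q : T) (f : T -> R)
    (g : T -> V) :
  {for q, continuous f} -> {for q, continuous g} ->
  {for q, continuous (fun t => f t *: g t)}.
Proof. by move=> fc gc; exact: cvgZ. Qed.

Lemma dot_galpha_cont : continuous (fun q : galpha R n * galpha R n => <|q.1, q.2|>).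
Proof.
rewrite /dot_galpha; apply: continuous_big => [|i _]; first exact: add_continuous.
move=> q; have f1 := @fst_cont (galpha R n) (galpha R n) q.
have f2 := @snd_cont (galpha R n) (galpha R n) q.
have cc k := @coord_continuous R _ _ (0 : 'I_1) (k : 'I_n.-1).
have h1 := cont_comp (cont_comp f1 (@fst_cont _ _)) (cc i).
have h2 := cont_comp (cont_comp f2 (@fst_cont _ _)) (cc i).
have h3 := cont_comp (cont_comp f1 (@snd_cont _ _)) (cc i).
have h4 := cont_comp (cont_comp f2 (@snd_cont _ _)) (cc i).
exact: (cvgD (cvgM h1 h2) (cvgM h3 h4)).
Qed.

Lemma bb_dot_galpha : bounded_bilinear (@dot_galpha R n).
Proof.
split=> [u a v w|u a v w|]; last exact: dot_galpha_cont.
  by rewrite dot_galphaDr dot_galphaZr.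
by rewrite dot_galphaDl dot_galphaZl.
Qed.

Lemma J_galpha_linear : linear Jg.
Proof. by move=> a u v; rewrite J_galphaD J_galphaZ. Qed.

Lemma J_galpha_cont : continuous Jg.
Proof.
move=> u; apply: (@cont_pair _ _ _ u (fun t : galpha R n => - t.2) fst).
  exact: (cont_opp (@snd_cont _ _ u)).
exact: fst_cont.
Qed.

Lemma J_an_linear : linear J.
Proof. by move=> a x y; rewrite J_anD J_anZ. Qed.

Section Continuity.
Variables (T : topologicalType) (q : T).
Variables (f : T -> CH R n).
Hypothesis (fc : {for q, continuous f}).

Lemma cont_a : {for q, continuous (fun t => (f t).1.1)}.
Proof. exact: (cont_comp (cont_comp fc (@fst_cont _ _)) (@fst_cont _ _)). Qed.

Lemma cont_u : {for q, continuous (fun t => (f t).1.2)}.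
Proof. exact: (cont_comp (cont_comp fc (@fst_cont _ _)) (@snd_cont _ _)). Qed.

Lemma cont_b : {for q, continuous (fun t => (f t).2)}.
Proof. exact: (cont_comp fc (@snd_cont _ _)). Qed.

End Continuity.

Lemma J_an_cont : continuous J.
Proof.
move=> x; have i := @cvg_id _ (nbhs x).
have c1 := cont_opp (cont_b i).
have c2 := cont_comp (cont_u i) J_galpha_cont.
exact: (cont_pair (cont_pair c1 c2) (cont_a i)).
Qed.

Lemma cont_dot (T : topologicalType) (q : T) (f g : T -> galpha R n) :
  {for q, continuous f} -> {for q, continuous g} ->
  {for q, continuous (fun t => <|f t, g t|>)}.
Proof. by move=> fc gc; exact: (cont_comp (cont_pair fc gc) dot_galpha_cont). Qed.

Lemma bb_dot_an : bounded_bilinear (@dot_an R n).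
Proof.
split=> [x a y z|x a y z|q]; first by rewrite dot_anDr dot_anZr.
  by rewrite dot_anDl dot_anZl.
have f1 := @fst_cont (CH R n) (CH R n) q; have f2 := @snd_cont (CH R n) (CH R n) q.
have h1 := cont_scale (cont_a f1) (cont_a f2).
have h2 := cont_dot (cont_u f1) (cont_u f2).
have h3 := cont_scale (cont_b f1) (cont_b f2).
exact: (cont_add (cont_add h1 h2) h3).
Qed.

Lemma bb_lc : bounded_bilinear (@lc R n).
Proof.
split=> [x a y z|x a y z|q]; first by rewrite lcDr lcZr.
  by rewrite lcDl lcZl.
have f1 := @fst_cont (CH R n) (CH R n) q; have f2 := @snd_cont (CH R n) (CH R n) q.
have a1 := cont_a f1; have a2 := cont_a f2; have b1 := cont_b f1; have b2 := cont_b f2.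
have u1 := cont_u f1; have u2 := cont_u f2.
have J1 := cont_comp u1 J_galpha_cont; have J2 := cont_comp u2 J_galpha_cont.
have k c : {for q, continuous (fun=> c : R)} by exact: cst_continuous.
have h1 := cont_add (cont_scale (k 2^-1) (cont_dot u1 u2)) (cont_scale b1 b2).
have h2 := cont_opp (cont_scale (k 2^-1)
  (cont_add (cont_add (cont_scale a2 u1) (cont_scale b2 J1)) (cont_scale b1 J2))).
have h3 := cont_add (cont_opp (cont_scale a2 b1)) (cont_scale (k 2^-1) (cont_dot J1 u2)).
exact: (cont_pair (cont_pair h1 h2) h3).
Qed.

(* The change of [maurer_cartan p y] for fixed y when p moves with velocity x,
   both vectors being left-translated to the identity. *)
Definition dmc x y : CH R n :=
  (0, - (2^-1 * x.1.1 *: y.1.2), - (x.1.1 * y.2) - 2^-1 * <|Jg x.1.2, y.1.2|>).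

Section Components.
Variables (V : normedModType R) (f : V -> CH R n) (q : V) (d : V).
Hypothesis df : differentiable f q.

Lemma derive_a : differentiable (fun t => (f t).1.1) q /\
  'D_d (fun t => (f t).1.1) q = ('D_d f q).1.1.
Proof.
apply: (@derive_lin _ _ _ _ (fun x : CH R n => x.1.1)) => //.
by move=> x; apply: cont_a; exact: cvg_id.
Qed.

Lemma derive_u : differentiable (fun t => (f t).1.2) q /\
  'D_d (fun t => (f t).1.2) q = ('D_d f q).1.2.
Proof.
apply: (@derive_lin _ _ _ _ (fun x : CH R n => x.1.2)) => //.
by move=> x; apply: cont_u; exact: cvg_id.
Qed.

Lemma derive_b : differentiable (fun t => (f t).2) q /\
  'D_d (fun t => (f t).2) q = ('D_d f q).2.
Proof. by apply: (@derive_lin _ _ _ _ (fun x : CH R n => x.2)) => //; exact: snd_cont. Qed.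

End Components.

(** Product rule for the trivialization; the moving base point contributes [dmc]. Antisymmetrized,
    [dmc] is minus the bracket, which is the Maurer-Cartan structure equation. *)
Lemma derive_mc (V : normedModType R) (F Y : V -> CH R n) (q d : V) :
  differentiable F q -> differentiable Y q ->
  differentiable (fun t => mc (F t) (Y t)) q /\
  'D_d (fun t => mc (F t) (Y t)) q =
    dmc (mc (F q) ('D_d F q)) (mc (F q) (Y q)) + mc (F q) ('D_d Y q).
Proof.
move=> dF dY.
have [Fa DFa] := derive_a d dF; have [Fu DFu] := derive_u d dF.
have [Ya DYa] := derive_a d dY; have [Yu DYu] := derive_u d dY.
have [Yb DYb] := derive_b d dY.
have E c : differentiable (fun t => expR (c * (F t).1.1)) q /\
   'D_d (fun t => expR (c * (F t).1.1)) q = c * ('D_d F q).1.1 * expR (c * (F q).1.1).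
  have [g Dg] := derive_lin d (L := fun s : R => c * s)
    (fun a s t => etrans (mulrDr _ _ _) (congr1 (+%R^~ _) (mulrCA _ _ _)))
    (@mulrl_continuous R c) Fa.
  have [h1 h2] := derive_comp_real d (is_derive_expR _) g.
  by split; [exact: h1|rewrite [LHS]h2 Dg DFa].
have [e1 De1] := E (- 2^-1); have [e2 De2] := E (- 1).
have [JF DJF] := derive_lin d J_galpha_linear J_galpha_cont Fu.
have [U DU] := derive_bil d (bounded_bilinear_scale (galpha R n)) e1 Yu.
have [D DD] := derive_bil d bb_dot_galpha JF Yu.
have [D' DD'] := derive_lin d (L := fun s : R => - 2^-1 * s)
    (fun a s t => etrans (mulrDr _ _ _) (congr1 (+%R^~ _) (mulrCA _ _ _)))
    (@mulrl_continuous R _) D.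
have [B DB] := derive_addf d Yb D'.
have [B' DB'] := derive_bil d (bounded_bilinear_scale R) e2 B.
have [P DP] := derive_pair d Ya U.
have [Q DQ] := derive_pair d P B'.
have e : (fun t => mc (F t) (Y t)) = (fun t => ((Y t).1.1,
    expR (- 2^-1 * (F t).1.1) *: (Y t).1.2, expR (- 1 * (F t).1.1) *: ((Y t).2 +
       - 2^-1 * <|Jg (F t).1.2, (Y t).1.2|>))).
  apply/funext => t; rewrite mct.unlock; congr (_, _ , _).
    by congr (expR _ *: _); rewrite mulNr mulrC mulNr.
  by rewrite /GRing.scale /= mulN1r mulNr.
rewrite e; split; first exact: Q.
rewrite [LHS]DQ DP DU DB' DB DD' DD DYa DYu DYb DJF DFu De1 De2 mct.unlock; cbn beta iota delta
  [fst snd comp].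
move: (F q) (Y q) ('D_d F q) ('D_d Y q) => [[pa pu] pb] [[xa xu] xb] [[da du] db] [[ya yu] yb];
  cbn beta iota delta [fst snd].
have -> : - pa / 2 = - 2^-1 * pa by rewrite mulNr mulrC mulNr.
rewrite !mulN1r.
have -> : expR (- pa) = expR (- 2^-1 * pa) * expR (- 2^-1 * pa).
  by rewrite -expRD -mulrDl (_ : - 2^-1 + - 2^-1 = -1 :> R) ?mulN1r //; field.
set e' := expR _; rewrite /dmc; cbn beta iota delta [fst snd].
rewrite ?(dot_galphaE, J_galphaE); congr (_, _, _) => /=.
- by rewrite add0r.
- by rewrite scalerA -scaleNr; congr (_ *: _ + _); ring.
- by rewrite /GRing.scale /=; ring.
Qed.

(** A field that is constant in the chart reads [mct p y] in the left-invariant trivialization; its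
    derivative there is [dmc], and adding [lc] gives the covariant derivative. *)
Lemma christoffelE p x y :
  christoffel (@metric R n) p x y =
  lft p (dmc (mc p x) (mc p y) + lc (mc p x) (mc p y)).
Proof.
have Dg (u v w : CH R n) : 'D_u (fun q => metric q v w) p =
    << dmc (mc p u) (mc p v), mc p w >> + << mc p v, dmc (mc p u) (mc p w) >>.
  have c (t : CH R n) : differentiable (fun q : CH R n => mc q t) p /\
      'D_u (fun q => mc q t) p = dmc (mc p u) (mc p t).
    have di : differentiable (id : CH R n -> CH R n) p.
      by apply: (smooth_on_diff (U := setT)) => //; apply: smooth_on_id; exact: openT.
    have [h1 h2] := derive_mc u di (differentiable_cst t p).
    split; first exact: h1.
    by rewrite [LHS]h2 derive_id derive_cst mct0 addr0.
  have [c1 d1] := c v; have [c2 d2] := c w.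
  have [_ h] := derive_bil u bb_dot_an c1 c2.
  have -> : (fun q => metric q v w) = (fun q => << mc q v, mc q w >>).
    by apply/funext => q; rewrite metricE.
  by rewrite [LHS]h d1 d2.
rewrite /christoffel; set S := [set _ | _].
have S0 : S (lft p (dmc (mc p x) (mc p y) + lc (mc p x) (mc p y))).
  move=> w; apply: (etrans _ (esym (congr2 (fun a b : R => a - b)
    (congr2 (fun a b : R => a + b) (Dg x y w) (Dg y x w)) (Dg w x y)))).
  rewrite metricE lftK.
  move: (mc p x) (mc p y) (mc p w) => [[xa xu] xb] [[ya yu] yb] [[wa wu] wb].
  rewrite /dmc /lc /dot_an /= ?(dot_galphaE, J_galphaE, dot_galphaJr).
  rewrite ?(dot_galphaC yu xu) ?(dot_galphaC wu xu) ?(dot_galphaC wu yu).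
  rewrite ?(dot_galphaJC yu xu) ?(dot_galphaJC wu xu) ?(dot_galphaJC wu yu).
  by field.
(* The Koszul formula has only one solution because the metric is nondegenerate, so the chosen one
   is the vector just checked. *)
case: xgetP => [z _ Sz|h]; last by case: (h _ S0).
apply: (@mct_inj p); apply: dot_an_ext => t.
have := Sz (lft p t); rewrite -(S0 (lft p t)) !metricE !lftK.
by move=> e; apply: (@mulfI R 2) => //; rewrite ?pnatr_eq0.
Qed.

End Calculus.

(** * Symmetry of second derivatives *)

Section Lines.
Variable R : realType.
Implicit Types V W : normedModType R.

Lemma derive_line V W (f : V -> W) (p v : V) (t : R) :
  differentiable f (p + t *: v) ->
  is_derive t 1 (fun s : R => f (p + s *: v)) ('D_v f (p + t *: v)).
Proof.
move=> df.
have dl : is_diff t (fun s : R => p + s *: v) (fun s : R => s *: v).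
  have h : is_diff t (cst p + (fun s : R => s *: v)) (0 + (fun s : R => s *: v)).
    by apply: is_diffD.
  by rewrite add0r in h.
have dl1 : differentiable (fun s : R => p + s *: v) t by exact: ex_diff.
have d : differentiable (f \o (fun s : R => p + s *: v)) t by exact: differentiable_comp.
split; first exact: diff_derivable.
have -> : (fun s : R => f (p + s *: v)) = f \o (fun s : R => p + s *: v) by [].
by rewrite deriveE // diff_comp //= diff_val scale1r deriveE.
Qed.

Lemma MVT_line V (f : V -> R) (p v : V) (t : R) : 0 <= t ->
  (forall s, 0 <= s <= t -> differentiable f (p + s *: v)) ->
  exists2 c, 0 <= c <= t & f (p + t *: v) - f p = t * 'D_v f (p + c *: v).
Proof.
move=> t0 df.
have h s : s \in `]0, t[ -> is_derive s 1 (fun s : R => f (p + s *: v)) ('D_v f (p + s *: v)).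
  rewrite in_itv /= => /andP[s0 st]; apply: derive_line; apply: df.
  by rewrite (ltW s0) (ltW st).
have c : {within `[0, t], continuous (fun s : R => f (p + s *: v))}.
  apply: derivable_within_continuous => s; rewrite in_itv /= => st.
  by have [] := derive_line (df s st).
have [x] := MVT_segment t0 h c.
rewrite in_itv /= subr0 scale0r addr0 => xt e.
by exists x => //; rewrite e mulrC.
Qed.

Lemma dist_half (x y z : R) :
  `|x - z| < `|x - y| / 2 -> `|y - z| < `|x - y| / 2 -> False.
Proof. by have := ler_distD z x y; rewrite (distrC z y); lra. Qed.

(** By two mean values, the second difference of f over a small parallelogram is [t^2] times either
    mixed derivative at some point of it. If the mixed derivatives differed at p, continuity would
    keep each within half of the gap, yet these two values agree. *)
Lemma derive_comm_real V (U : set V) (f : V -> R) (p v w : V) : open U ->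
  smooth_on U f -> U p -> 'D_v ('D_w f) p = 'D_w ('D_v f) p.
Proof.
move=> oU sf Up; apply/eqP; apply: contraT => ne.
set A := 'D_v ('D_w f); set B := 'D_w ('D_v f).
have e0 : 0 < `|A p - B p| / 2 by rewrite divr_gt0 // normr_gt0 subr_eq0.
have sA : smooth_on U A by do 2 apply: smooth_on_derive.
have sB : smooth_on U B by do 2 apply: smooth_on_derive.
have cA := differentiable_continuous (smooth_on_diff sA Up).
have cB := differentiable_continuous (smooth_on_diff sB Up).
have nU : nbhs p U by exact: open_nbhs_nbhs.
have nA : \forall x \near p, `|A p - A x| < `|A p - B p| / 2.
  by move/cvgrPdist_lt : cA => /(_ _ e0).
have nB : \forall x \near p, `|B p - B x| < `|A p - B p| / 2.
  by move/cvgrPdist_lt : cB => /(_ _ e0).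
have /nbhs_ballP[r /= r0 hr] : \forall x \near p, [/\ U x,
    `|A p - A x| < `|A p - B p| / 2 & `|B p - B x| < `|A p - B p| / 2].
  by apply: filterS3 nU nA nB => x.
(* The parallelogram with sides [t *: v] and [t *: w] fits into the ball; the summand 1 keeps the
   denominator positive when v = w = 0. *)
pose t := r / (`|v| + `|w| + 1).
have d0 : 0 < `|v| + `|w| + 1 by rewrite ltr_wpDl // addr_ge0.
have t0 : 0 < t by rewrite divr_gt0.
have tr : t * (`|v| + `|w| + 1) = r by rewrite /t divfK // gt_eqF.
have inb a b : 0 <= a <= t -> 0 <= b <= t -> ball p r (p + a *: v + b *: w).
  move=> /andP[a0 at'] /andP[b0 bt]; rewrite -ball_normE /ball_ /=.
  rewrite opprD addrA opprD addNKr -opprD normrN.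
  apply: (le_lt_trans (ler_normD _ _)); rewrite !normrZ !ger0_norm //.
  apply: (@le_lt_trans _ _ (t * (`|v| + `|w|))).
    by rewrite mulrDr lerD // ler_wpM2r.
  by rewrite -[X in _ < X]tr ltr_pM2l // ltrDl.
have Ub a b : 0 <= a <= t -> 0 <= b <= t -> U (p + a *: v + b *: w).
  by move=> ha hb; have [] := hr _ (inb a b ha hb).
have tt : 0 <= t <= t by rewrite (ltW t0) lexx.
have zt : (0 : R) <= 0 <= t by apply/andP; split; [exact: lexx|exact: ltW].
pose D := f (p + t *: v + t *: w) - f (p + t *: v) - f (p + t *: w) + f p.
(* The mean value theorem is applied along [v'] to the increment of f by [t *: w'], then along [w']
   to the derivative of f in direction [v']. *)
have step (v' w' : V) (inU : forall a b, 0 <= a <= t -> 0 <= b <= t -> U (p + a *: v' + b *: w')) :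
   exists a b, [/\ 0 <= a <= t, 0 <= b <= t &
     f (p + t *: v' + t *: w') - f (p + t *: v') - f (p + t *: w') + f p
       = t * (t * 'D_w' ('D_v' f) (p + a *: v' + b *: w'))].
  pose g x := f (x + t *: w') - f x.
  have dfs x : U x -> differentiable f x by move=> Ux; exact: smooth_on_diff Ux.
  have dsh x : U (x + t *: w') -> differentiable (fun x => f (x + t *: w')) x /\
     'D_v' (fun x => f (x + t *: w')) x = 'D_v' f (x + t *: w').
    move=> Ux; have ds : is_diff x (fun x : V => x + t *: w') id.
      have h : is_diff x (id + cst (t *: w')) (id + 0) by apply: is_diffD.
      by rewrite addr0 in h.
    have ds1 : differentiable (fun x : V => x + t *: w') x by exact: ex_diff.
    have d : differentiable (f \o (fun x : V => x + t *: w')) x.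
      by apply: differentiable_comp => //; exact: dfs.
    split; first exact: d.
    have -> : (fun x => f (x + t *: w')) = f \o (fun x : V => x + t *: w') by [].
    by rewrite deriveE // diff_comp //; [rewrite /= diff_val deriveE //; exact: dfs|exact: dfs].
  have dg s : 0 <= s <= t -> differentiable g (p + s *: v') /\
     'D_v' g (p + s *: v') = 'D_v' f (p + s *: v' + t *: w') - 'D_v' f (p + s *: v').
    move=> hs; have U1 := inU _ _ hs tt; have U2 := inU _ _ hs zt.
    rewrite scale0r addr0 in U2.
    have [d1 e1] := dsh _ U1; have d2 := dfs _ U2.
    split; first exact: (differentiableB d1 d2).
    have := @deriveB _ _ _ (fun x => f (x + t *: w')) f _ v' (diff_derivable d1) (diff_derivable
      d2).
    by rewrite e1.
  have [a ha e] := MVT_line (ltW t0) (fun s hs => proj1 (dg s hs)).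
  have [_ ea] := dg a ha.
  have [b hb eb] := @MVT_line V ('D_v' f) (p + a *: v') w' t (ltW t0)
    (fun s hs => smooth_on_diff (smooth_on_derive v' sf) (inU a s ha hs)).
  exists a, b; split=> //; rewrite -eb -ea -e /g.
  by rewrite opprB addrA addrAC.
have [a [b [ha hb e1]]] := step v w Ub.
have Ub' c d : 0 <= c <= t -> 0 <= d <= t -> U (p + c *: w + d *: v).
  by move=> hc hd; rewrite addrAC; exact: Ub.
have [a' [b' [ha' hb' e2]]] := step w v Ub'.
have tn0 : t != 0 by rewrite gt_eqF.
have e : B (p + a *: v + b *: w) = A (p + b' *: v + a' *: w).
  have q1 : p + t *: w + t *: v = p + t *: v + t *: w by rewrite addrAC.
  have q2 : p + a' *: w + b' *: v = p + b' *: v + a' *: w by rewrite addrAC.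
  rewrite q1 q2 in e2.
  apply: (mulfI tn0); apply: (mulfI tn0).
  apply: (etrans (esym e1)); apply: (etrans _ e2).
  by congr (_ + _); exact: addrAC.
have [_ _ hB] := hr _ (inb a b ha hb); have [_ hA _] := hr _ (inb b' a' hb' ha').
rewrite -e in hA.
by case: (dist_half hA hB).
Qed.

End Lines.

(** * Coordinate frames in the left-invariant trivialization *)

Section Frames.
Variables (R : realType) (n : nat) (V : normedModType R) (O : set V).
Hypothesis oO : open O.
Local Notation CH := (CH R n).
Local Notation J := (@J_an R n).
Local Notation "<< x , y >>" := (dot_an x y).
Implicit Types (p q : V) (a b : R).

Lemma smooth_dot_an (Y Y' : V -> CH) : smooth_on O Y -> smooth_on O Y' ->
  smooth_on O (fun p => << Y p, Y' p >>).
Proof. by apply: smooth_on_bil => //; exact: bb_dot_an. Qed.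

Lemma smooth_lc (Y Y' : V -> CH) : smooth_on O Y -> smooth_on O Y' ->
  smooth_on O (fun p => lc (Y p) (Y' p)).
Proof. by apply: smooth_on_bil => //; exact: bb_lc. Qed.

Lemma smooth_J (Y : V -> CH) : smooth_on O Y -> smooth_on O (fun p => J (Y p)).
Proof. by apply: smooth_on_lin => //; [exact: J_an_linear|exact: J_an_cont]. Qed.

Lemma smooth_cZ a (W : normedModType R) (Y : V -> W) : smooth_on O Y ->
  smooth_on O (fun p => a *: Y p).
Proof. by move=> sY; apply: smooth_on_scale => //; exact: smooth_on_cst. Qed.

Lemma smooth_mlc (z Y Y' : V -> CH) :
  smooth_on O z -> smooth_on O Y -> smooth_on O Y' ->
  smooth_on O (fun p => mlc (z p) (Y p) (Y' p)).
Proof.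
move=> sz sY sY'; apply: smooth_on_add => //; first exact: smooth_lc.
apply: smooth_cZ; apply: smooth_on_add => //; apply: smooth_on_scale => //;
  by [exact: smooth_dot_an|exact: smooth_J].
Qed.

Lemma smooth_a (F : V -> CH) : smooth_on O F -> smooth_on O (fun p => (F p).1.1).
Proof.
apply: (@smooth_on_lin _ _ _ _ _ (fun x : CH => x.1.1)) => //.
by move=> x; apply: cont_a; exact: cvg_id.
Qed.

Lemma smooth_u (F : V -> CH) : smooth_on O F -> smooth_on O (fun p => (F p).1.2).
Proof.
apply: (@smooth_on_lin _ _ _ _ _ (fun x : CH => x.1.2)) => //.
by move=> x; apply: cont_u; exact: cvg_id.
Qed.

Lemma smooth_b (F : V -> CH) : smooth_on O F -> smooth_on O (fun p => (F p).2).
Proof.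
by apply: (@smooth_on_lin _ _ _ _ _ (fun x : CH => x.2)) => //; exact: snd_cont.
Qed.

Lemma smooth_triple (f g : V -> R) (h : V -> galpha R n) :
  smooth_on O f -> smooth_on O h -> smooth_on O g ->
  smooth_on O (fun p => (f p, h p, g p) : CH).
Proof. by move=> sf sh sg; do 2 apply: smooth_on_pair => //. Qed.

Lemma smooth_dot_galpha (f g : V -> galpha R n) : smooth_on O f -> smooth_on O g ->
  smooth_on O (fun p => dot_galpha (f p) (g p)).
Proof. by apply: smooth_on_bil => //; exact: bb_dot_galpha. Qed.

Lemma smooth_J_galpha (f : V -> galpha R n) : smooth_on O f ->
  smooth_on O (fun p => J_galpha (f p)).
Proof.
by apply: smooth_on_lin => //; [exact: J_galpha_linear|exact: J_galpha_cont].
Qed.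

Lemma smooth_mct (F Y : V -> CH) : smooth_on O F -> smooth_on O Y ->
  smooth_on O (fun p => mct (F p) (Y p)).
Proof.
move=> sF sY.
have -> : (fun p => mct (F p) (Y p)) = (fun p => ((Y p).1.1,
   expR (- 2^-1 * (F p).1.1) *: (Y p).1.2, expR (- 1 * (F p).1.1) *
      ((Y p).2 + - 2^-1 * dot_galpha (J_galpha (F p).1.2) (Y p).1.2))).
  apply/funext => p; rewrite mct.unlock; congr (_, _ *: _, _).
    by congr expR; rewrite mulNr mulrC mulNr.
  by rewrite mulN1r mulNr.
have c a : smooth_on O (fun=> a : R) by exact: smooth_on_cst.
apply: smooth_triple; first exact: smooth_a.
  apply: smooth_on_scale => //; last exact: smooth_u.
  by apply: smooth_on_exp => //; apply: smooth_on_mul => //; exact: smooth_a.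
apply: smooth_on_mul => //.
  by apply: smooth_on_exp => //; apply: smooth_on_mul => //; exact: smooth_a.
apply: smooth_on_add => //; first exact: smooth_b.
apply: smooth_on_mul => //; apply: smooth_dot_galpha; last exact: smooth_u.
by apply: smooth_J_galpha; exact: smooth_u.
Qed.

Lemma smooth_lft (F Y : V -> CH) : smooth_on O F -> smooth_on O Y ->
  smooth_on O (fun p => lft (F p) (Y p)).
Proof.
move=> sF sY.
have -> : (fun p => lft (F p) (Y p)) = (fun p => ((Y p).1.1,
   expR (2^-1 * (F p).1.1) *: (Y p).1.2, expR (F p).1.1 * (Y p).2
     + 2^-1 * expR (2^-1 * (F p).1.1) * dot_galpha (J_galpha (F p).1.2) (Y p).1.2)).
  by apply/funext => p; rewrite lft.unlock (mulrC _ 2^-1).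
have c a : smooth_on O (fun=> a : R) by exact: smooth_on_cst.
have e : smooth_on O (fun p => expR (2^-1 * (F p).1.1)).
  by apply: smooth_on_exp => //; apply: smooth_on_mul => //; exact: smooth_a.
apply: smooth_triple; first exact: smooth_a.
  by apply: smooth_on_scale => //; exact: smooth_u.
apply: smooth_on_add => //.
  apply: smooth_on_mul => //; last exact: smooth_b.
  by apply: smooth_on_exp => //; exact: smooth_a.
apply: smooth_on_mul => //; first exact: smooth_on_mul.
apply: smooth_dot_galpha; last exact: smooth_u.
by apply: smooth_J_galpha; exact: smooth_u.
Qed.

Lemma derive_comm_an (F : V -> CH) (p v w : V) :
  smooth_on O F -> O p -> 'D_v ('D_w F) p = 'D_w ('D_v F) p.
Proof.
move=> sF Op; apply: dot_an_ext => t.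
have lin : linear (fun x : CH => << x, t >>) by move=> a x y; rewrite dot_anDl dot_anZl.
have cont : continuous (fun x : CH => << x, t >>).
  move=> x; have [_ _ c] := bb_dot_an R n.
  have k : {for x, continuous (fun=> t : CH)} by exact: cst_continuous.
  have i : {for x, continuous (fun x : CH => x)} by exact: cvg_id.
  exact: (cont_comp (cont_pair i k) c).
have D (G : V -> CH) d q : smooth_on O G -> O q ->
    'D_d (fun q => << G q, t >>) q = << 'D_d G q, t >>.
  by move=> sG Oq; have [_] := derive_lin d lin cont (smooth_on_diff sG Oq).
have sw := smooth_on_derive w sF; have sv := smooth_on_derive v sF.
apply: (etrans (esym (D _ v _ sw Op))); apply: (etrans _ (D _ w _ sv Op)).
have st : smooth_on O (fun q => << F q, t >>) by exact: (smooth_on_lin oO lin cont sF).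
have nr : nbhs p O by exact: open_nbhs_nbhs.
have E d d' : 'D_d (fun q => << 'D_d' F q, t >>) p = 'D_d ('D_d' (fun q => << F q, t >>)) p.
  by apply: near_eq_derive; apply: filterS nr => q Oq; rewrite D.
apply: (etrans (E v w)); apply: (etrans _ (esym (E w v))).
exact: (derive_comm_real v w oO st Op).
Qed.

Variable F : V -> CH.
Hypothesis sF : smooth_on O F.

(* The coordinate fields of F, left-translated to T_o CH^n. *)
Definition frame (v : V) (p : V) : CH := mct (F p) ('D_v F p).
Local Notation X := frame.

Lemma smooth_frame v : smooth_on O (X v).
Proof. by apply: smooth_mct => //; exact: smooth_on_derive. Qed.

Lemma frame_linear p : O p -> linear (X^~ p).
Proof.
move=> Op a v w; have d := smooth_on_diff sF Op.
by rewrite /frame !deriveE // linearP mctD mctZ.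
Qed.

(** Coordinate fields commute: the second derivatives of F cancel, and what remains is the
    antisymmetric part of [dmc], that is a bracket, expressed by [lc_torsion]. *)
Lemma frame_torsion p v w : O p ->
  'D_v (X w) p - 'D_w (X v) p = lc (X w p) (X v p) - lc (X v p) (X w p).
Proof.
move=> Op; have d := smooth_on_diff sF Op.
have [_ e1] := derive_mc v d (smooth_on_diff (smooth_on_derive w sF) Op).
have [_ e2] := derive_mc w d (smooth_on_diff (smooth_on_derive v sF) Op).
have {}e1 := etrans e1 (congr1 (fun t => _ + mct (F p) t) (derive_comm_an v w sF Op)).
apply: (etrans (congr2 (fun a b : CH => a - b) e1 e2)).
have alg (x y t : CH) : (x + t) - (y + t) = x - y by rewrite opprD addrACA subrr addr0.
apply: (etrans (alg _ _ _)); apply: (etrans _ (esym (lc_torsion _ _))).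
change (dmc (X v p) (X w p) - dmc (X w p) (X v p) = bracket_an (X w p) (X v p)).
move: (X v p) (X w p) => [[xa xu] xb] [[ya yu] yb].
rewrite /dmc /bracket_an /=; congr (_, _, _) => /=.
- by rewrite subrr.
- by rewrite opprK addrC mulrC [2^-1 * _]mulrC.
- by rewrite (dot_galphaJC yu xu); field.
Qed.

End Frames.

Section DefectAlgebra.
Variables (R : realType) (n : nat).
Implicit Types (x y z w t p q : CH R n).
Local Notation J := (@J_an R n).
Local Notation "<< x , y >>" := (dot_an x y).

Lemma mlcDr z x y w : mlc z x (y + w) = mlc z x y + mlc z x w.
Proof.
rewrite /mlc /acor !lcE; apply: dot_an_ext => t.
by rewrite !(dot_anE, J_anE); ring.
Qed.

Lemma mlcDl z x y w : mlc z (x + y) w = mlc z x w + mlc z y w.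
Proof.
rewrite /mlc /acor !lcE; apply: dot_an_ext => t.
by rewrite !(dot_anE, J_anE); ring.
Qed.

Lemma mlcNl z x w : mlc z (- x) w = - mlc z x w.
Proof.
rewrite /mlc /acor !lcE; apply: dot_an_ext => t.
by rewrite !(dot_anE, J_anE); ring.
Qed.

(** This formula and the next exhibit the defect and its image under J as modified derivatives of
    the tangent fields z and Jz, up to tangent vectors. Hence the defect lies in the maximal complex
    subspace. *)
Lemma defect_mlc z x p : << z, z >> = 1 ->
  p + lc x z - Phi z x = p + mlc z x z + (2^-1 * << x, J z >>) *: z.
Proof.
move=> zz; rewrite /mlc /acor /Phi zz; apply: dot_an_ext => t.
by rewrite !dot_anE; ring.
Qed.

Lemma J_defect_mlc z x p : J (p + lc x z - Phi z x) =
  J p + mlc z x (J z) - 2^-1 *: x + (2^-1 * << x, J z >>) *: J z.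
Proof.
rewrite /mlc /acor /Phi lcJ dot_anJ; apply: dot_an_ext => t.
by rewrite !(dot_anE, J_anE); ring.
Qed.

(** The commutator of two modified derivatives of a field: the ordinary second derivative [s]
    cancels, and the derivatives of x and y enter only through the torsion identity. *)
Lemma mlc_antisym z x y w p q s xy yx xw yw :
  xy - yx = lc y x - lc x y ->
  (s + (mlc z xy w + mlc z y xw + 2^-1 *: (<< y, p >> *: J w + << w, p >> *: J y))
     + mlc z x (yw + mlc z y w))
  - (s + (mlc z yx w + mlc z x yw + 2^-1 *: (<< x, q >> *: J w + << w, q >> *: J x))
     + mlc z y (xw + mlc z x w)) =
  mlc z (lc y x - lc x y) w
  + 2^-1 *: (<< y, p >> *: J w + << w, p >> *: J y)
  - 2^-1 *: (<< x, q >> *: J w + << w, q >> *: J x)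
  + mlc z x (mlc z y w) - mlc z y (mlc z x w).
Proof.
move=> <-; rewrite !mlcDr mlcDl mlcNl; apply: dot_an_ext => t.
by rewrite !dot_anE; ring.
Qed.

Lemma mlc_leibniz z dz x dx y dy :
  lc dx y + lc x dy + 2^-1 *: ((<< dx, z >> + << x, dz >>) *: J y + << x, z >> *: J dy
    + ((<< dy, z >> + << y, dz >>) *: J x + << y, z >> *: J dx)) =
  mlc z dx y + mlc z x dy + 2^-1 *: (<< x, dz >> *: J y + << y, dz >> *: J x).
Proof.
rewrite /mlc /acor; apply: dot_an_ext => t.
by rewrite !dot_anE; ring.
Qed.

(** Undoes the factor [2^-1] in [mlc_curvature] and removes its terms along x and y, which are
    tangent and carry no information. *)
Lemma halve_mod x y w (a b c d : R) : w =
  2 *: (2^-1 *: w - 4^-1 *: (a *: x - b *: y) + 4^-1 *: (c *: x - d *: y))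
  + (2^-1 * a - 2^-1 * c) *: x + (2^-1 * d - 2^-1 * b) *: y.
Proof. by apply: dot_an_ext => t; rewrite !dot_anE; field. Qed.

End DefectAlgebra.

(** * The covariant derivative of Z *)

Section HorosphericalField.
Variables (R : realType) (n : nat) (V : normedModType R) (O : set V).
Hypothesis oO : open O.
Local Notation CH := (CH R n).
Local Notation J := (@J_an R n).
Local Notation "<< x , y >>" := (dot_an x y).
Variables F z : V -> CH.
Hypotheses (sF : smooth_on O F) (sz : smooth_on O z).
Local Notation X := (frame F).

Definition tangent_frame (p : V) : set CH := [set x | exists v, x = X v p].
Local Notation T := tangent_frame.

Lemma tangent_frame_lin p a x y : O p -> T p x -> T p y -> T p (a *: x + y).
Proof.
move=> Op [v ->] [w ->]; exists (a *: v + w).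
by rewrite (frame_linear sF Op).
Qed.

Lemma tangent_frame0 p : O p -> T p 0.
Proof.
move=> Op; exists 0; have := frame_linear sF Op (-1) 0 0.
by rewrite scaler0 addr0 scaleN1r addNr.
Qed.

Lemma tangent_frameD p x y : O p -> T p x -> T p y -> T p (x + y).
Proof. by move=> Op Tx Ty; rewrite -(scale1r x); exact: tangent_frame_lin. Qed.

Lemma tangent_frameZ p a x : O p -> T p x -> T p (a *: x).
Proof.
by move=> Op Tx; rewrite -(addr0 (a *: x)); apply: tangent_frame_lin => //; exact: tangent_frame0.
Qed.

Lemma tangent_frameN p x : O p -> T p x -> T p (- x).
Proof. by move=> Op Tx; rewrite -scaleN1r; exact: tangent_frameZ. Qed.

Lemma tangent_frameB p x y : O p -> T p x -> T p y -> T p (x - y).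
Proof. by move=> Op Tx Ty; apply: tangent_frameD => //; exact: tangent_frameN. Qed.

Hypothesis mlcT : forall Y, smooth_on O Y -> (forall p, O p -> T p (Y p)) ->
  forall p v, O p -> T p ('D_v Y p + mlc (z p) (X v p) (Y p)).
Hypothesis zz : forall p, O p -> << z p, z p >> = 1.
Hypothesis Tz : forall p, O p -> T p (z p).
Hypothesis TJz : forall p, O p -> T p (J (z p)).

Definition defect (v p : V) : CH := 'D_v z p + lc (X v p) (z p) - Phi (z p) (X v p).
Local Notation N := defect.

Lemma TX v p : T p (X v p). Proof. by exists v. Qed.

Lemma defect_tangent v p : O p -> T p (N v p).
Proof.
move=> Op; have h := mlcT sz Tz v Op; rewrite /N defect_mlc; last exact: zz.
by apply: tangent_frameD => //; apply: tangent_frameZ => //; exact: Tz.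
Qed.

Lemma J_defect_tangent v p : O p -> T p (J (N v p)).
Proof.
move=> Op; have h := mlcT (smooth_J oO sz) TJz v Op; rewrite /N J_defect_mlc.
have [_ e] := derive_lin v (@J_an_linear R n) (@J_an_cont R n) (smooth_on_diff sz Op).
rewrite [X in X + mlc _ _ _](esym e).
apply: tangent_frameD => //; last by apply: tangent_frameZ => //; exact: TJz.
by apply: tangent_frameB => //; apply: tangent_frameZ => //; exact: TX.
Qed.

Lemma derive_mlc (Y Y' : V -> CH) (p v : V) :
  differentiable z p -> differentiable Y p -> differentiable Y' p ->
  'D_v (fun p => mlc (z p) (Y p) (Y' p)) p =
  mlc (z p) ('D_v Y p) (Y' p) + mlc (z p) (Y p) ('D_v Y' p) +
  2^-1 *: (<< Y p, 'D_v z p >> *: J (Y' p) + << Y' p, 'D_v z p >> *: J (Y p)).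
Proof.
move=> dz dY dY'; have bs := @bounded_bilinear_scale R CH.
have [d1 e1] := derive_bil v (bb_lc R n) dY dY'.
have [j je] := derive_lin v (@J_an_linear R n) (@J_an_cont R n) dY.
have [j' je'] := derive_lin v (@J_an_linear R n) (@J_an_cont R n) dY'.
have [d2 e2] := derive_bil v (bb_dot_an R n) dY dz.
have [d2' e2'] := derive_bil v (bb_dot_an R n) dY' dz.
have [d3 e3] := derive_bil v bs d2 j'; have [d3' e3'] := derive_bil v bs d2' j.
have [d4 e4] := derive_addf v d3 d3'.
have cs : differentiable (fun=> 2^-1 : R) p by exact: differentiable_cst.
have [d5 e5] := derive_bil v bs cs d4.
have [d6 e6] := derive_addf v d1 d5.
apply: (etrans e6); rewrite e1 e5 e4 e3 e3' derive_cst scale0r add0r.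
rewrite e2 e2' je je'; exact: mlc_leibniz.
Qed.

(** A connection that preserves T has a curvature that preserves T. Of [mlc_curvature] only the
    terms with J say something, the others being tangent anyway. *)
Lemma defect_codazzi a b c p : O p ->
  T p ((<< N a p, X b p >> - << N b p, X a p >>) *: J (X c p)
       + << N a p, X c p >> *: J (X b p) - << N b p, X c p >> *: J (X a p)).
Proof.
move=> Op.
(* The modified derivative of [X c] in direction b is again a tangent field, so [mlcT] can be
   applied a second time. *)
pose Y b p := 'D_b (X c) p + mlc (z p) (X b p) (X c p).
have sX v : smooth_on O (X v) by exact: smooth_frame.
have sY v : smooth_on O (Y v).
  by apply: smooth_on_add => //; [exact: smooth_on_derive|exact: smooth_mlc].
have TY v q : O q -> T q (Y v q) by move=> Oq; apply: mlcT => // r _; exact: TX.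
have DY v w : 'D_v (Y w) p = 'D_v ('D_w (X c)) p +
   (mlc (z p) ('D_v (X w) p) (X c p) + mlc (z p) (X w p) ('D_v (X c) p) +
  2^-1 *: (<< X w p, 'D_v z p >> *: J (X c p) + << X c p, 'D_v z p >> *: J (X w p))).
  have d1 := smooth_on_diff (smooth_on_derive w (sX c)) Op.
  have d2 := smooth_on_diff (smooth_mlc oO sz (sX w) (sX c)) Op.
  have [_ e] := derive_addf v d1 d2.
  apply: (etrans e); congr (_ + _); apply: derive_mlc; exact: smooth_on_diff Op.
have Ta := mlcT (sY b) (TY b) a Op; have Tb := mlcT (sY a) (TY a) b Op.
have Tab := tangent_frameB Op Ta Tb.
have sw : 'D_b ('D_a (X c)) p = 'D_a ('D_b (X c)) p by exact: (derive_comm_an oO b a (sX c) Op).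
have {}Tab : T p (mlc (z p) (lc (X b p) (X a p) - lc (X a p) (X b p)) (X c p)
  + 2^-1 *: (<< X b p, 'D_a z p >> *: J (X c p) + << X c p, 'D_a z p >> *: J (X b p))
  - 2^-1 *: (<< X a p, 'D_b z p >> *: J (X c p) + << X c p, 'D_b z p >> *: J (X a p))
  + mlc (z p) (X a p) (mlc (z p) (X b p) (X c p)) -
    mlc (z p) (X b p) (mlc (z p) (X a p) (X c p))).
  have ft := frame_torsion oO sF a b Op.
  have e := mlc_antisym (z p) (X c p) ('D_a z p) ('D_b z p) ('D_a ('D_b (X c)) p)
     ('D_a (X c) p) ('D_b (X c) p) ft.
  pose G u u' := (u + mlc (z p) (X a p) (Y b p)) - (u' + mlc (z p) (X b p) (Y a p)).
  have E := congr2 G (DY a b) (etrans (DY b a) (congr1 (fun t => t + _) sw)).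
  exact: (eq_ind _ (T p) (eq_ind _ (T p) Tab _ E) _ e).
have {}Tab := tangent_frameZ 2 Op Tab.
move: Tab; rewrite mlc_curvature => Tab.
rewrite [X in T p X](halve_mod (X a p) (X b p) _ << X b p, X c p >> << X a p, X c p >>
  (<< X b p, z p >> * << X c p, z p >>) (<< X a p, z p >> * << X c p, z p >>)).
have T1 v s : T p (s *: X v p) := tangent_frameZ s Op (TX v p).
exact: (tangent_frameD Op (tangent_frameD Op Tab (T1 a _)) (T1 b _)).
Qed.

Lemma complex_subZ (p : V) (a : R) (x : CH) : O p -> ~ T p x -> T p (a *: x) -> a = 0.
Proof.
move=> Op nTx Tax; apply/eqP; apply/negPn/negP => a0; apply: nTx.
by rewrite -(scale1r x) -(mulVf a0) -scalerA; exact: tangent_frameZ.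
Qed.

Lemma tangent_frame_mid (p : V) (x y t : CH) : O p ->
  T p (x + y - t) -> T p x -> T p t -> T p y.
Proof.
move=> Op h Tx Tt; have -> : y = (x + y - t) - x + t.
  by apply: dot_an_ext => s; rewrite !dot_anE; ring.
by apply: tangent_frameD => //; exact: tangent_frameB.
Qed.

(** The vector outside T acts as a probe: a multiple of it can lie in T only if the coefficient
    vanishes. The Codazzi relation is evaluated so that all its other terms are tangent. *)
Lemma defect_eq0 p : O p -> (exists x, T p x /\ ~ T p (J x)) -> forall v, N v p = 0.
Proof.
move=> Op [_ [[d ->] nJd]].
(* For complex directions a and c, two of the three terms of the Codazzi relation for (a, d, c) are
   tangent, which leaves the multiple [<< N a, X c >>] of [J (X d)]. *)
have complex a c : T p (J (X a p)) -> T p (J (X c p)) -> << N a p, X c p >> = 0.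
  move=> Ta Tc; apply: (complex_subZ Op nJd).
  by apply: (tangent_frame_mid Op (defect_codazzi a d c Op)); exact: tangent_frameZ.
(* The defect is itself a complex tangent vector, so it may be taken for [X c], and its length
   vanishes. *)
have N0 a : T p (J (X a p)) -> N a p = 0.
  move=> Ta; have [e Ne] := defect_tangent a Op.
  have Te := eq_ind _ (fun t => T p (J t)) (J_defect_tangent a Op) _ Ne.
  apply: dot_an_eq0; apply: (etrans (congr1 (dot_an (N a p)) Ne)); exact: complex.
move=> v; have [Tv|nJ] := pselect (T p (J (X v p))); first exact: (N0 v Tv).
have [e Ne] := defect_tangent v Op.
have Te := eq_ind _ (fun t => T p (J t)) (J_defect_tangent v Op) _ Ne.
apply: dot_an_eq0; apply: (etrans (congr1 (dot_an (N v p)) Ne)).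
apply: (complex_subZ Op nJ).
(* Here [X e] is the defect [N v], and [N e = 0] is already known. The Codazzi relation for (e, v,
   v) then isolates the squared length of [N v] as the coefficient of the nontangent [J (X v)]. *)
have := tangent_frameD Op (defect_codazzi e v v Op)
  (tangent_frameZ << N v p, X v p >> Op Te).
rewrite subrK -scalerDl (N0 e Te) !dot_an0l sub0r addr0 => h.
by rewrite -(opprK << _, _ >>) scaleNr; exact: tangent_frameN.
Qed.

End HorosphericalField.

(** * Tangent spaces and second fundamental forms *)

Section LocalInversion.
Variable R : realType.

Lemma diff_eps (V W : normedModType R) (f : V -> W) (p : V) (e : R) : 0 < e ->
  differentiable f p ->
  \forall q \near p, `|f q - f p - 'd f p (q - p)| <= e * `|q - p|.
Proof.
move=> e0 df; have := diff_locally df; move=> /eqaddoP /(_ _ e0) h.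
rewrite (near_shift 0 p) subr0.
apply: filterS h => x; rewrite !fctE /= addrK => h.
by apply: le_trans h; rewrite opprD addrA.
Qed.

(** The constant is the minimum of the norm of [A w] over the unit sphere; for m = 0 the sphere is
    empty and any constant will do. *)
Lemma injective_lower_bound m (W : normedModType R) (A : 'rV[R]_m -> W) :
  linear A -> continuous A -> injective A ->
  exists2 k, 0 < k & forall w, k * `|w| <= `|A w|.
Proof.
move=> lA cA iA; have A0 : A 0 = 0.
  by have := lA (-1) 0 0; rewrite scaler0 addr0 scaleN1r addNr.
have AZ a w : A (a *: w) = a *: A w by rewrite -(addr0 (a *: w)) lA A0 addr0.
pose S := [set w : 'rV[R]_m | `|w| = 1].
have [S0|S0] := pselect (S !=set0); last first.
  exists 1 => // w; suff -> : w = 0 by rewrite normr0 mulr0.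
  apply/eqP; apply: contraT => w0; case: S0; exists (`|w|^-1 *: w).
  by rewrite /S /= normrZ normfV normr_id mulVf // normr_eq0.
have cS : compact S.
  apply: bounded_closed_compact.
    exists 1; split; first exact: num_real.
    by move=> x x1 w; rewrite /S /= => ->; exact: ltW.
  apply: (@preimage_closed _ _ (fun w : 'rV[R]_m => `|w|) [set 1]).
    by move=> w _; exact: norm_continuous.
  exact: closed_eq.
have cn : {within S, continuous (fun w => `|A w|)}.
  apply: continuous_subspaceT => w; apply: (cont_comp (cA w)); exact: norm_continuous.
have [c Sc hc] := EVT_min_rV S0 cS cn.
exists `|A c|.
  rewrite normr_gt0; apply/eqP => Ac0.
  have c0 : c = 0 by apply: iA; rewrite Ac0 A0.
  by move: Sc; rewrite inE /S /= c0 normr0 => /esym/eqP; rewrite oner_eq0.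
move=> w; have [->|w0] := eqVneq w 0; first by rewrite normr0 mulr0.
have := hc (`|w|^-1 *: w); rewrite inE /S /= normrZ normfV normr_id mulVf ?normr_eq0 //.
move=> /(_ erefl); rewrite AZ normrZ normfV normr_id ler_pdivlMl ?normr_gt0 //.
by rewrite mulrC.
Qed.

End LocalInversion.

Lemma tangent_range_absurd (R : realType) (t a C K e d : R) : 0 < t -> 0 < a -> 0 < e ->
  e * (C + K) = a / 2 -> C * d <= K * t -> t * a <= C * (e * d) + C * (e * t) -> False.
Proof.
move=> t0 a0 e0 eK Cd ta.
have h1 : e * (C * d) <= e * (K * t) by rewrite ler_pM2l.
have h2 : t * (e * (C + K)) = t * (a / 2) by rewrite eK.
have h3 : 0 < t * a by rewrite mulr_gt0.
by lra.
Qed.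

Section TangentSpace.
Variables (R : realType) (n m : nat) (M : topologicalType) (iota : M -> CH R n).
Variables (O : set 'rV[R]_m) (h : 'rV[R]_m -> M).
Hypothesis hO : local_param iota O h.
Local Notation F := (iota \o h).

Lemma param_open : open O. Proof. by case: hO. Qed.

Lemma param_smooth : smooth_on O F. Proof. by case: hO => _ _ _ _ []. Qed.

Lemma param_velocity x v : O x ->
  has_velocity iota (fun t : R => h (x + t *: v)) (h x) ('D_v F x).
Proof.
move=> Ox; case: hO => _ _ hc _ _; split; first by rewrite scale0r addr0.
  have c0 : {for (0 : R), continuous (fun t : R => x + t *: v)}.
    apply: cont_add; first exact: cst_continuous.
    by apply: cont_scale; [exact: cvg_id|exact: cst_continuous].
  apply: (@cvg_comp _ _ _ (fun t : R => x + t *: v) h _ _ _ c0).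
  by rewrite scale0r addr0; exact: hc.
have d : differentiable F (x + 0 *: v).
  by rewrite scale0r addr0; exact: smooth_on_diff param_smooth Ox.
by have := derive_line d; rewrite scale0r addr0.
Qed.

(** A continuous curve in M stays in the chart for small t, and injectivity of the differential
    bounds its displacement in the parameter space by a multiple of t. So the increment of the curve
    pairs with the part u of v orthogonal to the range to an o(t); hence [<u, v> = 0] and u = 0. *)
Lemma tangent_range x : O x -> tangent iota (h x) = [set v | exists w, v = 'D_w F x].
Proof.
move=> Ox; apply/seteqP; split => [v|v [w ->]]; last first.
  by eexists; exact: param_velocity.
case=> c [c0 cc dc]; case: (hO) => oO inj hc hop [sF iF].
have dF : differentiable F x by exact: smooth_on_diff sF Ox.
pose A := 'd F x : 'rV[R]_m -> CH R n.
have lA : linear A by exact: linearP.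
have cA : continuous A by exact: diff_continuous.
have [k k0 hk] := injective_lower_bound lA cA (iF x Ox).
have ipP : inner_product (@dot_an R n).
  split; [exact: dot_anC| |exact: dot_an_ge0|exact: dot_an_eq0].
  by move=> a y z t; rewrite dot_anDl dot_anZl.
pose S := [set y : CH R n | exists w, y = A w].
have PT : projectable (@dot_an R n) S := projectable_image ipP lA.
pose u := v - orth_proj (@dot_an R n) S v.
have uT w : dot_an u (A w) = 0 by exact: (orth_proj_orth PT v (ex_intro _ w erefl)).
suff uv : dot_an u v = 0.
  have u0 : u = 0.
    apply: dot_an_eq0; rewrite {2}/u dot_anDr uv add0r dot_anNr.
    have [w ->] := orth_projS PT v; by rewrite uT oppr0.
  have [w hw] := orth_projS PT v; exists w.
  by rewrite deriveE // -/A -hw; apply/eqP; rewrite -subr_eq0; apply/eqP.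
have uD : linear (fun y : CH R n => dot_an u y) by move=> a y z; rewrite dot_anDr dot_anZr.
have uc : continuous (fun y : CH R n => dot_an u y).
  move=> y; have [_ _ c'] := bb_dot_an R n.
  have k' : {for y, continuous (fun=> u : CH R n)} by exact: cst_continuous.
  have i : {for y, continuous (fun y : CH R n => y)} by exact: cvg_id.
  exact: (cont_comp (cont_pair k' i) c').
pose uL : {linear CH R n -> R} := HB.pack (fun y : CH R n => dot_an u y)
  (GRing.isLinear.Build _ _ _ _ _ uD).
have [C C0 hC] := @linear_lipschitz R (CH R n) R uL uc.
have dic : differentiable (iota \o c) 0 by apply/derivable1_diffP; case: dc.
have dicE t : 'd (iota \o c) 0 t = t *: v.
  have -> : t = t *: (1 : R) by rewrite /GRing.scale /= mulr1.
  by rewrite linearZ -deriveE //; case: dc => _ ->; rewrite /GRing.scale /= mulr1.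
apply/eqP; apply: contraT => a0.
have na0 : 0 < `|dot_an u v| by rewrite normr_gt0.
(* [K * t] bounds C times the parameter displacement: an error of k/2 in the expansion of F leaves
   the lower bound k/2, and an error of 1 in that of the curve gives the norm of v plus 1. With this
   e, t times the size of [<u, v>] would be at most half of itself. *)
pose K := C * (2 / k * (`|v| + 1)).
have K0 : 0 < K.
  by apply: mulr_gt0 => //; apply: mulr_gt0; [exact: divr_gt0|rewrite ltr_wpDl].
pose e := `|dot_an u v| / (2 * (C + K)).
have e0 : 0 < e by rewrite divr_gt0 // mulr_gt0 // addr_gt0.
have n1 := diff_eps e0 dF.
have n2 := diff_eps (divr_gt0 k0 (ltr0Sn _ 1)) dF.
have nO : nbhs x O by exact: open_nbhs_nbhs.
have nP := @filterI _ _ (nbhs_filter _) _ _ nO (@filterI _ _ (nbhs_filter _) _ _ n1 n2); set Q :=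
  _ `&` _ in nP.
pose B := Q^°; have oB : open B := @open_interior _ Q.
have BP : B `<=` Q := @interior_subset _ Q; have Bx : B x by [].
have BO : B `<=` O by move=> y /BP[].
have nB : nbhs (0 : R) (c @^-1` (h @` B)).
  apply: cc; rewrite c0; apply: open_nbhs_nbhs; split; first exact: hop.
  by exists x.
have n3 := diff_eps ltr01 dic; have n4 := diff_eps e0 dic.
have /nbhs_ballP[r /= r0 hr] := @filterI _ _ (nbhs_filter _) _ _ nB
  (@filterI _ _ (nbhs_filter _) _ _ n3 n4).
have [t [t0 tr]] : exists t : R, 0 < t /\ ball (0 : R) r t.
  exists (r / 2); split; first by rewrite divr_gt0.
  rewrite /ball /= sub0r normrN ger0_norm ?divr_ge0 ?ltW //.
  by rewrite ltr_pdivrMr // ltr_pMr // ltr1n.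
have [[y By hy] []] := hr t tr.
rewrite /= subr0 mul1r c0 dicE (gtr0_norm t0) -hy.
have [_ [P1 P2]] := BP y By.
rewrite -/A in P1 P2; move: P1 P2; set G := iota (h y) - iota (h x).
rewrite /= -/G => P1 P2 Q1 Q2.
have kb := hk (y - x); set d := `|y - x| in P1 P2 kb.
have b1 := ler_normB G (G - A (y - x)); rewrite opprB addrC subrK in b1.
have b2 := ler_normD (G - t *: v) (t *: v); rewrite subrK normrZ (gtr0_norm t0) in b2.
have dt : d <= 2 / k * (`|v| + 1) * t.
  rewrite -(ler_pM2l k0) !mulrA (mulrC k 2) mulfK ?gt_eqF //.
  by move: kb b1 b2 P2 Q1; clear; set a1 := `|A _|; set a2 := `|G|; set a3 := `|G - _|;
    set a4 := `|G - t *: v|; set a5 := `|v|; lra.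
have uG : `|dot_an u G| <= C * (e * d).
  have -> : dot_an u G = dot_an u (G - A (y - x)) by rewrite dot_anDr dot_anNr uT subr0.
  by apply: (le_trans (hC _)); rewrite ler_pM2l.
have uv : t * `|dot_an u v| <= C * (e * d) + C * (e * t).
  rewrite -(gtr0_norm t0) -normrM -dot_anZr (gtr0_norm t0).
  have -> : dot_an u (t *: v) = dot_an u G - dot_an u (G - t *: v).
    by rewrite dot_anDr dot_anNr opprD addrA subrr add0r opprK.
  apply: (le_trans (ler_normB _ _)); apply: lerD => //.
  by apply: (le_trans (hC _)); rewrite ler_pM2l.
have eK : e * (C + K) = `|dot_an u v| / 2.
  by rewrite /e invfM mulrA mulfVK // gt_eqF // addr_gt0.
have Cd : C * d <= K * t by rewrite /K -mulrA ler_pM2l.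
by case: (tangent_range_absurd t0 na0 e0 eK Cd uv).
Qed.

End TangentSpace.

Section MetricAtPoint.
Variables (R : realType) (n : nat).
Local Notation J := (@J_an R n).
Local Notation "<< x , y >>" := (dot_an x y).
Local Notation g := (@metric R n).

Lemma metric_inner p : inner_product (g p).
Proof.
split=> [x y|a x y t|x|x].
- by rewrite !metricE dot_anC.
- by rewrite !metricE mctD mctZ dot_anDl dot_anZl.
- by rewrite metricE dot_an_ge0.
- by rewrite metricE => /dot_an_eq0 x0; apply: (@mct_inj _ _ p); rewrite mct0.
Qed.

Lemma mct_cplx (p x : CH R n) : mct p (cplx p x) = J (mct p x).
Proof. by rewrite cplxE lftK. Qed.

Lemma cplx_funE (p : CH R n) : cplx p = (fun x => lft p (J (mct p x))).
Proof. by apply/funext => x; exact: cplxE. Qed.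

Lemma cplx_linear (p : CH R n) : linear (@cplx R n p).
Proof.
move=> a x y; rewrite cplx_funE; apply: (@mct_inj _ _ p).
by rewrite lftK mctD mctZ [in RHS]mctD [in RHS]mctZ !lftK J_anD J_anZ.
Qed.

Lemma cplxK (p x : CH R n) : cplx p (cplx p x) = - x.
Proof.
rewrite cplx_funE lftK J_anK; apply: (@mct_inj _ _ p); rewrite lftK.
by rewrite -(scaleN1r x) mctZ scaleN1r.
Qed.

Lemma metric_cplxC (p x y : CH R n) : g p (cplx p x) y = - g p (cplx p y) x.
Proof. by rewrite cplx_funE !metricE !lftK dot_anJC. Qed.

End MetricAtPoint.

Section KahlerDecomposition.
Variables (R : realType) (E : lmodType R) (ip : E -> E -> R) (J : E -> E).
Hypotheses (ipP : inner_product ip) (JD : linear J) (JK : forall x, J (J x) = - x).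
Hypothesis JC : forall x y, ip (J x) y = - ip (J y) x.
Variables (T : set E) (phi : R).
Hypotheses (TP : projectable ip T) (sphi : sin phi != 0) (cphi : 0 <= cos phi).
Hypothesis angle : const_kahler_angle ip J (orth ip T) phi.
Local Notation PT := (orth_proj ip T).
Local Notation PN := (orth_proj ip (orth ip T)).

(* [J P_T J xi = - sin^2 phi xi] modulo T for normal xi, so this choice of xi
   cancels the normal part of [J x]. *)
Lemma kahler_decomp x : T x ->
  let xi := - ((sin phi ^+ 2)^-1 *: PN (J x)) in
  [/\ orth ip T xi, T (x - PT (J xi)) & T (J (x - PT (J xi)))].
Proof.
move=> Tx xi; have NP := orth_projectable ipP TP.
have Nxi : orth ip T xi.
  by apply: (projectableN NP); apply: (projectableZ NP); exact: (orth_projS NP).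
have J0 : J 0 = 0 by have := JD (-1) 0 0; rewrite scaler0 addr0 scaleN1r addNr.
have JN y : J (- y) = - J y by rewrite -(addr0 (- y)) -scaleN1r JD J0 addr0 scaleN1r.
have JDD y y' : J (y + y') = J y + J y' by rewrite -{1}(scale1r y) JD scale1r.
split=> //; first by apply: (projectableB TP) => //; exact: (orth_projS TP).
apply: (orth_orth ipP TP) => s Ns.
suff PN0 : PN (J (x - PT (J xi))) = 0.
  by rewrite -(ip_orth_proj ipP NP) // PN0 ip0l.
have PTE : PT (J xi) = J xi - PN (J xi).
  by rewrite orth_proj_compl // opprB addrC subrK.
have /(const_kahler_angleP ipP JD JC NP cphi) K := angle.
have -> : J (x - PT (J xi)) = J x + xi + J (PN (J xi)).
  by rewrite JDD JN PTE JDD JN JK opprD !opprK addrA.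
rewrite !(orth_projD ipP NP) K // (orth_proj_id ipP NP Nxi) -addrA -{1}(scale1r xi) -scalerBl.
rewrite -(cos2Dsin2 phi) addrAC subrr add0r /xi scalerN scalerA divff ?expf_neq0 //.
by rewrite scale1r subrr.
Qed.

End KahlerDecomposition.

Lemma scale_cancel (R : realType) (n : nat) (r a b : R) (u v : CH R n) : r != 0 ->
  (2^-1 * r) *: (b *: - (r^-1 *: u) + a *: - (r^-1 *: v)) =
  - (2^-1 *: (a *: v + b *: u)).
Proof.
move=> r0; apply: dot_an_ext => t; rewrite !dot_anE.
by field.
Qed.

Lemma mct_corr (R : realType) (n : nat) (c s x y : CH R n) :
  mct c (2^-1 *: (metric c x s *: cplx c y + metric c y s *: cplx c x)) =
  acor (mct c s) (mct c x) (mct c y).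
Proof.
by rewrite !metricE cplx_funE mctZ mctD !mctZ !lftK.
Qed.

(** * The second fundamental form in a chart *)

Section SecondFundamentalForm.
Variables (R : realType) (n m : nat) (M : topologicalType) (iota : M -> CH R n).
Variables (phi : R) (O : set 'rV[R]_m) (h : 'rV[R]_m -> M) (Z : M -> CH R n).
Variable II : M -> CH R n -> CH R n -> CH R n.
Hypotheses (sphi : sin phi != 0) (cphi : 0 <= cos phi).
Hypothesis hO : local_param iota O h.
Local Notation F := (iota \o h).
Local Notation J := (@J_an R n).
Local Notation "<< x , y >>" := (dot_an x y).
Local Notation g := (@metric R n).
Local Notation T := (tangent_frame F).

Let sF : smooth_on O F. Proof. exact: param_smooth hO. Qed.
Let oO : open O. Proof. exact: param_open hO. Qed.

Lemma tangent_projectable p : O p -> projectable (g (iota (h p))) (tangent iota (h p)).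
Proof.
move=> Op; have ipP := metric_inner (iota (h p)).
have dF := smooth_on_diff sF Op.
have lA : linear (fun w => 'D_w F p).
  by move=> a v w; rewrite !deriveE // linearP.
by rewrite (tangent_range hO Op); exact: (projectable_image ipP lA).
Qed.

Lemma tangent_mct p v : O p -> tangent iota (h p) v <-> T p (mct (F p) v).
Proof.
move=> Op; rewrite (tangent_range hO Op); split=> -[w].
  by move=> ->; exists w.
by move=> /(@mct_inj _ _ _) ->; exists w.
Qed.

Lemma tangent_lft p x : O p -> T p x -> tangent iota (h p) (lft (F p) x).
Proof. by move=> Op Tx; apply/(tangent_mct _ Op); rewrite lftK. Qed.

Hypothesis sZ : smooth_on O (Z \o h).
Hypothesis ZC : forall q, max_complex (@cplx R n) iota q (Z q).
Hypothesis ZZ : forall q, g (iota q) (Z q) (Z q) = 1.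
Hypothesis angle : const_kahler_normal g (@cplx R n) iota phi.
Hypothesis IIP : is_second_ff m g iota II.
Hypothesis IIZ : trivial_extension g (@cplx R n) iota phi Z II.

Let z p := mct (F p) (Z (h p)).

Lemma smooth_z : smooth_on O z.
Proof. exact: smooth_mct. Qed.

Lemma z_unit p : << z p, z p >> = 1.
Proof. by rewrite /z -metricE; exact: ZZ. Qed.

Lemma z_tangent p : O p -> T p (z p).
Proof. by move=> Op; apply/(tangent_mct _ Op); case: (ZC (h p)). Qed.

Lemma cplx_max_complex q x : max_complex (@cplx R n) iota q x ->
  tangent iota q (- cplx (iota q) x).
Proof. by case=> _ [y Ty <-]; rewrite cplxK opprK. Qed.

Lemma z_cplx_tangent p : O p -> tangent iota (h p) (cplx (iota (h p)) (Z (h p))).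
Proof.
move=> Op; have h1 := cplx_max_complex (ZC (h p)).
by rewrite -[X in tangent _ _ X]opprK; exact: (projectableN (tangent_projectable Op)).
Qed.

Lemma Jz_tangent p : O p -> T p (J (z p)).
Proof.
move=> Op; rewrite -mct_cplx; apply/(tangent_mct _ Op); exact: z_cplx_tangent.
Qed.

(** Writing [x = <x,Z> Z + U + P xi], the vector xi is [- 1 / sin^2 phi] times the normal part of
    Jx. The factor [sin^2 phi] of the trivial extension then cancels, and no reference to the
    splitting is left. *)
Lemma trivial_extensionE p x y : O p -> tangent iota (h p) x -> tangent iota (h p) y ->
  II (h p) x y = - orth_proj (g (iota (h p))) (orth (g (iota (h p))) (tangent iota (h p)))
    (2^-1 *: (g (iota (h p)) x (Z (h p)) *: cplx (iota (h p)) y +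
              g (iota (h p)) y (Z (h p)) *: cplx (iota (h p)) x)).
Proof.
move=> Op Tx Ty; set q := h p; set c := iota q.
have ipP := metric_inner c; have TP : projectable (g c) (tangent iota q) := tangent_projectable Op.
have NP := orth_projectable ipP TP.
have dec := kahler_decomp ipP (cplx_linear c) (cplxK c) (metric_cplxC c) TP
  sphi cphi (const_kahler_normal_orth angle (q:=q)).
have ZT : tangent iota q (Z q) by case: (ZC q).
have JZT : tangent iota q (cplx c (Z q)) by exact: z_cplx_tangent.
have cN a : cplx c (- a) = - cplx c a.
  have c0 : cplx c 0 = 0.
    by have := cplx_linear c (-1) 0 0; rewrite scaler0 addr0 scaleN1r addNr.
  by have := cplx_linear c (-1) a 0; rewrite !scaleN1r c0 !addr0.
have cC s w : tangent iota q w -> tangent iota q (cplx c w) -> 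
    max_complex (@cplx R n) iota q (w - s *: Z q).
  move=> Tw TJw; split; first by apply: (projectableB TP) => //; exact: (projectableZ TP).
  exists (- cplx c (w - s *: Z q)); last by rewrite -/c cN cplxK opprK.
  have -> : cplx c (w - s *: Z q) = cplx c w - s *: cplx c (Z q).
    rewrite addrC -scaleNr cplx_linear addrC scaleNr //.
  by apply: (projectableN TP); apply: (projectableB TP) => //; exact: (projectableZ TP).
have alg (a b t : CH R n) : a = t + (a - b - t) + b by rewrite [t + _]addrC !subrK.
(* The splitting required by [trivial_extension], with [xi] supplied by [kahler_decomp]; the part
   [P xi] is orthogonal to Z because JZ is tangent. *)
have D w : tangent iota q w -> exists U xi,
   [/\ max_complex (@cplx R n) iota q U, g c U (Z q) = 0, orth (g c) (tangent iota q) xi,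
    w = g c w (Z q) *: Z q + U + tangential_J g (@cplx R n) iota q xi &
    xi = - ((sin phi ^+ 2)^-1 *: orth_proj (g c) (orth (g c) (tangent iota q)) (cplx c w))].
  move=> Tw; have [Nxi T1 T2] := dec w Tw.
  set xi := - _ in Nxi T1 T2; set P := orth_proj _ _ (cplx c xi) in T1 T2.
  have PZ : g c P (Z q) = 0.
    rewrite /P (ip_orth_proj ipP TP) // metric_cplxC.
    by have [gC _ _ _] := ipP; rewrite gC (Nxi _ JZT) oppr0.
  exists (w - P - g c w (Z q) *: Z q), xi; split.
  - exact: (cC _ _ T1 T2).
  - by rewrite !(ipDl ipP) !(ipNl ipP) (ipZl ipP) PZ ZZ mulr1 subr0 subrr.
  - exact: Nxi.
  - exact: alg.
  - exact: erefl.
have [U [xi [mU UZ Nxi wx exi]]] := D x Tx; have [U' [xi' [mU' UZ' Nxi' wy exi']]] := D y Ty.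
have nE : normal g iota q = orth (g c) (tangent iota q) := normal_orth g iota q.
rewrite -nE in Nxi Nxi'; rewrite {1}wx {1}wy (IIZ _ _ mU UZ mU' UZ' Nxi Nxi').
have PL a b u v := etrans (orth_projZ ipP NP 2^-1 (a *: u + b *: v))
  (congr1 (fun t => 2^-1 *: t) (etrans (orth_projD ipP NP _ _)
    (congr2 +%R (orth_projZ ipP NP a u) (orth_projZ ipP NP b v)))).
apply: (etrans _ (esym (congr1 -%R (PL _ _ _ _)))); rewrite exi exi'.
by apply: scale_cancel; rewrite expf_neq0.
Qed.

(** By [trivial_extensionE] the correction [acor] has minus the second fundamental form as its
    normal part, so the modified derivative of a tangent field has none. *)
Lemma mlc_tangent Y : smooth_on O Y -> (forall p, O p -> T p (Y p)) ->
  forall p v, O p -> T p ('D_v Y p + mlc (z p) (frame F v p) (Y p)).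
Proof.
move=> sY TY p v Op; case: (hO) => _ inj _ hop _.
pose hinv q := xget 0 [set x | O x /\ h x = q].
have hinvK x : O x -> hinv (h x) = x.
  move=> Ox; rewrite /hinv; case: xgetP => [y _ [Oy e]|/(_ x)]; first exact: inj.
  by case.
pose U := h @` O; have oU : open U by exact: hop.
pose Yf q := lft (iota q) (Y (hinv q)).
have YfE x : O x -> lft (F x) (Y x) = (Yf \o h) x by move=> Ox; rewrite /Yf /= hinvK.
have sYf : smooth_on O (Yf \o h).
  by apply: (smooth_on_ext oO YfE); exact: smooth_lft.
have Yfield : smooth_field m iota U Yf by move=> _ [x Ox <-]; exists O, h, x.
have Ytan q : U q -> tangent iota q (Yf q).
  by move=> [x Ox <-]; rewrite -[Yf (h x)](YfE x Ox); apply: tangent_lft => //; exact: TY.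
have Uq : U (h p) by exists p.
have dYf : is_derive (0 : R) 1 (Yf \o (fun t : R => h (p + t *: v))) ('D_v (Yf \o h) p).
  have d : differentiable (Yf \o h) (p + 0 *: v).
    by rewrite scale0r addr0; exact: smooth_on_diff sYf Op.
  by have := derive_line d; rewrite scale0r addr0.
have e1 := IIP oU Yfield Ytan Uq (param_velocity hO v Op) dYf.
have Tx : tangent iota (h p) ('D_v F p).
  by rewrite (tangent_range hO Op); exists v.
have e2 := trivial_extensionE Op Tx (Ytan _ Uq).
set c := iota (h p) in e1 e2; set y := Yf (h p) in e1 e2.
set a := 'D_v (Yf \o h) p in e1; set x := 'D_v F p in e1 e2 Tx.
have ipP := metric_inner c; have TP := tangent_projectable Op.
have NP := orth_projectable ipP TP.
set corr := 2^-1 *: _ in e2.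
set w := a + christoffel g c x y in e1.
(* The second fundamental form obtained from its definition and the one obtained from the trivial
   extension differ in sign as normal parts, so their sum vanishes. *)
have PN0 : orth_proj (g c) (orth (g c) (tangent iota (h p))) (w + corr) = 0.
  rewrite (orth_projD ipP NP) -[X in _ + X]opprK.
  by apply/eqP; rewrite subr_eq0; apply/eqP; rewrite -e2; exact: esym.
have Tw : tangent iota (h p) (w + corr).
  have := orth_projS TP (w + corr).
  have e := orth_proj_compl ipP (w + corr) TP; rewrite PN0 in e.
  by have /esym/eqP := e; rewrite subr_eq0 => /eqP <-.
have yE : mct c y = Y p by rewrite /y -[Yf (h p)](YfE p Op) lftK.
have -> : 'D_v Y p + mlc (z p) (frame F v p) (Y p) = mct c (w + corr); last first.
  exact/(tangent_mct _ Op).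
have dY : 'D_v Y p = dmc (mct c x) (mct c y) + mct c a.
  have [_ dE] := derive_mc v (smooth_on_diff sF Op) (smooth_on_diff sYf Op).
  apply: (etrans _ dE); apply: near_eq_derive.
  have : nbhs p O by exact: open_nbhs_nbhs.
  by apply: filterS => s Os; rewrite -(YfE s Os) lftK.
rewrite (mctD c w corr) (mctD c a) christoffelE lftK dY.
have -> : mct c corr = acor (z p) (mct c x) (mct c y).
  exact: mct_corr.
rewrite /mlc yE /frame -/x -/c.
have alg (b d e f : CH R n) : b + d + (e + f) = d + (b + e) + f.
  by rewrite [b + d]addrC -!addrA.
exact: alg.
Qed.

End SecondFundamentalForm.

Section Precomposition.
Variable R : realType.
Implicit Types V W E : normedModType R.

Lemma derive_precomp V W E (L : V -> W) (f : W -> E) (p v : V) :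
  linear L -> continuous L -> differentiable f (L p) ->
  differentiable (f \o L) p /\ 'D_v (f \o L) p = 'D_(L v) f (L p).
Proof.
move=> lL cL df.
pose L' : {linear V -> W} := HB.pack L (GRing.isLinear.Build _ _ _ _ _ lL).
have dL : differentiable L p by apply: (@linear_differentiable _ _ _ L').
have d : differentiable (f \o L) p by exact: differentiable_comp.
split => //; rewrite !deriveE // diff_comp //=.
by rewrite (@diff_lin _ _ _ L').
Qed.

Lemma smooth_precomp V W E (U : set W) (L : V -> W) (f : W -> E) :
  open U -> linear L -> continuous L -> smooth_on U f ->
  smooth_on (L @^-1` U) (f \o L).
Proof.
move=> oU lL cL /smooth_onP sf; apply/smooth_onP => k.
have oV : open (L @^-1` U) by apply: open_comp => // x _; exact: cL.
elim: k f sf => [|k IH] f sf; have [df _] := sf 0.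
  by split=> // p Up; have [] := derive_precomp 0 lL cL (df _ Up).
split=> [p Up|v]; first by have [] := derive_precomp 0 lL cL (df _ Up).
apply: (@Ck_ext _ _ _ _ _ ('D_(L v) f \o L)) => //.
  by move=> p Up; have [] := derive_precomp v lL cL (df _ Up).
by apply: IH => j; have [_ h] := sf j.+1; exact: h.
Qed.

End Precomposition.

Lemma sub_eq_opp (R : realType) (x y x' y' : R) :
  x + y = x' + y' -> x - x' = - (y - y').
Proof. by lra. Qed.

(** The algebra behind the uniqueness of the Levi-Civita connection: six alternating transpositions
    return to the start with the opposite sign. *)
Lemma skew_sym_eq0 (R : realType) (V : Type) (S : V -> V -> V -> R) :
  (forall a b c, S a b c = S b a c) -> (forall a b c, S a b c = - S a c b) ->
  forall a b c, S a b c = 0.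
Proof.
move=> sym skew a b c; have := sym a b c; have := skew b a c; have := sym b c a.
by have := skew c b a; have := sym c a b; have := skew a c b; lra.
Qed.

Lemma dot_lc_leibniz (R : realType) (n : nat) (x' x y' y u : CH R n) :
  dot_an x' y + dot_an x y' = dot_an (x' + lc u x) y + dot_an (y' + lc u y) x.
Proof.
rewrite !dot_anDl (lc_skew u x y) (dot_anC x (lc u y)) (dot_anC x y').
by ring.
Qed.

(** * Holomorphic isometries *)

Section Koszul.
Variables (R : realType) (n : nat) (V : normedModType R) (O : set V).
Hypothesis oO : open O.
Local Notation CH := (CH R n).
Local Notation "<< x , y >>" := (dot_an x y).

(* The covariant derivative of the tangent field [frame F w] along [frame F v],
   in the left-invariant trivialization. *)
Definition frame_lc (F : V -> CH) v w p : CH :=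
  'D_v (frame F w) p + lc (frame F v p) (frame F w p).

Lemma frame_lc_sym (F : V -> CH) v w p : smooth_on O F -> O p ->
  frame_lc F v w p = frame_lc F w v p.
Proof.
move=> sF Op; have h := frame_torsion oO sF v w Op.
apply/eqP; rewrite -subr_eq0; apply/eqP; rewrite /frame_lc opprD addrACA.
have alg (a b : CH) : (a - b) + (b - a) = 0 by rewrite addrA subrK subrr.
by apply: (etrans (congr1 (fun t => t + _) h)); exact: alg.
Qed.

Lemma derive_frame_dot (F : V -> CH) u v w p : smooth_on O F -> O p ->
  'D_u (fun q => << frame F v q, frame F w q >>) p =
  << frame_lc F u v p, frame F w p >> + << frame_lc F u w p, frame F v p >>.
Proof.
move=> sF Op.
have d1 := smooth_on_diff (smooth_frame oO sF v) Op.
have d2 := smooth_on_diff (smooth_frame oO sF w) Op.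
have [_ e] := derive_bil u (bb_dot_an R n) d1 d2.
apply: (etrans e); exact: dot_lc_leibniz.
Qed.

(** The difference of the two sides is symmetric in u, v since both connections are torsion-free,
    and skew in v, w since both are metric for the same induced metric. Only components along the
    frame are determined in this way. *)
Lemma koszul (F1 F2 : V -> CH) : smooth_on O F1 -> smooth_on O F2 ->
  (forall p v w, O p ->
     << frame F1 v p, frame F1 w p >> = << frame F2 v p, frame F2 w p >>) ->
  forall p u v w, O p ->
    << frame_lc F1 u v p, frame F1 w p >> = << frame_lc F2 u v p, frame F2 w p >>.
Proof.
move=> s1 s2 iso p u v w Op.
pose S u v w := << frame_lc F1 u v p, frame F1 w p >> - << frame_lc F2 u v p, frame F2 w p >>.
have Ssym a b c : S a b c = S b a c.
  by rewrite /S (frame_lc_sym a b s1 Op) (frame_lc_sym a b s2 Op).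
have Sskew a b c : S a b c = - S a c b.
  have e1 := derive_frame_dot a b c s1 Op; have e2 := derive_frame_dot a b c s2 Op.
  have e : 'D_a (fun q => << frame F1 b q, frame F1 c q >>) p =
           'D_a (fun q => << frame F2 b q, frame F2 c q >>) p.
    have nr : nbhs p O := open_nbhs_nbhs (conj oO Op).
    by apply: near_eq_derive; apply: filterS nr => q Oq; exact: iso.
  exact: (sub_eq_opp (etrans (esym e1) (etrans e e2))).
by apply/eqP; rewrite -subr_eq0; apply/eqP; exact: (skew_sym_eq0 Ssym Sskew u v w).
Qed.

End Koszul.

(** * Isometries commute with the Levi-Civita connection *)

Section Transport.
Variables (R : realType) (n : nat).
Local Notation CH := (CH R n).
Local Notation J := (@J_an R n).
Local Notation "<< x , y >>" := (dot_an x y).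
Local Notation g := (@metric R n).

(* Stability of smoothness under composition with f is used in place of
   [smooth_on setT f], which makes a chain rule of all orders unnecessary. *)
Definition smooth_closed (f : CH -> CH) := forall (V : normedModType R) (O : set V)
  (F : V -> CH), open O -> smooth_on O F -> smooth_on O (fun p => f (F p)).

Lemma smooth_mul_AN (V : normedModType R) (O : set V) (F G : V -> CH) : open O ->
  smooth_on O F -> smooth_on O G -> smooth_on O (fun p => mul_AN (F p) (G p)).
Proof.
move=> oO sF sG; have a1 := smooth_a oO sF; have a2 := smooth_a oO sG.
have u1 := smooth_u oO sF; have u2 := smooth_u oO sG.
have c a : smooth_on O (fun=> a : R) by exact: smooth_on_cst.
have e : smooth_on O (fun p => expR ((F p).1.1 / 2)).
  by apply: smooth_on_exp => //; exact: smooth_on_mul.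
apply: smooth_triple => //.
- exact: smooth_on_add.
- by apply: smooth_on_add => //; exact: smooth_on_scale.
- apply: smooth_on_add => //.
    apply: smooth_on_add => //; first exact: smooth_b.
    by apply: smooth_on_mul => //; [exact: smooth_on_exp|exact: smooth_b].
  apply: smooth_on_mul => //; first exact: smooth_on_mul.
  by apply: smooth_dot_galpha => //; exact: smooth_J_galpha.
Qed.

Definition isometry_at (f : CH -> CH) :=
  (forall p u v, g (f p) ('D_u f p) ('D_v f p) = g p u v) /\
  (forall p v, 'D_(cplx p v) f p = cplx (f p) ('D_v f p)).

(* The differential of f in the left-invariant trivialization. *)
Definition triv_diff (f : CH -> CH) (q x : CH) : CH := mct (f q) ('D_(lft q x) f q).

Variables (f : CH -> CH).
Hypotheses (fsc : smooth_closed f) (fiso : isometry_at f).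
Local Notation A := (triv_diff f).

Let fs : smooth_on setT f.
Proof. by apply: (fsc openT (smooth_on_id openT)). Qed.

Let fd q : differentiable f q.
Proof. exact: (smooth_on_diff fs). Qed.

Lemma triv_diff_dot q x y : << A q x, A q y >> = << x, y >>.
Proof.
have [h _] := fiso; rewrite /triv_diff -metricE h metricE.
by rewrite !lftK.
Qed.

Lemma triv_diff_linear q : linear (A q).
Proof.
move=> a x y; rewrite /triv_diff lftD lftZ !deriveE //.
by rewrite linearP mctD mctZ.
Qed.

Lemma triv_diffJ q x : A q (J x) = J (A q x).
Proof.
have [_ h] := fiso; rewrite /triv_diff.
have e : lft q (J x) = cplx q (lft q x) by rewrite cplx_funE lftK.
apply: (etrans (congr1 (fun t => mct (f q) ('D_t f q)) e)).
apply: (etrans (congr1 (mct (f q)) (h q (lft q x)))); exact: mct_cplx.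
Qed.

Section AlongMap.
Variables (V : normedModType R) (O : set V) (F : V -> CH).
Hypotheses (oO : open O) (sF : smooth_on O F).
Local Notation fF := (fun p => f (F p)).

Lemma frame_triv_diff v p : O p -> frame fF v p = A (F p) (frame F v p).
Proof.
move=> Op; have dF := smooth_on_diff sF Op.
rewrite /frame /triv_diff mctK.
have dc : differentiable (f \o F) p by exact: differentiable_comp.
rewrite -[fF]/(f \o F) (deriveE _ dc) diff_comp //= -(deriveE _ dF).
by rewrite -deriveE.
Qed.

Hypothesis A_surj : forall q y, exists x, A q x = y.

Let inc (p : V) : V * CH := (p, 0).
Let O2 : set (V * CH) := fst @^-1` O.
(** The frame of F alone spans too little for [koszul] to see every component of a covariant
    derivative. Right multiplication by a free point of the group adds all directions, and F is
    recovered along [inc]. *)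
Let Fh (q : V * CH) : CH := mul_AN (F q.1) q.2.

Let inc_lin : linear inc.
Proof.
move=> a x y; change ((a *: x + y, 0) = (a *: x + y, a *: (0 : CH) + 0)).
by rewrite scaler0 addr0.
Qed.

Let inc_cont : continuous inc.
Proof. by move=> x; apply: cont_pair; [exact: cvg_id|exact: cst_continuous]. Qed.

Let oO2 : open O2.
Proof. by apply: open_comp => // x _; exact: fst_cont. Qed.

Let sFh : smooth_on O2 Fh.
Proof.
apply: smooth_mul_AN => //.
  exact: (smooth_precomp oO (@fst_linear R V CH) (@fst_cont R V CH) sF).
apply: (@smooth_on_lin _ _ _ _ _ snd id) => //; first exact: snd_cont.
exact: smooth_on_id.
Qed.

Let O2inc p : O p -> O2 (inc p). Proof. by []. Qed.

(* The auxiliary factor provides constant directions along which F spans CH. *)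
Lemma frame_inc (H : V * CH -> CH) (G : V -> CH) v p : smooth_on O2 H ->
  (forall q, H (inc q) = G q) -> O p ->
  frame H (inc v) (inc p) = frame G v p.
Proof.
move=> sH HG Op; have dH := smooth_on_diff sH (O2inc Op).
have [_ e] := derive_precomp v inc_lin inc_cont dH.
have HGE : H \o inc = G by apply/funext.
by rewrite /frame HG -HGE; apply: (congr1 (mct _)); exact: esym.
Qed.

Lemma frame_lc_inc (H : V * CH -> CH) (G : V -> CH) v w p : smooth_on O2 H ->
  (forall q, H (inc q) = G q) -> O p ->
  frame_lc H (inc v) (inc w) (inc p) = frame_lc G v w p.
Proof.
move=> sH HG Op.
have dH := smooth_on_diff (smooth_frame oO2 sH (inc w)) (O2inc Op).
have [_ e] := derive_precomp v inc_lin inc_cont dH.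
apply: (congr2 +%R _ (congr2 (@lc R n) (frame_inc v sH HG Op) (frame_inc w sH HG Op))).
apply: (etrans (esym e)).
have nr : nbhs p O := open_nbhs_nbhs (conj oO Op).
by apply: near_eq_derive; apply: filterS nr => q Oq; exact: frame_inc.
Qed.

Lemma frame_vertical (y : CH) p : frame Fh (0, y) (inc p) = y.
Proof.
rewrite /frame; have -> : Fh (inc p) = F p by exact: mul_AN0.
suff -> : 'D_(0, y) Fh (inc p) = lft (F p) y by rewrite lftK.
pose L (q : V * CH) := lft (F p) q.2.
apply: (@derive_affine _ _ _ _ L) => h; rewrite /Fh /L /inc /= scaler0 add0r addr0.
rewrite mul_AN0 lft.unlock; case: (F p) y => [[pa pu] pb] [[ya yu] yb].
rewrite /mul_AN /=; congr (_, _, _) => /=.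
- by rewrite addrC addKr.
- by rewrite addrC addKr !scalerA mulrC.
- by rewrite dot_galphaZr /GRing.scale /=; ring.
Qed.

Let fFh (q : V * CH) := f (Fh q).

Let sfFh : smooth_on O2 fFh. Proof. exact: fsc. Qed.

Let FhE q : Fh (inc q) = F q. Proof. exact: mul_AN0. Qed.

Let fFhE q : fFh (inc q) = f (F q). Proof. by rewrite /fFh FhE. Qed.

Lemma frame_fFh v q : O2 q -> frame fFh v q = A (Fh q) (frame Fh v q).
Proof.
move=> Oq; have dF := smooth_on_diff sFh Oq.
rewrite /frame /triv_diff mctK.
have dc : differentiable (f \o Fh) q by exact: differentiable_comp.
rewrite -[fFh]/(f \o Fh) (deriveE _ dc) diff_comp //= -(deriveE _ dF).
by rewrite -deriveE.
Qed.

Lemma frame_fFh_vertical y p : O p -> frame fFh (0, y) (inc p) = A (F p) y.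
Proof.
move=> Op; apply: (etrans (frame_fFh _ (O2inc Op))).
by apply: (congr2 A); [exact: FhE|exact: frame_vertical].
Qed.

Let transport_aux u v p : O p ->
  frame_lc fFh u v (inc p) = A (F p) (frame_lc Fh u v (inc p)).
Proof.
move=> Op.
have iso q v' w : O2 q -> << frame Fh v' q, frame Fh w q >> = << frame fFh v' q, frame fFh w q >>.
  move=> Oq; apply: (etrans (esym (triv_diff_dot (Fh q) _ _))).
  exact: (congr2 (@dot_an R n) (esym (frame_fFh v' Oq)) (esym (frame_fFh w Oq))).
apply: dot_an_ext => t; have [s <-] := A_surj (F p) t.
have e := koszul oO2 sFh sfFh iso u v (0, s) (O2inc Op).
apply: (etrans _ (esym (triv_diff_dot (F p) _ s))).
exact: (etrans (congr1 (dot_an _) (esym (frame_fFh_vertical s Op)))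
  (etrans (esym e) (congr1 (dot_an _) (frame_vertical s p)))).
Qed.

(** In contrast to [koszul] this includes the components normal to the image of F. *)
Lemma frame_lc_transport v w p : O p ->
  frame_lc fF v w p = A (F p) (frame_lc F v w p).
Proof.
move=> Op; apply: (etrans (esym (frame_lc_inc v w sfFh fFhE Op))).
apply: (etrans (transport_aux _ _ Op)).
exact: (congr1 (A (F p)) (frame_lc_inc v w sFh FhE Op)).
Qed.

Lemma triv_diff_const_smooth y : smooth_on O (fun p => A (F p) y).
Proof.
have s := smooth_precomp oO2 inc_lin inc_cont (smooth_frame oO2 sfFh (0, y)).
by apply: (smooth_on_ext oO _ s) => p Op; exact: frame_fFh_vertical.
Qed.

(** [A (F p) y] is the image under f of the left-invariant field with value y, whose covariant
    derivative is [lc _ y] because its trivialization is constant. *)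
Lemma triv_diff_const y v p : O p ->
  'D_v (fun p => A (F p) y) p + lc (frame fF v p) (A (F p) y) =
  A (F p) (lc (frame F v p) y).
Proof.
move=> Op; have h := transport_aux (inc v) (0, y) Op.
have E (H : V * CH -> CH) (G : V -> CH) (Y : V -> CH) : smooth_on O2 H ->
    (forall q, H (inc q) = G q) -> (forall q, O q -> frame H (0, y) (inc q) = Y q) ->
    frame_lc H (inc v) (0, y) (inc p) = 'D_v Y p + lc (frame G v p) (Y p).
  move=> sH HG HY.
  have dH := smooth_on_diff (smooth_frame oO2 sH (0, y)) (O2inc Op).
  have [_ e] := derive_precomp v inc_lin inc_cont dH.
  apply: (congr2 +%R _ (congr2 (@lc R n) (frame_inc v sH HG Op) (HY p Op))).
  apply: (etrans (esym e)).
  have nr : nbhs p O := open_nbhs_nbhs (conj oO Op).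
  by apply: near_eq_derive; apply: filterS nr => q Oq; exact: HY.
have e1 := E fFh fF (fun p => A (F p) y) sfFh fFhE (fun q Oq => frame_fFh_vertical y Oq).
have e2 := E Fh F (fun=> y) sFh FhE (fun q _ => frame_vertical y q).
apply: (etrans (etrans (esym e1) (etrans h (congr1 (A (F p)) e2)))).
apply: (congr1 (A (F p))); apply: (etrans (congr1 (fun t => t + _) (derive_cst y p v))).
exact: add0r.
Qed.

End AlongMap.
End Transport.

(** * Left translations and unitary maps as holomorphic isometries *)

Section Isometries.
Variables (R : realType) (n : nat).
Local Notation CH := (CH R n).
Local Notation galpha := (galpha R n).
Local Notation J := (@J_an R n).
Local Notation Jg := (@J_galpha R n).
Local Notation "<< x , y >>" := (dot_an x y).
Local Notation "<| u , v |>" := (dot_galpha u v).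
Local Notation g := (@metric R n).
Implicit Types (f h : CH -> CH) (p q x y : CH).

Definition an_isometry f := exists f', [/\ smooth_closed f, smooth_closed f',
  cancel f f', cancel f' f & isometry_at f].

Lemma smooth_closed_on f : smooth_closed f -> smooth_on setT f.
Proof. by move=> sf; exact: (sf _ _ id openT (smooth_on_id openT)). Qed.

Lemma smooth_closed_diff f p : smooth_closed f -> differentiable f p.
Proof. by move=> /smooth_closed_on sf; exact: smooth_on_diff sf I. Qed.

Lemma an_isometry_holomorphic f : an_isometry f -> holomorphic_isometry g (@cplx R n) f.
Proof.
move=> [f' [sf sf' ff' f'f [h1 h2]]]; split=> //; first exact: smooth_closed_on.
by exists f'; split=> //; exact: smooth_closed_on.
Qed.

(** In the trivialization both conditions concern linear maps of one fixed Hermitian space, the Lie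
    algebra. *)
Lemma isometry_triv f (A : CH -> CH -> CH) :
  (forall p v, mct (f p) ('D_v f p) = A p (mct p v)) ->
  (forall p x y, << A p x, A p y >> = << x, y >>) ->
  (forall p x, A p (J x) = J (A p x)) -> isometry_at f.
Proof.
move=> h iso Jh; split=> p u; last first.
  apply: (@mct_inj _ _ (f p)); apply: (etrans (h p (cplx p u))).
  apply: (etrans (congr1 (A p) (mct_cplx p u))); apply: (etrans (Jh p _)).
  by apply: (etrans _ (esym (mct_cplx _ _))); exact: (congr1 J (esym (h p u))).
move=> v; rewrite !metricE; apply: (etrans (congr2 (@dot_an R n) (h p u) (h p v))).
exact: iso.
Qed.

Lemma derive_comp f h p v : differentiable f p -> differentiable h (f p) ->
  'D_v (h \o f) p = 'D_('D_v f p) h (f p).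
Proof.
move=> df dh; have d : differentiable (h \o f) p by exact: differentiable_comp.
apply: (etrans (deriveE _ d)); rewrite diff_comp //=.
apply: (etrans (congr1 ('d h (f p)) (esym (deriveE v df)))).
exact: (esym (deriveE _ dh)).
Qed.

Lemma an_isometry_comp f h : an_isometry f -> an_isometry h -> an_isometry (h \o f).
Proof.
move=> [f' [sf sf' ff' f'f [f1 f2]]] [h' [sh sh' hh' h'h [h1 h2]]].
have D p v := derive_comp v (smooth_closed_diff p sf) (smooth_closed_diff (f p) sh).
exists (f' \o h'); split.
- by move=> V O F oO sF; apply: sh => //; exact: sf.
- by move=> V O F oO sF; apply: sf' => //; exact: sh'.
- exact: can_comp.
- exact: can_comp.
split=> p u.
  move=> v; rewrite -(f1 p u v) -(h1 (f p)).
  exact: (congr2 (g (h (f p))) (D p u) (D p v)).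
apply: (etrans (D p _)); apply: (etrans _ (congr1 (cplx _) (esym (D p u)))).
apply: (etrans _ (h2 (f p) _)).
exact: (congr1 (fun t => 'D_t h (f p)) (f2 p u)).
Qed.

Lemma an_isometry_surj f q y : an_isometry f -> exists x, triv_diff f q x = y.
Proof.
move=> [f' [sf sf' ff' f'f _]].
exists (mct q ('D_(lft (f q) y) f' (f q))); rewrite /triv_diff mctK.
have e := derive_comp (lft (f q) y) (smooth_closed_diff (f q) sf')
  (smooth_closed_diff (f' (f q)) sf).
have fid : f \o f' = id by apply/funext.
rewrite fid derive_id ff' in e.
by rewrite -e lftK.
Qed.

Lemma an_isometry_id : an_isometry id.
Proof.
exists id; split; [by []|by []|by []|by []|split=> p u].
  by move=> v; exact: (congr2 (g p) (derive_id _ _) (derive_id _ _)).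
apply: (etrans (derive_id _ _)); exact: (congr1 (cplx p) (esym (derive_id _ _))).
Qed.

Lemma inv_ANK (p : CH) : cancel (mul_AN p) (mul_AN (inv_AN p)).
Proof.
move=> q; rewrite mul_ANA mul_VAN /mul_AN; case: q => [[a u] b] /=.
rewrite mul0r expR0 !add0r scale1r mul1r -(scale0r (0 : galpha)) J_galphaZ.
by rewrite dot_galphaZl mul0r mulr0 addr0.
Qed.

Lemma inv_ANinv (p : CH) : inv_AN (inv_AN p) = p.
Proof.
case: p => [[a u] b]; rewrite /inv_AN /= opprK; congr (_, _, _).
  by rewrite scalerN opprK scalerA -expRD -mulrDl addrN mul0r expR0 scale1r.
by rewrite mulrN opprK mulrA -expRD addrN expR0 mul1r.
Qed.

Lemma derive_mul_AN_at p q v : 'D_v (mul_AN p) q = lft p v.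
Proof.
apply: (@derive_affine _ _ _ _ (lft p)) => h; rewrite lft.unlock.
case: p q v => [[pa pu] pb] [[qa qu] qb] [[va vu] vb].
rewrite /mul_AN /=; congr (_, _, _) => /=.
- by rewrite /GRing.scale /=; ring.
- by rewrite scalerDr opprD addrACA subrr add0r addrK !scalerA mulrC.
- by rewrite dot_galphaDr dot_galphaZr /GRing.scale /=; ring.
Qed.

Lemma mct_mul_AN p q v : mct (mul_AN p q) (lft p v) = mct q v.
Proof.
rewrite mct.unlock lft.unlock.
case: p q v => [[pa pu] pb] [[qa qu] qb] [[va vu] vb].
rewrite /mul_AN /=; congr (_, _, _).
  by rewrite scalerA -expRD -mulrDl opprD addrAC addNr add0r.
rewrite !(dot_galphaE, J_galphaE).
have e1 : expR (- (pa + qa)) = expR (- qa) / expR pa by rewrite opprD expRD (expRN pa) mulrC.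
have e2 : expR pa = expR (pa / 2) * expR (pa / 2) by rewrite -expRD -splitr.
have e0 : expR (pa / 2) != 0 by rewrite gt_eqF ?expR_gt0.
rewrite e1 e2; by field.
Qed.

(** In the left-invariant trivialization the differential of a left translation is the identity. *)
Lemma an_isometry_mul_AN p : an_isometry (mul_AN p).
Proof.
have sm q : smooth_closed (mul_AN q).
  by move=> V O F oO sF; apply: smooth_mul_AN => //; exact: smooth_on_cst.
exists (mul_AN (inv_AN p)); split; [exact: sm|exact: sm|exact: inv_ANK| |].
  by have := inv_ANK (inv_AN p); rewrite inv_ANinv.
apply: (@isometry_triv _ (fun _ x => x)); [|by []|by []] => q v.
by rewrite derive_mul_AN_at mct_mul_AN.
Qed.

Definition unitary_galpha (U : galpha -> galpha) := [/\ linear U,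
  forall u v, <|U u, U v|> = <|u, v|> & forall u, U (Jg u) = Jg (U u)].

Definition extend_galpha (U : galpha -> galpha) p : CH := (p.1.1, U p.1.2, p.2).

Lemma an_isometry_extend U U' : unitary_galpha U -> unitary_galpha U' ->
  continuous U -> continuous U' -> cancel U U' -> cancel U' U ->
  an_isometry (extend_galpha U).
Proof.
move=> [lU dU JU] [lU' _ _] cU cU' UU' U'U.
have sm (W : galpha -> galpha) : linear W -> continuous W -> smooth_closed (extend_galpha W).
  move=> lW cW V O F oO sF; apply: smooth_triple => //.
  - exact: smooth_a.
  - by apply: (@smooth_on_lin _ _ _ _ _ W) => //; exact: smooth_u.
  - exact: smooth_b.
exists (extend_galpha U'); split; [exact: sm|exact: sm| | |].
- by case=> [[a u] b]; rewrite /extend_galpha /= UU'.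
- by case=> [[a u] b]; rewrite /extend_galpha /= U'U.
have UZ a u : U (a *: u) = a *: U u.
  have U0 : U 0 = 0 by have := lU (-1) 0 0; rewrite scaler0 addr0 scaleN1r addNr.
  by have := lU a u 0; rewrite U0 !addr0.
apply: (@isometry_triv _ (fun _ => extend_galpha U)).
- move=> p v; have -> : 'D_v (extend_galpha U) p = extend_galpha U v.
    apply: (@derive_affine _ _ _ _ (extend_galpha U)) => h.
    rewrite /extend_galpha; congr (_, _, _) => /=; rewrite ?addrK //.
    by rewrite lU addrK.
  rewrite mct.unlock /extend_galpha /=; congr (_, _, _); first by rewrite UZ.
  by rewrite -JU dU.
- by move=> p x y; rewrite /dot_an /= dU.
- by move=> p x; rewrite /extend_galpha /J_an /= JU.
Qed.

End Isometries.

(* In the Siegel domain coordinates w = e^a + |u|^2/4 + i b and u, the inversion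
   is (w, u) |-> (1/w, u/w). *)
Section Inversion.
Variables (R : realType) (n : nat).
Local Notation CH := (CH R n).
Local Notation galpha := (galpha R n).
Local Notation J := (@J_an R n).
Local Notation Jg := (@J_galpha R n).
Local Notation "<< x , y >>" := (dot_an x y).
Local Notation "<| u , v |>" := (dot_galpha u v).
Implicit Types (p q x y v : CH).

Definition rew p : R := expR p.1.1 + 4^-1 * <|p.1.2, p.1.2|>.
Definition normw p : R := rew p ^+ 2 + p.2 ^+ 2.

Definition inversion p : CH :=
  (p.1.1 - ln (normw p), (normw p)^-1 *: (rew p *: p.1.2 - p.2 *: Jg p.1.2),
   - ((normw p)^-1 * p.2)).

Lemma rew_gt0 p : 0 < rew p.
Proof.
by rewrite /rew ltr_pwDl ?expR_gt0 // mulr_ge0 ?invr_ge0 // dot_galpha_ge0.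
Qed.

Lemma normw_gt0 p : 0 < normw p.
Proof. by rewrite /normw ltr_pwDl ?exprn_gt0 ?rew_gt0 // sqr_ge0. Qed.

Lemma normw_neq0 p : normw p != 0. Proof. by rewrite gt_eqF ?normw_gt0. Qed.

Lemma smooth_rew (V : normedModType R) (O : set V) (F : V -> CH) : open O ->
  smooth_on O F -> smooth_on O (fun q : V => rew (F q)).
Proof.
move=> oO sF; have su := smooth_u oO sF.
apply: smooth_on_add => //; first by apply: smooth_on_exp => //; exact: smooth_a.
by apply: smooth_cZ => //; exact: smooth_dot_galpha.
Qed.

Lemma smooth_normw (V : normedModType R) (O : set V) (F : V -> CH) : open O ->
  smooth_on O F -> smooth_on O (fun q : V => normw (F q)).
Proof.
move=> oO sF; have sr := smooth_rew oO sF; have sb := smooth_b oO sF.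
by apply: smooth_on_add => //; apply: smooth_on_mul.
Qed.

Lemma smooth_inversion : smooth_closed inversion.
Proof.
move=> V O F oO sF; have sr := smooth_rew oO sF; have sn := smooth_normw oO sF.
have su := smooth_u oO sF; have sb := smooth_b oO sF.
have sN : smooth_on O (fun q : V => (normw (F q))^-1).
  by apply: smooth_on_inv => // q _; exact: normw_neq0.
apply: smooth_triple => //.
- apply: smooth_on_sub_fun => //; first exact: smooth_a.
  by apply: smooth_on_ln => // q _; exact: normw_gt0.
- apply: smooth_on_scale => //; apply: smooth_on_sub_fun => //.
    exact: smooth_on_scale.
  by apply: smooth_on_scale => //; exact: smooth_J_galpha.
- by apply: smooth_on_opp => //; exact: smooth_on_mul.
Qed.

Lemma exp_ln_normw p (c : R) : expR (c - ln (normw p)) = expR c / normw p.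
Proof. by rewrite expRD expRN lnK // posrE normw_gt0. Qed.

Lemma inversion_dot p : <|(inversion p).1.2, (inversion p).1.2|> = <|p.1.2, p.1.2|> / normw p.
Proof.
rewrite /= !(dot_galphaE, dot_galphaJr, J_galphaE) dot_galphaJ.
have N0 := normw_neq0 p; have NE : normw p = rew p ^+ 2 + p.2 ^+ 2 by [].
move: NE N0; set N := normw p; set a := dot_galpha _ _; set r := rew p => NE N0.
by rewrite NE in N0 *; field.
Qed.

Lemma rew_inversion p : rew (inversion p) = rew p / normw p.
Proof.
rewrite {1}/rew inversion_dot /= exp_ln_normw /rew.
by rewrite mulrDl mulrA.
Qed.

Lemma normw_inversion p : normw (inversion p) = (normw p)^-1.
Proof.
rewrite {1}/normw rew_inversion /=; have N0 := normw_neq0 p.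
have -> : (rew p / normw p) ^+ 2 + (- ((normw p)^-1 * p.2)) ^+ 2 =
   (rew p ^+ 2 + p.2 ^+ 2) / normw p / normw p by field.
by rewrite -/(normw p) divff // mul1r.
Qed.

Lemma inversionK : involutive inversion.
Proof.
move=> p; have N0 := normw_neq0 p.
rewrite {1}/inversion normw_inversion rew_inversion invrK.
rewrite /inversion /=; set N := normw p in N0 *.
have -> : ln N^-1 = - ln N by rewrite lnV ?posrE ?normw_gt0.
case: p @N N0 => [[a u] b] /=; set N := normw _ => N0; congr (_, _, _).
- by rewrite opprK subrK.
- rewrite J_galphaZ J_galphaD J_galphaN !J_galphaZ J_galphaK.
  apply/eqP; rewrite -subr_eq0; apply/eqP/dot_galpha_eq0.
  set r := rew _; have NE : N = r ^+ 2 + b ^+ 2 by [].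
  rewrite !(dot_galphaE, dot_galphaJr, J_galphaE) !dot_galphaJ.
  set d := dot_galpha _ _; rewrite NE in N0 *; by field.
- by rewrite mulrN opprK mulrA divff // mul1r.
Qed.

Lemma dot_galpha_ext (u v : galpha) : (forall t, <|u, t|> = <|v, t|>) -> u = v.
Proof.
move=> h; apply/eqP; rewrite -subr_eq0; apply/eqP/dot_galpha_eq0.
by rewrite dot_galphaDl dot_galphaNl h subrr.
Qed.

Definition drew p v : R := expR p.1.1 * v.1.1 + 2^-1 * <|p.1.2, v.1.2|>.

Definition dnormw p v : R := 2 * (rew p * drew p v + p.2 * v.2).

Definition dinversion p v : CH :=
  (v.1.1 - dnormw p v / normw p,
   (normw p)^-1 *: (drew p v *: p.1.2 + rew p *: v.1.2 - v.2 *: Jg p.1.2 - p.2 *: Jg v.1.2)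
     - (dnormw p v / normw p ^+ 2) *: (rew p *: p.1.2 - p.2 *: Jg p.1.2),
   - ((normw p)^-1 * v.2) + dnormw p v / normw p ^+ 2 * p.2).

Lemma derive_inversion p v : 'D_v inversion p = dinversion p v.
Proof.
have did : differentiable (id : CH -> CH) p.
  exact: (smooth_on_diff (smooth_on_id openT) (I : setT p)).
have [a1 a2] := derive_a v did; have [u1 u2] := derive_u v did; have [b1 b2] := derive_b v did.
rewrite derive_id in a2; rewrite derive_id in u2; rewrite derive_id in b2.
have bs W := @bounded_bilinear_scale R W.
have [e1 e2] := derive_comp_real v (is_derive_expR _) a1.
have [d1 d2] := derive_bil v (bb_dot_galpha R n) u1 u1.
have [q1 q2] := derive_bil v (bs R) (differentiable_cst (4^-1 : R) p) d1.
have [r1 r2] := derive_addf v e1 q1.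
have r3 : differentiable rew p by exact: r1.
have [n1 n2] := derive_bil v (bs R) r3 r3; have [n3 n4] := derive_bil v (bs R) b1 b1.
have [N1 N2] := derive_addf v n1 n3.
have Dr : 'D_v rew p = drew p v.
  apply: (etrans r2); rewrite e2 q2 d2 a2 u2 derive_cst scale0r add0r /drew.
  by rewrite (dot_galphaC v.1.2) /GRing.scale /= mulrC; congr (_ + _); field.
have DN : 'D_v normw p = dnormw p v.
  apply: (etrans N2); rewrite n2 n4 b2 Dr /dnormw.
  by rewrite /GRing.scale /=; ring.
have dN : differentiable normw p by exact: N1.
have [i1 i2] : differentiable (fun q => (normw q)^-1) p /\
    'D_v (fun q => (normw q)^-1) p = - (dnormw p v / normw p ^+ 2).
  have h : is_derive (normw p) 1 (@GRing.inv R) (- (normw p ^- 2)).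
    have n0 := normw_neq0 p; have di : derivable (id : R -> R) (normw p) 1 by exact: derivable_id.
    split; first by apply: (@derivableV _ _ (id : R -> R)).
    by rewrite (@deriveV _ _ (id : R -> R) (normw p) 1 n0 di) derive_id /GRing.scale /= mulr1.
  have [i1 i2] := derive_comp_real v h dN; split; first exact: i1.
  by apply: (etrans i2); rewrite DN mulrN.
have [l1 l2] : differentiable (fun q => ln (normw q)) p /\
    'D_v (fun q => ln (normw q)) p = dnormw p v / normw p.
  have [l1 l2] := derive_comp_real v (is_derive1_ln (normw_gt0 p)) dN.
  by split; [exact: l1|apply: (etrans l2); rewrite DN].
have oL (W : normedModType R) : linear (-%R : W -> W) by move=> a x y; rewrite opprD scalerN.
have oc (W : normedModType R) : continuous (-%R : W -> W) by move=> x; exact: opp_continuous.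
have [l3 l4] := derive_lin v (oL R) (oc R) l1.
have [A1 A2] := derive_addf v a1 l3.
have [j1 j2] := derive_lin v (@J_galpha_linear R n) (@J_galpha_cont R n) u1.
have [m1 m2] := derive_bil v (bs galpha) r3 u1.
have [m3 m4] := derive_bil v (bs galpha) b1 j1.
have [m5 m6] := derive_lin v (oL galpha) (oc galpha) m3.
have [m7 m8] := derive_addf v m1 m5.
have [U1 U2] := derive_bil v (bs galpha) i1 m7.
have [B1 B2] := derive_bil v (bs R) i1 b1.
have [B3 B4] := derive_lin v (oL R) (oc R) B1.
have [P1 P2] := derive_pair v A1 U1; have [Q1 Q2] := derive_pair v P1 B3.
apply: (etrans Q2); rewrite P2 A2 l4 l2 a2 U2 B4 B2 i2 m8 m6 m4 m2 j2 u2 b2.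
rewrite Dr /dinversion; congr (_, _, _).
  apply: dot_galpha_ext => t; rewrite /= !dot_galphaE; by ring.
by rewrite /GRing.scale /=; ring.
Qed.

(* The differential in the trivialization: theta' = theta - 2 dw / w and
   eta' = (|w| / w) (eta - e^(-a/2) u dw / w). *)
Definition inv_alpha p x : R :=
  let dr := expR p.1.1 * x.1.1 + 2^-1 * expR (p.1.1 / 2) * <|p.1.2, x.1.2|> in
  let db := expR p.1.1 * x.2 + 2^-1 * expR (p.1.1 / 2) * <|Jg p.1.2, x.1.2|> in
  (rew p * dr + p.2 * db) / normw p.

Definition inv_beta p x : R :=
  let dr := expR p.1.1 * x.1.1 + 2^-1 * expR (p.1.1 / 2) * <|p.1.2, x.1.2|> in
  let db := expR p.1.1 * x.2 + 2^-1 * expR (p.1.1 / 2) * <|Jg p.1.2, x.1.2|> in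
  (rew p * db - p.2 * dr) / normw p.

Definition inv_eta p x : galpha :=
  x.1.2 - expR (- p.1.1 / 2) *: (inv_alpha p x *: p.1.2 + inv_beta p x *: Jg p.1.2).

Definition triv_inversion p x : CH :=
  (x.1.1 - 2 * inv_alpha p x,
   expR (- ln (normw p) / 2) *: (rew p *: inv_eta p x - p.2 *: Jg (inv_eta p x)),
   x.2 - 2 * inv_beta p x).

Lemma triv_inversionJ p x : triv_inversion p (J x) = J (triv_inversion p x).
Proof.
have ea : inv_alpha p (J x) = - inv_beta p x.
  rewrite /inv_alpha /inv_beta /= ?(dot_galphaE, dot_galphaJr, J_galphaE).
  by have := normw_neq0 p; set N := normw p => N0; field.
have eb : inv_beta p (J x) = inv_alpha p x.
  rewrite /inv_alpha /inv_beta /= ?(dot_galphaE, dot_galphaJr, J_galphaE).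
  by have := normw_neq0 p; set N := normw p => N0; field.
have ee : inv_eta p (J x) = Jg (inv_eta p x).
  rewrite /inv_eta ea eb !(J_galphaE) /=; congr (_ - _ *: _).
  by rewrite scalerN scaleNr addrC.
rewrite {1}/triv_inversion ea eb ee /triv_inversion /J_an.
cbn beta iota delta [fst snd]; congr (_, _, _); try ring.
have alg s r b (w : galpha) : s *: (r *: Jg w - b *: Jg (Jg w)) = Jg (s *: (r *: w - b *: Jg w)).
  by rewrite J_galphaZ J_galphaD J_galphaN !J_galphaZ.
exact: alg.
Qed.

(** The factor [conj w / |w|] acts isometrically on the g_alpha part. What remains is a rational
    identity once the norm of u is eliminated by [|u|^2 = 4 (Re w - e^a)]. *)
Lemma triv_inversion_dot p x y : << triv_inversion p x, triv_inversion p y >> = << x, y >>.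
Proof.
have N0 := normw_neq0 p; have NE : normw p = rew p ^+ 2 + p.2 ^+ 2 by [].
have e2 : expR (- ln (normw p) / 2) * expR (- ln (normw p) / 2) = (normw p)^-1.
  by rewrite -expRD -splitr expRN lnK // posrE normw_gt0.
have s : <|(triv_inversion p x).1.2, (triv_inversion p y).1.2|> = <|inv_eta p x, inv_eta p y|>.
  rewrite /= dot_galphaZl dot_galphaZr mulrA e2.
  rewrite !(dot_galphaE, dot_galphaJJ, dot_galphaJr, J_galphaE).
  set d := dot_galpha _ _; set d' := dot_galpha _ _.
  by rewrite NE in N0 *; field.
rewrite {1}/dot_an s /triv_inversion /= /inv_eta /dot_an.
rewrite !(dot_galphaE, dot_galphaJJ, dot_galphaJr, J_galphaE, dot_galphaJ).
rewrite ?(dot_galphaC x.1.2 p.1.2) ?(dot_galphaC x.1.2 (Jg p.1.2)) ?(dot_galphaJC x.1.2 p.1.2).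
have ee : expR (- p.1.1 / 2) = (expR (p.1.1 / 2))^-1 by rewrite mulNr expRN.
have e0 : expR (p.1.1 / 2) != 0 by rewrite gt_eqF ?expR_gt0.
have eE : expR p.1.1 = expR (p.1.1 / 2) * expR (p.1.1 / 2) by rewrite -expRD -splitr.
have uE : <|p.1.2, p.1.2|> = 4 * (rew p - expR p.1.1) by rewrite /rew; field.
rewrite uE ee /inv_alpha /inv_beta !eE; rewrite NE in N0 *.
move: N0 e0; clear; move: (expR (p.1.1 / 2)) (rew p) p.2 <|p.1.2, x.1.2|> <|p.1.2, y.1.2|>
  <|Jg p.1.2, x.1.2|> <|Jg p.1.2, y.1.2|> <|x.1.2, y.1.2|> x.1.1 y.1.1 x.2 y.2.
by move=> E r b d1 d2 d3 d4 d5 xa ya xb yb N0 e0; field; rewrite N0 e0.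
Qed.

Lemma mct_dinversion p v : mct (inversion p) (dinversion p v) = triv_inversion p (mct p v).
Proof.
have N0 := normw_neq0 p; have NE : normw p = rew p ^+ 2 + p.2 ^+ 2 by [].
have e0 : expR (p.1.1 / 2) != 0 by rewrite gt_eqF ?expR_gt0.
have eE : expR p.1.1 = expR (p.1.1 / 2) * expR (p.1.1 / 2) by rewrite -expRD -splitr.
have ee : expR (- p.1.1 / 2) = (expR (p.1.1 / 2))^-1 by rewrite mulNr expRN.
have eEN : expR (- p.1.1) = (expR p.1.1)^-1 by rewrite expRN.
have ia : inv_alpha p (mct p v) = (rew p * drew p v + p.2 * v.2) / normw p.
  rewrite /inv_alpha mct.unlock /= /drew !(dot_galphaE) ee eEN eE.
  by field; rewrite N0 e0.
have ib : inv_beta p (mct p v) = (rew p * v.2 - p.2 * drew p v) / normw p.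
  rewrite /inv_beta mct.unlock /= /drew !(dot_galphaE) ee eEN eE.
  by field; rewrite N0 e0.
have uE : <|p.1.2, p.1.2|> = 4 * (rew p - expR p.1.1) by rewrite /rew; field.
have l1 : expR (- (p.1.1 - ln (normw p))) = normw p * expR (- p.1.1).
  by rewrite opprB expRD lnK // posrE normw_gt0.
pose s := expR (ln (normw p) / 2).
have s0 : s != 0 by rewrite gt_eqF ?expR_gt0.
have sN : normw p = s * s by rewrite /s -expRD -splitr lnK // posrE normw_gt0.
have l2 : expR (- (p.1.1 - ln (normw p)) / 2) = s * expR (- p.1.1 / 2).
  by rewrite opprB mulrDl expRD.
have l3 : expR (- ln (normw p) / 2) = s / normw p.
  by rewrite mulNr expRN -/s sN; field.
rewrite /triv_inversion /inv_eta ia ib l3 mct.unlock /inversion /dinversion.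
cbn beta iota delta [fst snd]; rewrite l1 l2 /dnormw; congr (_, _, _).
- by field.
- rewrite !J_galphaE; apply: dot_galpha_ext => t; rewrite !dot_galphaE.
  move: NE N0; clear; move: (normw p) (rew p) (drew p v) (expR (- p.1.1 / 2)) p.2 v.2
    <|p.1.2, t|> <|Jg p.1.2, t|> <|v.1.2, t|> <|Jg v.1.2, t|> => N r d e b vb d1 d2 d3 d4 -> N0.
  by field.
- rewrite !(dot_galphaE, dot_galphaJJ, dot_galphaJr, J_galphaE, dot_galphaJ) uE.
  rewrite ?(dot_galphaJC v.1.2) ?(dot_galphaC v.1.2) eEN /drew.
  have E0 : expR p.1.1 != 0 by rewrite gt_eqF ?expR_gt0.
  move: NE N0 E0; clear; move: (normw p) (rew p) (expR p.1.1) p.2 v.2 v.1.1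
    <|p.1.2, v.1.2|> <|Jg p.1.2, v.1.2|> => N r E b vb va d1 d2 -> N0 E0.
  by field; rewrite N0 E0.
Qed.

Lemma mct_derive_inversion p v :
  mct (inversion p) ('D_v inversion p) = triv_inversion p (mct p v).
Proof.
apply: (etrans (congr1 (mct (inversion p)) (derive_inversion p v))).
exact: mct_dinversion.
Qed.

Lemma an_isometry_inversion : an_isometry inversion.
Proof.
exists inversion; split; [exact: smooth_inversion|exact: smooth_inversion|
  exact: inversionK|exact: inversionK|].
exact: (isometry_triv mct_derive_inversion triv_inversion_dot triv_inversionJ).
Qed.

Lemma triv_diff_comp f h q x : an_isometry f -> an_isometry h ->
  triv_diff (h \o f) q x = triv_diff h (f q) (triv_diff f q x).
Proof.
move=> [_ [sf _ _ _ _]] [_ [sh _ _ _ _]]; rewrite /triv_diff mctK.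
apply: (congr1 (mct _)).
exact: (derive_comp _ (smooth_closed_diff q sf) (smooth_closed_diff (f q) sh)).
Qed.

Lemma triv_diff_mul_AN p q x : triv_diff (mul_AN p) q x = x.
Proof.
by rewrite /triv_diff derive_mul_AN_at mct_mul_AN lftK.
Qed.

Lemma triv_diff_inversion q x : triv_diff inversion q x = triv_inversion q x.
Proof. by rewrite /triv_diff mct_derive_inversion lftK. Qed.

(** Solves [triv_inversion p x = Z_0] for p with first coordinate 0. With
    [zeta = x.1.1 + i (x.2 - 1)] the equation asks for [dw / w = zeta / 2] and [eta = 0]; the second
    gives [p.1.2 = 2 x.1.2 / zeta], and the first then leads to [p.2]. [D] is the squared modulus of
    zeta. *)
Definition center_shift x : CH :=
  let D := x.1.1 ^+ 2 + (x.2 - 1) ^+ 2 in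
  (0, (2 / D) *: (x.1.1 *: x.1.2 - (x.2 - 1) *: Jg x.1.2), 2 * x.1.1 / D).

Lemma triv_inversion_center x : << x, x >> = 1 -> x.1.1 ^+ 2 + (x.2 - 1) ^+ 2 != 0 ->
  triv_inversion (center_shift x) x = (0, 0, 1).
Proof.
case: x => [[a u] b]; rewrite /dot_an /=; set d := <|u, u|>; set D := a ^+ 2 + (b - 1) ^+ 2 => ud
  D0.
have dE : d = 1 - a ^+ 2 - b ^+ 2 by rewrite -[X in X - _ - _]ud; ring.
set p := center_shift _.
have pu : p.1.2 = (2 / D) *: (a *: u - (b - 1) *: Jg u) by [].
have pb : p.2 = 2 * a / D by [].
have pa : p.1.1 = 0 by [].
clearbody p.
have rE : rew p = 2 * (1 - b) / D.
  rewrite /rew pa expR0 pu !(dot_galphaE, dot_galphaJJ, dot_galphaJr, J_galphaE) !dot_galphaJ.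
  by rewrite -/d dE; move: D0; rewrite /D => D0; field.
have nE : normw p = 4 / D.
  by rewrite /normw rE pb; move: D0; rewrite /D => D0; field.
have puu : <|p.1.2, u|> = 2 / D * a * d.
  by rewrite pu !dot_galphaE dot_galphaJ -/d; ring.
have pJu : <|Jg p.1.2, u|> = 2 / D * (b - 1) * d.
  by rewrite pu !(J_galphaE, dot_galphaE) dot_galphaJ -/d; ring.
have aE : inv_alpha p (a, u, b) = a / 2.
  rewrite /inv_alpha /= puu pJu rE nE pb pa mul0r expR0 dE.
  by move: D0; rewrite /D => D0; field.
have bE : inv_beta p (a, u, b) = (b - 1) / 2.
  rewrite /inv_beta /= puu pJu rE nE pb pa mul0r expR0 dE.
  by move: D0; rewrite /D => D0; field.
have eE : inv_eta p (a, u, b) = 0.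
  rewrite /inv_eta aE bE pa oppr0 mul0r expR0 scale1r pu !J_galphaE /=.
  apply: dot_galpha_ext => t; rewrite !dot_galphaE.
  by move: D0; rewrite /D => D0; field.
rewrite /triv_inversion eE aE bE /= scaler0.
have -> : Jg 0 = 0 :> galpha by rewrite -(scale0r (0 : galpha)) J_galphaZ !scale0r.
rewrite scaler0 subrr scaler0; congr (_, _, _); by field.
Qed.

Lemma an_isometry_center q x : << x, x >> = 1 ->
  exists f, an_isometry f /\ triv_diff f q x = (0, 0, 1).
Proof.
move=> x1; have [D0|D0] := eqVneq (x.1.1 ^+ 2 + (x.2 - 1) ^+ 2) 0; last first.
  have i1 := an_isometry_mul_AN (inv_AN q); have i2 := an_isometry_mul_AN (center_shift x).
  have i12 := an_isometry_comp i1 i2.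
  exists (inversion \o (mul_AN (center_shift x) \o mul_AN (inv_AN q))).
  split; first exact: (an_isometry_comp i12 an_isometry_inversion).
  apply: (etrans (triv_diff_comp q x i12 an_isometry_inversion)).
  apply: (etrans (triv_diff_inversion _ _)).
  have e : triv_diff (mul_AN (center_shift x) \o mul_AN (inv_AN q)) q x = x.
    apply: (etrans (triv_diff_comp q x i1 i2)); apply: (etrans (triv_diff_mul_AN _ _ _)).
    exact: triv_diff_mul_AN.
  rewrite e /= mul_VAN mul_AN0; exact: triv_inversion_center.
(* A vanishing denominator forces [x.1.1 = 0] and [x.2 = 1], so the unit vector x already is
   [Z_0]. *)
exists id; split; first exact: an_isometry_id.
rewrite /triv_diff.
apply: (etrans (congr1 (mct q) (derive_id q (lft q x)))); rewrite lftK.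
move/eqP: D0; rewrite paddr_eq0 ?sqr_ge0 // !sqrf_eq0 subr_eq0.
move=> /andP[/eqP a0 /eqP b1].
move: x1 a0 b1; case: x => [[a u] b]; rewrite /dot_an /= => x1 a0 b1.
move: x1; rewrite a0 b1 mulr0 add0r mulr1 => /(canRL (addrK _)); rewrite subrr.
by move=> /dot_galpha_eq0 ->.
Qed.

End Inversion.

(** * Propagation along a connected submanifold *)

Section LocalConstancy.
Variable R : realType.

(** One mean value on [0, 1] for [e^(-Ct) d(t)], which starts at 0 and has nonpositive derivative,
    so that d(1) is at most 0. *)
Lemma gronwall (d dd : R -> R) (C : R) :
  (forall t : R, 0 <= t <= 1 -> is_derive t 1 d (dd t)) ->
  (forall t : R, 0 <= t <= 1 -> `|dd t| <= C * d t) ->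
  (forall t : R, 0 <= d t) -> d 0 = 0 -> d 1 = 0.
Proof.
move=> der bd d0 dz.
pose e (t : R) := expR (- C * t).
have der_e (t : R) : is_derive t 1 e (- C * e t).
  rewrite /e; apply: is_derive_eq; rewrite /GRing.scale /=; ring.
pose h (t : R) := e t * d t.
have der_h (t : R) : 0 <= t <= 1 -> is_derive t 1 h (e t * dd t + d t * (- C * e t)).
  move=> ht; have hd := der t ht; have he := der_e t.
  by have := is_deriveM he hd; rewrite /GRing.scale /=.
have c : {within `[(0:R), 1], continuous h}.
  by apply: derivable_within_continuous => t; rewrite in_itv /= => /der_h[].
have der_h' (t : R) : t \in `]0, 1[ -> is_derive t 1 h (e t * dd t + d t * (- C * e t)).
  by rewrite in_itv /= => /andP[t0 t1]; apply: der_h; rewrite (ltW t0) (ltW t1).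
have [x x01] := MVT_segment ler01 der_h' c.
rewrite subr0 mulr1 /h dz mulr0 subr0 => ehx.
have {}x01 : 0 <= x <= 1 by move: x01; rewrite in_itv.
have ex : 0 < e x by exact: expR_gt0.
have e1 : 0 < e 1 by exact: expR_gt0.
have le1 : e 1 * d 1 <= 0.
  have -> : e 1 * d 1 = e x * (dd x - C * d x) by rewrite ehx; ring.
  rewrite pmulr_rle0 // subr_le0; have := bd x x01.
  by rewrite ler_norml => /andP[].
by apply/eqP; rewrite eq_le d0 andbT; move: le1; rewrite pmulr_rle0.
Qed.

Lemma connected_all (M : topologicalType) (P : M -> Prop) (q0 : M) :
  connected [set: M] ->
  (forall q, exists U : set M, [/\ open U, U q & forall a b, U a -> U b -> P a -> P b]) ->
  P q0 -> forall q, P q.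
Proof.
move=> cM loc P0; have oP : open [set q | P q].
  rewrite openE => q Pq; have [U [oU Uq h]] := loc q.
  by rewrite /interior nbhsE; exists U => //= b Ub; exact: (h q b).
have oN : open [set q | ~ P q].
  rewrite openE => q Pq; have [U [oU Uq h]] := loc q.
  by rewrite /interior nbhsE; exists U => //= b Ub Pb; apply: Pq; exact: (h b q).
have e : [set q | P q] = [set: M].
  apply: cM; first by exists q0.
    by exists [set q | P q] => //; rewrite setTI.
  exists [set q | P q]; last by rewrite setTI.
  rewrite -[X in closed X]setCK; exact: open_closedC.
by move=> q; have : [set: M] q by []; rewrite -e.
Qed.

Lemma sum_abs_sqr_le m (s : 'I_m -> R) :
  \sum_i (`|s i| * \sum_j `|s j|) <= m%:R * \sum_i s i ^+ 2.
Proof.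
have h (a b : R) : `|a| * `|b| <= 2^-1 * (a ^+ 2 + b ^+ 2).
  have := sqr_ge0 (`|a| - `|b|); rewrite -(real_normK (num_real a)) -(real_normK (num_real b)).
  by nra.
apply: (@le_trans _ _ (\sum_(i < m) \sum_(j < m) 2^-1 * (s i ^+ 2 + s j ^+ 2))).
  by apply: ler_sum => i _; rewrite mulr_sumr; apply: ler_sum => j _; exact: h.
have -> : \sum_(i < m) \sum_(j < m) 2^-1 * (s i ^+ 2 + s j ^+ 2) =
  \sum_(i < m) (2^-1 * (m%:R * s i ^+ 2) + 2^-1 * \sum_(j < m) s j ^+ 2).
  apply: eq_bigr => i _; rewrite -mulr_sumr big_split /= sumr_const card_ord mulrDr.
  by rewrite -[_ *+ m]mulr_natl.
rewrite big_split /= sumr_const card_ord -mulr_natl -!mulr_sumr.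
by rewrite -subr_ge0 (_ : _ - _ = 0) //; field.
Qed.

(** The scalar inequality is applied to the sum of squares, which is differentiable, unlike the sum
    of absolute values; [sum_abs_sqr_le] passes from one to the other. *)
Lemma gronwall_system m (s ds : 'I_m -> R -> R) (C : R) : 0 <= C ->
  (forall i (t : R), 0 <= t <= 1 -> is_derive t 1 (s i) (ds i t)) ->
  (forall i (t : R), 0 <= t <= 1 -> `|ds i t| <= C * \sum_j `|s j t|) ->
  (forall i, s i 0 = 0) -> forall i, s i 1 = 0.
Proof.
move=> C0 der bd s0.
pose d (t : R) := \sum_i s i t ^+ 2.
have d1 : d 1 = 0.
  apply: (@gronwall d (fun t : R => \sum_i (2 * s i t * ds i t)) (2 * C * m%:R)).
  - move=> t ht; rewrite /d.
    have -> : (fun t : R => \sum_i s i t ^+ 2) = \sum_i (fun t : R => s i t ^+ 2).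
      by apply/funext => u; rewrite fct_sumE.
    apply: is_derive_sum => i; have := der i t ht => hi.
    by apply: is_derive_eq; rewrite /GRing.scale /=; ring.
  - move=> t ht; apply: (le_trans (ler_norm_sum _ _ _)).
    apply: (@le_trans _ _ (\sum_i (2 * C * (`|s i t| * \sum_j `|s j t|)))).
      apply: ler_sum => i _; rewrite !normrM ger0_norm //.
      have := bd i t ht; have := normr_ge0 (s i t); set a := `|s i t|; set b := `|ds i t|.
      by set S := \sum_j _ => a0 bS; have := ler_wpM2l a0 bS; lra.
    rewrite -mulr_sumr -!mulrA !ler_wpM2l //; first exact: sum_abs_sqr_le.
  - by move=> t; apply: sumr_ge0 => i _; exact: sqr_ge0.
  - by rewrite /d big1 // => i _; rewrite s0 expr0n.
move=> i; apply/eqP; rewrite -sqrf_eq0; apply/eqP.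
have P (j : 'I_m) : true -> 0 <= s j 1 ^+ 2 by rewrite sqr_ge0.
exact: (psumr_eq0P P d1).
Qed.

End LocalConstancy.

(** * Uniqueness for the differential equation of Z *)

Section CenterUniqueness.
Variables (R : realType) (n : nat) (V : normedModType R) (O : set V).
Hypothesis oO : open O.
Local Notation CH := (CH R n).
Local Notation J := (@J_an R n).
Local Notation "<< x , y >>" := (dot_an x y).

(** A one-sided Lipschitz estimate for the equation of Z. The linear terms drop out, because [lc x]
    is skew and J is skew; three products are left, each at most [(K + 1) / 2] times the squared
    length of e by Cauchy-Schwarz. *)
Lemma center_diff_bound (x z y e : CH) (K : R) : e = z - y -> << x, x >> <= K ->
  << z, z >> = 1 -> << y, y >> = 1 ->
  Num.norm ( << (Phi z x - lc x z) - (Phi y x - lc x y), e >> + << e, (Phi z x - lc x z) - (Phi y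
    x - lc x y) >>)
    <= 3 / 2 * (K + 1) * << e, e >>.
Proof.
move=> eE xK zz yy.
have -> : << (Phi z x - lc x z) - (Phi y x - lc x y), e >> + << e, (Phi z x - lc x z) - (Phi y x
  - lc x y) >> =
  - (<< x, e >> * << J z, e >> + << x, J e >> * << z, e >> + << x, J y >> * << e, e >>).
  rewrite [<< e, _ >>]dot_anC.
  have l : << lc x e, e >> = 0 by have := lc_skew x e e; rewrite (dot_anC e (lc x e)); lra.
  have j : << J e, e >> = 0 by exact: dot_anJ.
  have zE : z = y + e by rewrite eE addrC subrK.
  rewrite zE => {eE zE zz}; move: e l j => f l j.
  rewrite /Phi !lcE !dot_anE l !(dot_anE, J_anE) j.
  by field.
have e0 := dot_an_ge0 e; have c1 := dot_an_CS x e; have c2 := dot_an_CS (J z) e.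
have c3 := dot_an_CS x (J e); have c4 := dot_an_CS z e; have c5 := dot_an_CS x (J y).
have x0 := dot_an_ge0 x.
rewrite !dot_anJJ ?zz ?yy in c2 c3 c4 c5.
move: c1 c2 c3 c4 c5 x0 xK e0.
move: << x, e >> << J z, e >> << x, J e >> << z, e >> << x, J y >> << x, x >> << e, e >>.
move=> a b c d f X E c1 c2 c3 c4 c5 x0 xK e0.
have XE : X * E <= K * E by rewrite ler_wpM2r.
have f1 : `|f| <= (K + 1) / 2.
  have := sqr_ge0 (f - 1); have := sqr_ge0 (f + 1).
  by rewrite ler_norml => h1 h2; apply/andP; split; nra.
have fE : `|f| * E <= (K + 1) / 2 * E by rewrite ler_wpM2r.
have f2 : `|f * E| <= (K + 1) / 2 * E by rewrite normrM (ger0_norm e0).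
move: f2; rewrite ler_norml => /andP[f2 f3].
have abE : `|a * b| <= (K + 1) / 2 * E.
  have := sqr_ge0 (a - b); have := sqr_ge0 (a + b).
  by rewrite ler_norml => h1 h2; apply/andP; split; nra.
have cdE : `|c * d| <= (K + 1) / 2 * E.
  have := sqr_ge0 (c - d); have := sqr_ge0 (c + d).
  by rewrite ler_norml => h1 h2; apply/andP; split; nra.
move: abE cdE; rewrite !ler_norml => /andP[? ?] /andP[? ?].
by apply/andP; split; lra.
Qed.

Lemma center_unique (F z y : V -> CH) (p v : V) (K : R) :
  smooth_on O F -> smooth_on O z -> smooth_on O y ->
  (forall q, O q -> << z q, z q >> = 1) -> (forall q, O q -> << y q, y q >> = 1) ->
  (forall q, O q -> 'D_v z q + lc (frame F v q) (z q) = Phi (z q) (frame F v q)) ->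
  (forall q, O q -> 'D_v y q + lc (frame F v q) (y q) = Phi (y q) (frame F v q)) ->
  (forall t : R, 0 <= t <= 1 -> O (p + t *: v) /\
     << frame F v (p + t *: v), frame F v (p + t *: v) >> <= K) ->
  z p = y p -> z (p + v) = y (p + v).
Proof.
move=> sF sz sy zz yy Dz Dy hK zy.
have se : smooth_on O (fun q => z q - y q) by exact: smooth_on_sub_fun.
pose ee q := << z q - y q, z q - y q >>.
have see : smooth_on O ee by exact: smooth_dot_an.
pose c (t : R) := p + t *: v.
have Dee q : O q -> 'D_v ee q = << 'D_v z q - 'D_v y q, z q - y q >> +
    << z q - y q, 'D_v z q - 'D_v y q >>.
  move=> Oq; have de := smooth_on_diff se Oq.
  have [_ e] := derive_bil v (bb_dot_an R n) de de.
  have e' : 'D_v (fun q => z q - y q) q = 'D_v z q - 'D_v y q.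
    have d1 := smooth_on_diff sz Oq; have d2 := smooth_on_diff sy Oq.
    apply: deriveB; exact: diff_derivable.
  apply: (etrans e); exact: (congr1 (fun t => << t, z q - y q >> + << z q - y q, t >>) e').
have h1 : ee (c 1) = 0.
  apply: (@gronwall _ (ee \o c) (fun t : R => 'D_v ee (c t)) (3 / 2 * (K + 1))).
  - move=> t ht; apply: derive_line; exact: (smooth_on_diff see (hK t ht).1).
  - move=> t ht; have [Oq xK] := hK t ht.
    have ez : 'D_v z (c t) = Phi (z (c t)) (frame F v (c t)) - lc (frame F v (c t)) (z (c t)).
      exact: (canRL (addrK _) (Dz _ Oq)).
    have ey : 'D_v y (c t) = Phi (y (c t)) (frame F v (c t)) - lc (frame F v (c t)) (y (c t)).
      exact: (canRL (addrK _) (Dy _ Oq)).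
    have b := center_diff_bound (erefl _) xK (zz _ Oq) (yy _ Oq).
    apply: (le_trans _ b); have E : 'D_v ee (c t) = _ := etrans (Dee _ Oq) (congr2 (fun a b => <<
      a - b, z (c t) - y (c t) >> + << z (c t) - y (c t), a - b >>) ez ey).
    by rewrite -E.
  - by move=> t; exact: dot_an_ge0.
  - by rewrite /ee /= /c scale0r addr0 zy subrr dot_an0l.
move: h1; rewrite /ee /c scale1r => /dot_an_eq0 /eqP; rewrite subr_eq0 => /eqP; exact.
Qed.

End CenterUniqueness.

Lemma surj_dim (K : fieldType) (vT wT : vectType K) (f : vT -> wT) : linear f ->
  (forall y, exists x, f x = y) -> (dim wT <= dim vT)%N.
Proof.
move=> lf sf; pose f' : {linear vT -> wT} := HB.pack f (GRing.isLinear.Build _ _ _ _ _ lf).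
pose L := linfun f'.
have e : (L @: fullv)%VS = fullv.
  apply/eqP; rewrite eqEsubv subvf /=; apply/subvP => y _.
  by have [x <-] := sf y; rewrite -[f x](lfunE f') memv_img // memvf.
have := limg_ker_dim L fullv; rewrite e !dimvf => <-; exact: leq_addl.
Qed.

Lemma inj_dim (K : fieldType) (vT wT : vectType K) (f : vT -> wT) : linear f ->
  injective f -> (dim vT <= dim wT)%N.
Proof.
move=> lf sf; pose f' : {linear vT -> wT} := HB.pack f (GRing.isLinear.Build _ _ _ _ _ lf).
pose L := linfun f'.
have k0 : lker L = 0%VS.
  by apply/eqP/lker0P => x y; rewrite !lfunE; exact: sf.
have := limg_ker_dim L fullv; rewrite capfv k0 dimv0 add0n dimvf => <-.
by rewrite -dimvf dimvS // subvf.
Qed.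

Lemma dim_CH (R : realType) n : (0 < n)%N -> dim (R^o * galpha R n * R^o)%type = (2 * n)%N.
Proof.
move=> n0; have -> : dim (R^o * galpha R n * R^o)%type = (1 + (1 * n.-1 + 1 * n.-1) + 1)%N by [].
by case: n n0 => // n _ /=; lia.
Qed.

Section NotComplex.
Variables (R : realType) (E : lmodType R) (ip : E -> E -> R) (J : E -> E).
Hypotheses (ipP : inner_product ip) (JD : linear J) (JK : forall x, J (J x) = - x).
Hypothesis JC : forall x y, ip (J x) y = - ip (J y) x.
Variables (T : set E) (phi : R).
Hypotheses (TP : projectable ip T) (sphi : sin phi != 0) (cphi : 0 <= cos phi).
Hypothesis angle : const_kahler_angle ip J (orth ip T) phi.

(** If T were complex, so would be its orthogonal complement. There the projected J would be J
    itself, so [cos^2 phi = 1], against [sin phi != 0]. *)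
Lemma not_complex xi : orth ip T xi -> xi != 0 -> exists x, T x /\ ~ T (J x).
Proof.
move=> Nxi xi0; apply: contrapT => h.
have TJ x : T x -> T (J x) by move=> Tx; apply: contrapT => nT; apply: h; exists x.
have NP := orth_projectable ipP TP.
have NJ x : orth ip T x -> orth ip T (J x).
  by move=> Nx s Ts; rewrite JC; have [c _ _ _] := ipP; rewrite c (Nx _ (TJ _ Ts)) oppr0.
have /(const_kahler_angleP ipP JD JC NP cphi) K := angle.
have := K xi Nxi; rewrite (orth_proj_id ipP NP (NJ _ Nxi)) JK.
rewrite (orth_proj_id ipP NP (projectableN NP Nxi)) => /oppr_inj /eqP.
rewrite -{1}(scale1r xi) -subr_eq0 -scalerBl scaler_eq0 (negPf xi0) orbF => e.
have := cos2Dsin2 phi => e2.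
move: sphi; rewrite -sqrf_eq0; have -> : sin phi ^+ 2 = 1 - cos phi ^+ 2 by rewrite -e2 addrC addKr.
by rewrite (eqP e) eqxx.
Qed.

End NotComplex.

Section ChartFacts.
Variables (R : realType) (n m : nat) (M : topologicalType) (iota : M -> CH R n).
Variables (phi : R) (Z : M -> CH R n) (II : M -> CH R n -> CH R n -> CH R n).
Hypotheses (sphi : sin phi != 0) (cphi : 0 <= cos phi).
Local Notation J := (@J_an R n).
Local Notation "<< x , y >>" := (dot_an x y).
Local Notation g := (@metric R n).
Hypothesis sub : submanifold m iota.

Lemma chart q : exists (O : set 'rV[R]_m) h x, [/\ local_param iota O h, O x & h x = q].
Proof. by case: sub. Qed.

Lemma tangent_projectable_at q : projectable (g (iota q)) (tangent iota q).
Proof. by case: (chart q) => D [h [x [hO Ox <-]]]; exact: (tangent_projectable hO). Qed.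

(** Without nonzero normal vectors the differential of a chart would map a space of dimension m onto
    one of dimension 2n. *)
Lemma normal_neq0 q : (0 < n)%N -> (m < 2 * n)%N ->
  exists xi, orth (g (iota q)) (tangent iota q) xi /\ xi != 0.
Proof.
move=> n0 mn; apply: contrapT => h; have TP := tangent_projectable_at q.
case: (chart q) => D [hh [x [hO Ox hx]]].
have sF := param_smooth hO; have dF := smooth_on_diff sF Ox.
suff : (2 * n <= m)%N by rewrite leqNgt mn.
rewrite -(dim_CH R n0); have -> : m = dim 'rV[R]_m by rewrite /dim /= mul1n.
pose f (v : 'rV[R]_m) : (R^o * galpha R n * R^o)%type := 'D_v (iota \o hh) x.
apply: (@surj_dim _ _ _ f); first by move=> a v w; rewrite /f !deriveE // linearP.
move=> y; suff : tangent iota q y by rewrite -hx (tangent_range hO Ox) => -[w ->]; exists w.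
have ipP := metric_inner (iota q).
apply: (orth_orth ipP TP) => s Ns; have [-> | s0] := eqVneq s 0; first by rewrite (ip0r ipP).
by exfalso; apply: h; exists s.
Qed.

Hypotheses (n0 : (0 < n)%N) (mn : (m < 2 * n)%N).
Hypothesis angle : const_kahler_normal g (@cplx R n) iota phi.
Hypothesis ZF : unit_complex_field m g (@cplx R n) iota Z.
Hypothesis IIP : is_second_ff m g iota II.
Hypothesis IIZ : trivial_extension g (@cplx R n) iota phi Z II.

Section InChart.
Variables (O : set 'rV[R]_m) (h : 'rV[R]_m -> M).
Hypothesis hO : local_param iota O h.
Hypothesis sZ : smooth_on O (Z \o h).
Local Notation F := (iota \o h).
Local Notation z := (fun p => mct (iota (h p)) (Z (h p))).

(** Positive codimension enters here: a nonzero normal vector yields a tangent vector whose image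
    under J is not tangent, as [defect_eq0] demands. *)
Lemma center_derive p v : O p ->
  'D_v z p + lc (frame F v p) (z p) = Phi (z p) (frame F v p).
Proof.
move=> Op; have [_ ZC ZZ] := ZF; set q := h p.
have [xi [Nxi xi0]] := normal_neq0 q n0 mn.
have [x [Tx nTx]] := not_complex (metric_inner (iota q)) (@cplx_linear _ _ (iota q))
  (@cplxK _ _ (iota q)) (@metric_cplxC _ _ (iota q)) (tangent_projectable_at q) sphi cphi
  (const_kahler_normal_orth angle (q:=q)) Nxi xi0.
have ex : exists x, tangent_frame F p x /\ ~ tangent_frame F p (J x).
  exists (mct (iota q) x); split; first by apply/(tangent_mct hO x Op).
  by rewrite -mct_cplx => /(tangent_mct hO _ Op).
have zu q' : O q' -> << z q', z q' >> = 1 by move=> _; exact: (z_unit h ZZ).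
have d := defect_eq0 (param_open hO) (param_smooth hO) (smooth_z hO sZ)
  (mlc_tangent sphi cphi hO ZC ZZ angle IIP IIZ) zu (z_tangent hO ZC)
  (Jz_tangent hO ZC) Op ex v.
by apply/eqP; rewrite -subr_eq0; apply/eqP; exact: d.
Qed.

End InChart.
End ChartFacts.

(** Reduced to the time 1 by the rescaling [r |-> t * r], under which the bound C only improves. *)
Lemma gronwall_system_all (R : realType) m (s ds : 'I_m -> R -> R) (C : R) : 0 <= C ->
  (forall i (t : R), 0 <= t <= 1 -> is_derive t 1 (s i) (ds i t)) ->
  (forall i (t : R), 0 <= t <= 1 -> `|ds i t| <= C * \sum_j `|s j t|) ->
  (forall i, s i 0 = 0) -> forall t : R, 0 <= t <= 1 -> forall i, s i t = 0.
Proof.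
move=> C0 der bd s0 t /andP[t0 t1] j.
have sub (r : R) : 0 <= r <= 1 -> 0 <= t * r <= 1.
  by move=> /andP[r0 r1]; rewrite mulr_ge0 //= mulr_ile1.
have := @gronwall_system R m (fun j r => s j (t * r)) (fun j r => t * ds j (t * r)) C C0.
move=> /(_ _ _ _ j); rewrite mulr1; apply.
- move=> i r hr; have d := der i _ (sub r hr).
  have d2 : is_derive r 1 (fun r : R => t * r) t.
    by apply: is_derive_eq; rewrite /GRing.scale /=; ring.
  have := @is_derive1_comp _ _ _ _ _ _ d d2; rewrite mulrC; exact.
- move=> i r hr; rewrite normrM (ger0_norm t0).
  have := bd i _ (sub r hr) => bS; apply: le_trans bS; by rewrite ler_piMl.
- by move=> i; rewrite mulr0.
Qed.

Section LinearFamilies.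
Variables (R : realType) (m : nat).

Lemma coord_norm_le (v : 'rV[R]_m) j : `|v 0 j| <= `|v|.
Proof.
rewrite [`|v|]/Num.norm /= mx_normrE.
exact: (@le_bigmax _ _ _ _ (fun i : 'I_1 * 'I_m => `|v i.1 i.2|) (0, j)).
Qed.

Lemma linear_sum_delta (W : lmodType R) (A : 'rV[R]_m -> W) v : linear A ->
  A v = \sum_j v 0 j *: A (delta_mx 0 j).
Proof.
move=> lA; pose A' : {linear 'rV[R]_m -> W} := HB.pack A (GRing.isLinear.Build _ _ _ _ _ lA).
rewrite -[A]/(A' : _ -> _) {1}[v]row_sum_delta linear_sum.
by apply: eq_bigr => j _; rewrite linearZ.
Qed.

Lemma linear_row_continuous (W : normedModType R) (A : 'rV[R]_m -> W) :
  linear A -> continuous A.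
Proof.
move=> lA; have -> : A = (fun v => \sum_j v 0 j *: A (delta_mx 0 j)).
  by apply/funext => v; exact: (linear_sum_delta v lA).
apply: continuous_big => [|j _ v]; first exact: add_continuous.
apply: cont_scale; last exact: cst_continuous.
exact: coord_continuous.
Qed.

Lemma lower_bound_near (V W : normedModType R) (A : 'rV[R]_m -> V -> W) (p : V) :
  (\forall q \near p, linear (A^~ q)) -> (forall j, {for p, continuous (A (delta_mx 0 j))}) ->
  injective (A^~ p) ->
  exists2 k, 0 < k & \forall q \near p, forall v, k * `|v| <= `|A v q|.
Proof.
move=> lA cA iA; have lp := nbhs_singleton lA.
have cp : continuous (A^~ p) := linear_row_continuous lp.
have [k k0 hk] := injective_lower_bound lp cp iA.
exists (k / 2); first by rewrite divr_gt0.
(* Each of the m coordinate vectors moves by less than this amount, so A loses at most half of its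
   lower bound; the successor avoids division by zero when m = 0. *)
have e0 : 0 < k / 2 / (m.+1)%:R by rewrite !divr_gt0.
have H : \forall q \near p, forall j, true -> `|A (delta_mx 0 j) p - A (delta_mx 0 j) q| < k / 2
  / (m.+1)%:R.
  apply: filter_forall => j; have /cvgrPdist_lt /(_ _ e0) := cA j.
  by apply: filterS => q h _.
apply: filterS2 lA H => q lq hq v; have hv := hk v.
have D : `|A v p - A v q| <= k / 2 * `|v|.
  rewrite (linear_sum_delta v lp) (linear_sum_delta v lq) -sumrB.
  apply: (le_trans (ler_norm_sum _ _ _)).
  apply: (@le_trans _ _ (\sum_(j < m) (k / 2 / (m.+1)%:R * `|v|))).
    apply: ler_sum => j _; rewrite -scalerBr normrZ mulrC.
    by apply: ler_pM => //; [exact: ltW (hq j isT)|exact: coord_norm_le].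
  rewrite sumr_const card_ord -[_ *+ m]mulr_natr mulrAC ler_wpM2r //.
  by rewrite mulrAC ler_pdivrMr // ler_wpM2l ?ler_nat // divr_ge0 // ltW.
have := ler_distD (A v q) (A v p) 0; rewrite !subr0 => T.
move: hv D T; move: `|A v p| `|A v q| `|_ - _| `|v| => a b c d; lra.
Qed.

Lemma segment_bound (V W : normedModType R) (f : V -> W) (p v : V) :
  (forall t : R, 0 <= t <= 1 -> {for (p + t *: v), continuous f}) ->
  exists K, forall t : R, 0 <= t <= 1 -> `|f (p + t *: v)| <= K.
Proof.
move=> fc; have c : {within `[(0 : R), 1], continuous (fun t : R => `|f (p + t *: v)|)}.
  apply: continuous_in_subspaceT => t; rewrite inE /= in_itv /= => ht.
  have c0 : {for t, continuous (fun t : R => p + t *: v)}.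
    apply: cont_add; first exact: cst_continuous.
    by apply: cont_scale; [exact: cvg_id|exact: cst_continuous].
  by apply: (cvg_comp _ _ (cvg_comp _ _ c0 (fc t ht))); exact: norm_continuous.
have [x _ hx] := EVT_max ler01 c.
by exists (`|f (p + x *: v)|) => t ht; apply: hx; rewrite in_itv.
Qed.

End LinearFamilies.

(** Balls in the parameter space are convex, so local constancy on M need only be tested along
    segments, where the one-variable estimates apply. *)
Lemma local_segment (R : realType) n m (M : topologicalType) (iota : M -> CH R n)
  (O Q : set 'rV[R]_m) h x (P : M -> Prop) : local_param iota O h -> O x -> nbhs x Q ->
  (forall p v, (forall t : R, 0 <= t <= 1 -> O (p + t *: v) /\ Q (p + t *: v)) ->
     P (h p) -> P (h (p + v))) ->
  exists U : set M, [/\ open U, U (h x) & forall a b, U a -> U b -> P a -> P b].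
Proof.
move=> hO Ox nQ hP; have oO := param_open hO; case: (hO) => _ _ _ hop _.
have nO : nbhs x O := open_nbhs_nbhs (conj oO Ox).
have /nbhs_ballP[r /= r0 hr] := @filterI _ _ (nbhs_filter _) _ _ nO nQ.
have b0 : ball x r `<=` O by move=> y /hr[].
exists (h @` ball x r); split; first by apply: hop => //; exact: ball_open.
  by exists x => //; exact: ballxx.
move=> _ _ [a ba <-] [b bb <-] Pa; have -> : b = a + (b - a) by rewrite addrC subrK.
apply: hP Pa => t /andP[t0 t1]; apply: hr.
move: ba bb; rewrite -!ball_normE /ball_ /= => ba bb.
have E : x - (a + t *: (b - a)) = (1 - t) *: (x - a) + t *: (x - b).
  by rewrite -[RHS]opprK -[LHS]opprK; congr (- _); apply/rowP => i; rewrite !mxE; ring.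
rewrite E.
apply: (le_lt_trans (ler_normD _ _)); rewrite !normrZ (ger0_norm t0) ger0_norm ?subr_ge0 //.
move: ba bb; move: `|x - a| `|x - b| => A B; have [->|t0'] := eqVneq t 0; first by lra.
have t2 : 0 < t by rewrite lt_def t0' t0.
move=> hA hB; have : t * B < t * r by rewrite ltr_pM2l.
have : (1 - t) * A <= (1 - t) * r by rewrite ler_wpM2l ?subr_ge0 // ltW.
lra.
Qed.

Section UnitaryMorphism.
Variables (R : realType) (n : nat) (B : CH R n -> CH R n).
Local Notation J := (@J_an R n).
Local Notation "<< x , y >>" := (dot_an x y).
Hypothesis BD : forall x y, B (x + y) = B x + B y.
Hypothesis BZ : forall a x, B (a *: x) = a *: B x.
Hypothesis BJ : forall x, B (J x) = J (B x).
Hypothesis Bdot : forall x y, << B x, B y >> = << x, y >>.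

Lemma Phi_morph z x : B (Phi z x) = Phi (B z) (B x).
Proof.
have BN y : B (- y) = - B y.
  by have := BZ 0 0; rewrite !scale0r => B0; apply/eqP; rewrite -addr_eq0 -BD addNr B0.
by rewrite /Phi BN BZ !BD !BZ !BJ -(Bdot x (J z)) BJ Bdot.
Qed.

Lemma acor_morph z x y : B (acor z x y) = acor (B z) (B x) (B y).
Proof. by rewrite /acor BZ BD !BZ !BJ !Bdot. Qed.

End UnitaryMorphism.

Section CenterAlgebra.
Variables (R : realType) (n : nat).
Local Notation CH := (CH R n).
Local Notation J := (@J_an R n).
Local Notation "<< x , y >>" := (dot_an x y).
Definition center_vec : CH := (0, 0, 1).

(** A left-invariant field has constant trivialization, so this is the equation of Z for [Z_0]. *)
Lemma lc_center (x : CH) : lc x center_vec = Phi center_vec x.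
Proof.
rewrite /Phi /lc /center_vec /dot_an /=; case: x => [[a u] b] /=; congr (_, _, _) => /=.
- by rewrite ?(dot_galphaE, J_galphaE) /GRing.scale /=; field.
- by apply: dot_galpha_ext => t; rewrite ?(dot_galphaE, J_galphaE, dot_galphaJr); field.
- by rewrite ?(dot_galphaE, J_galphaE, dot_galphaJr) /GRing.scale /=; field.
Qed.

(** For [Z = Z_0] the terms with J in [lc] and in [acor] cancel in g_alpha. What is left is a
    multiple of [x.1.2], which makes the g_alpha parts of a preserved family of subspaces satisfy a
    closed linear system. *)
Lemma mlc_center_u (d x y : CH) :
  (d + mlc center_vec x y).1.2 = d.1.2 - (2^-1 * y.1.1) *: x.1.2.
Proof.
apply: dot_galpha_ext => t; rewrite /mlc /acor /lc /dot_an /center_vec /=.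
by rewrite ?(dot_galphaE, J_galphaE, dot_galphaJr) /=; field.
Qed.

Lemma mlc_center_dot l (d x y c : CH) : d + mlc center_vec x y = c ->
  dot_galpha l d.1.2 = dot_galpha l c.1.2 + 2^-1 * y.1.1 * dot_galpha l x.1.2.
Proof. by move=> <-; rewrite mlc_center_u dot_galphaDr -scaleNr dot_galphaZr; ring. Qed.

Lemma dot_an_center : << center_vec, center_vec >> = 1.
Proof. by rewrite /dot_an /center_vec /= ?dot_galphaE mulr0 mulr1 !add0r. Qed.

Variable f : CH -> CH.
Hypothesis fiso : an_isometry f.
Local Notation A := (triv_diff f).

Lemma isometryP : smooth_closed f /\ isometry_at f.
Proof. by case: fiso => f' []. Qed.

Lemma triv_diff_lin q a x y : A q (a *: x + y) = a *: A q x + A q y.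
Proof. by have [s i] := isometryP; exact: triv_diff_linear. Qed.

Lemma triv_diff0 q : A q 0 = 0.
Proof. by have := triv_diff_lin q (-1) 0 0; rewrite scaler0 addr0 scaleN1r addNr. Qed.

Lemma triv_diffZ q a x : A q (a *: x) = a *: A q x.
Proof. by rewrite -(addr0 (a *: x)) triv_diff_lin triv_diff0 addr0. Qed.

Lemma triv_diffD q x y : A q (x + y) = A q x + A q y.
Proof. by rewrite -(scale1r x) triv_diff_lin !scale1r. Qed.

Lemma triv_diff_dotE q x y : << A q x, A q y >> = << x, y >>.
Proof. by have [s i] := isometryP; exact: triv_diff_dot. Qed.

Lemma triv_diff_JE q x : A q (J x) = J (A q x).
Proof. by have [s i] := isometryP; exact: triv_diffJ. Qed.

Lemma Phi_triv_diff q z x : A q (Phi z x) = Phi (A q z) (A q x).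
Proof.
exact: (Phi_morph (triv_diffD q) (triv_diffZ q) (triv_diff_JE q) (triv_diff_dotE q)).
Qed.

Lemma acor_triv_diff q z x y : A q (acor z x y) = acor (A q z) (A q x) (A q y).
Proof.
exact: (acor_morph (triv_diffD q) (triv_diffZ q) (triv_diff_JE q) (triv_diff_dotE q)).
Qed.

Lemma triv_diff_mlc q a z x y :
  A q (a + mlc z x y) = A q (a + lc x y) + acor (A q z) (A q x) (A q y).
Proof.
apply: (etrans (congr1 (A q) (addrA a (lc x y) (acor z x y)))).
apply: (etrans (triv_diffD q _ _)); congr (_ + _); exact: acor_triv_diff.
Qed.

Lemma an_isometry_inv : exists k, [/\ an_isometry k, cancel f k & cancel k f].
Proof.
have [k [sf sk fk kf [i1 i2]]] := fiso; exists k; split; [|exact: fk|exact: kf].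
exists f; split; [exact: sk|exact: sf|exact: kf|exact: fk|].
have D p v : 'D_('D_v k p) f (k p) = v.
  apply: (etrans (esym (derive_comp v (smooth_closed_diff p sk) (smooth_closed_diff (k p) sf)))).
  have -> : f \o k = id by apply/funext => y; exact: kf.
  exact: derive_id.
have inj p : injective (fun v => 'D_v f p).
  move=> u v e; have : metric (f p) ('D_(u - v) f p) ('D_(u - v) f p) = 0.
    have e' : 'D_(u - v) f p = 0.
      have d := smooth_closed_diff p sf; move: e; rewrite !deriveE // => e.
      by rewrite linearB e subrr.
    by apply: (etrans (congr1 (fun t => metric (f p) t t) e')); rewrite metricE mct0 dot_an0l.
  rewrite i1 metricE => /dot_an_eq0 e'; apply/eqP; rewrite -subr_eq0; apply/eqP.
  by apply: (@mct_inj _ _ p); rewrite mct0.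
split=> p u => [v|].
  apply: (etrans (esym (i1 _ _ _))); rewrite kf.
  exact: (congr2 (metric p) (D p u) (D p v)).
apply: (inj (k p)); apply: (etrans (D p _)); apply: esym; apply: (etrans (i2 _ _)).
rewrite kf; apply: (congr1 (cplx p)); exact: D.
Qed.

Lemma triv_diff_inv k q x : an_isometry k -> cancel f k ->
  triv_diff k (f q) (A q x) = x.
Proof.
move=> ik fk; apply: (etrans (esym (triv_diff_comp q x fiso ik))).
have -> : k \o f = id by apply/funext => y; exact: fk.
rewrite /triv_diff; apply: (etrans (congr1 (mct q) (derive_id q _))); exact: lftK.
Qed.

End CenterAlgebra.

(** * The image of M after Z has been moved to Z_0 *)

Section Transported.
Variables (R : realType) (n m : nat) (M : topologicalType) (iota : M -> CH R n).
Variables (phi : R) (Z : M -> CH R n) (II : M -> CH R n -> CH R n -> CH R n).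
Hypotheses (sphi : sin phi != 0) (cphi : 0 <= cos phi).
Local Notation J := (@J_an R n).
Local Notation "<< x , y >>" := (dot_an x y).
Local Notation "<| u , v |>" := (dot_galpha u v).
Local Notation g := (@metric R n).
Local Notation center_vec := (@center_vec R n).
Hypothesis subM : submanifold m iota.
Hypotheses (n0 : (0 < n)%N) (mn : (m < 2 * n)%N) (cM : connected [set: M]).
Hypothesis angle : const_kahler_normal g (@cplx R n) iota phi.
Hypothesis ZF : unit_complex_field m g (@cplx R n) iota Z.
Hypothesis IIP : is_second_ff m g iota II.
Hypothesis IIZ : trivial_extension g (@cplx R n) iota phi Z II.
Variable f : CH R n -> CH R n.
Hypothesis fiso : an_isometry f.
Local Notation A := (triv_diff f).
Local Notation zM q := (mct (iota q) (Z q)).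

Lemma Z_chart q : exists (D : set 'rV[R]_m) h x,
  [/\ local_param iota D h, D x, h x = q & smooth_on D (Z \o h)].
Proof. by have [s _ _] := ZF; exact: s. Qed.

(** The pullback of [Z_0] by f, along any map F: [lc_center] gives the equation for [Z_0], and
    isometries preserve it since they commute with the connection and with [Phi]. *)
Lemma isometry_inv_ode k (V : normedModType R) (O : set V) (F : V -> CH R n) v p :
  an_isometry k -> cancel f k -> open O -> smooth_on O F -> O p ->
  let y := fun p => triv_diff k (f (F p)) center_vec in
  'D_v y p + lc (frame F v p) (y p) = Phi (y p) (frame F v p).
Proof.
move=> ik fk oO sF Op y; have [sk [isk1 isk2]] := isometryP ik.
have [sf _] := isometryP fiso.
have sfF := sf _ _ _ oO sF.
have kfF : (fun p => k (f (F p))) = F by apply/funext => q; exact: fk.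
have h := triv_diff_const sk (conj isk1 isk2) oO sfF (fun q y => an_isometry_surj q y ik)
  center_vec v Op.
have h2 := frame_triv_diff sk sfF v Op.
have e1 := congr1 (fun H => frame H v p) kfF.
have h3 := etrans (esym e1) h2.
apply: (etrans (congr1 (fun t => 'D_v y p + lc t (y p)) (esym e1))).
apply: (etrans h); rewrite lc_center (Phi_triv_diff ik).
exact: (congr1 (Phi (y p)) (esym h3)).
Qed.

(** On a segment, Z and the pullback of [Z_0] solve the same equation and agree at the start, hence
    at the end; connectedness spreads the equality over M. *)
Lemma center_constant q0 : A (iota q0) (zM q0) = center_vec ->
  forall q, A (iota q) (zM q) = center_vec.
Proof.
move=> z0; have [k [ik fk kf]] := an_isometry_inv fiso.
apply: (connected_all (q0 := q0) cM _ z0) => q.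
case: (Z_chart q) => D [h [x [hO Ox <- sZ]]]; have oD := param_open hO.
apply: (local_segment hO Ox (filterT : nbhs x setT)) => p v seg Pp.
pose F := iota \o h; have sF : smooth_on D F := param_smooth hO.
pose z (p : 'rV[R]_m) := mct (F p) (Z (h p)).
pose y (p : 'rV[R]_m) := triv_diff k (f (F p)) center_vec.
have [_ ZC ZZ] := ZF.
have sz : smooth_on D z := smooth_z hO sZ.
have [sf _] := isometryP fiso; have [sk isk] := isometryP ik.
have sfF := sf _ _ _ oD sF.
have sy : smooth_on D y := triv_diff_const_smooth sk oD sfF center_vec.
have zu q' : D q' -> << z q', z q' >> = 1 by move=> _; exact: (z_unit h ZZ).
have yu q' : D q' -> << y q', y q' >> = 1.
  by move=> _; rewrite /y (triv_diff_dotE ik) ?dot_an_center.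
have Dz q' (Dq : D q') := center_derive sphi cphi subM n0 mn angle ZF IIP IIZ hO sZ v Dq.
have Dy q' (Dq : D q') := isometry_inv_ode v ik fk oD sF Dq.
have sX := smooth_frame oD sF v; have sXX := smooth_dot_an oD sX sX.
(* The Lipschitz constant involves the speed of the segment in CH^n, which is bounded by
   compactness. *)
have [K hK] := @segment_bound R _ _ (fun q => << frame F v q, frame F v q >>) p v
  (fun t ht => differentiable_continuous (smooth_on_diff sXX (seg t ht).1)).
have zy : z p = y p.
  rewrite -[z p](triv_diff_inv fiso (F p) (z p) ik fk).
  exact: (congr1 (triv_diff k (f (F p))) Pp).
have bd (t : R) : 0 <= t <= 1 -> D (p + t *: v) /\
     << frame F v (p + t *: v), frame F v (p + t *: v) >> <= K.
  by move=> ht; split; [exact: (seg t ht).1|exact: (le_trans (ler_norm _) (hK t ht))].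
have e := center_unique oD sF sz sy zu yu Dz Dy bd zy.
apply: (etrans (congr1 (A (F (p + v))) e)).
have := triv_diff_inv ik (f (F (p + v))) center_vec fiso kf.
by rewrite fk.
Qed.

Hypothesis zc : forall q, A (iota q) (zM q) = center_vec.

(* The tangent space of the image of M under f, translated to T_o CH^n. *)
Definition model_tangent q : set (CH R n) :=
  [set x | exists v, tangent iota q v /\ x = A (iota q) (mct (iota q) v)].

Section InChart.
Variables (O : set 'rV[R]_m) (h : 'rV[R]_m -> M).
Hypothesis hO : local_param iota O h.
Local Notation F := (iota \o h).
Local Notation G := (fun p => f (F p)).

Let oO := param_open hO.
Let sF : smooth_on O F := param_smooth hO.
Let sG : smooth_on O G.
Proof. by have [sf _] := isometryP fiso; exact: sf. Qed.

Lemma model_tangentE p : O p -> model_tangent (h p) = tangent_frame G p.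
Proof.
move=> Op; have [sf _] := isometryP fiso.
have E v := frame_triv_diff sf sF v Op.
apply/seteqP; split=> x.
  move=> [v []]; rewrite (tangent_range hO Op) => -[w ->] ->; exists w.
  exact: (esym (E w)).
move=> [w ->]; exists ('D_w F p); split; last exact: (E w).
by rewrite (tangent_range hO Op); exists w.
Qed.

Lemma model_frame_inj p : O p -> injective (frame G ^~ p).
Proof.
move=> Op v w; have [sf _] := isometryP fiso.
move=> e; have {e} : A (F p) (frame F v p) = A (F p) (frame F w p).
  exact: (etrans (esym (frame_triv_diff sf sF v Op)) (etrans e (frame_triv_diff sf sF w Op))).
move=> e; have {e} e : frame F v p = frame F w p.
  have [k [ik fk _]] := an_isometry_inv fiso.
  exact: (etrans (esym (triv_diff_inv fiso (F p) _ ik fk))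
    (etrans (congr1 (triv_diff k (f (F p))) e) (triv_diff_inv fiso (F p) _ ik fk))).
have dF := smooth_on_diff sF Op.
case: hO => _ _ _ _ [_ /(_ p Op)]; apply.
have := mct_inj e; by rewrite !deriveE.
Qed.

Lemma model_mlc v w p : O p ->
  tangent_frame G p ('D_w (frame G v) p + mlc center_vec (frame G w p) (frame G v p)).
Proof.
move=> Op; have [_ ZC ZZ] := ZF; have [sf isf] := isometryP fiso.
have [c hc] := mlc_tangent sphi cphi hO ZC ZZ angle IIP IIZ (smooth_frame oO sF v)
  (fun q _ => ex_intro _ v erefl) w Op.
have E u := frame_triv_diff sf sF u Op.
exists c; apply: (etrans _ (esym (E c))).
apply: (etrans _ (congr1 (A (F p)) hc)).
have tr := frame_lc_transport sf isf oO sF (fun q y => an_isometry_surj q y fiso) w v Op.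
have e : acor center_vec (frame G w p) (frame G v p) =
    acor (A (F p) (zM (h p))) (A (F p) (frame F w p)) (A (F p) (frame F v p)).
  apply: (etrans _ (congr1 (fun t => acor t _ _) (esym (zc (h p))))).
  exact: (congr2 (acor center_vec) (E w) (E v)).
exact: (etrans (addrA _ _ _) (etrans (congr2 +%R tr e) (esym (triv_diff_mlc fiso _ _ _ _ _)))).
Qed.

(** The pairings of l with the g_alpha parts of the coordinate fields satisfy a linear system: by
    [model_mlc] and [mlc_center_u] their derivatives are combinations of themselves. Vanishing at
    the start of the segment therefore persists. *)
Lemma normal_direction_chart (l : galpha R n) p0 : O p0 ->
  exists2 Q : set 'rV[R]_m, nbhs p0 Q &
  forall p v, (forall t : R, 0 <= t <= 1 -> O (p + t *: v) /\ Q (p + t *: v)) ->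
  (forall x, tangent_frame G p x -> <|l, x.1.2|> = 0) ->
  (forall x, tangent_frame G (p + v) x -> <|l, x.1.2|> = 0) /\
  <|l, (G (p + v)).1.2|> = <|l, (G p).1.2|>.
Proof.
move=> Op0; have nO : nbhs p0 O := open_nbhs_nbhs (conj oO Op0).
have lin : \forall q \near p0, linear ((frame G) ^~ q).
  by apply: filterS nO => q Oq; exact: (frame_linear sG Oq).
have cX j : {for p0, continuous (frame G (delta_mx 0 j))}.
  exact: (differentiable_continuous (smooth_on_diff (smooth_frame oO sG _) Op0)).
have [k k0 nk] := lower_bound_near lin cX (model_frame_inj Op0).
(* On this neighbourhood a tangent vector controls its coordinates, so the coefficients of the
   linear system are bounded. *)
exists [set q | forall v, k * `|v| <= `|frame G v q|]; first exact: nk.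
move=> p v seg hp.
pose X j := frame G (delta_mx 0 j : 'rV[R]_m).
pose s j (t : R) := <|l, (X j (p + t *: v)).1.2|>.
have dX j q : O q -> differentiable (X j) q.
  by move=> Oq; exact: (smooth_on_diff (smooth_frame oO sG _) Oq).
have sumX q u : O q -> <|l, (frame G u q).1.2|> = \sum_j u 0 j * <|l, (X j q).1.2|>.
  move=> Oq; have lA : linear (fun u : 'rV[R]_m => <|l, (frame G u q).1.2|>).
    move=> a x y; rewrite (frame_linear sG Oq) /=.
    by rewrite dot_galphaDr dot_galphaZr.
  exact: (linear_sum_delta u lA).
pose Y j q := 'D_v (X j) q + mlc center_vec (frame G v q) (X j q).
have sY j : smooth_on O (Y j).
  apply: smooth_on_add => //; first by apply: smooth_on_derive; exact: smooth_frame.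
  by apply: smooth_mlc => //; [exact: smooth_on_cst|exact: smooth_frame|exact: smooth_frame].
have bY j : exists K, forall t : R, 0 <= t <= 1 -> `|Y j (p + t *: v)| <= K.
  apply: segment_bound => t ht.
  exact: (differentiable_continuous (smooth_on_diff (sY j) (seg t ht).1)).
have bA j : exists K, forall t : R, 0 <= t <= 1 -> `|(X j (p + t *: v)).1.1| <= K.
  apply: (@segment_bound _ _ _ (fun q => (X j q).1.1)) => t ht.
  exact: (differentiable_continuous (smooth_on_diff (smooth_a oO (smooth_frame oO sG _)) (seg t
    ht).1)).
have [KY hKY] := choice bY; have [KA hKA] := choice bA.
(* First summand: the coordinates of the modified derivative [Y j]. Second summand: the term along
   [frame G v] in [mlc_center_dot]. *)
pose C := \sum_j (`|KY j| / k + `|KA j| * `|v|).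
have Cj j : `|KY j| / k + `|KA j| * `|v| <= C.
  rewrite /C (bigD1 j) //= lerDl sumr_ge0 // => i _.
  by rewrite addr_ge0 ?divr_ge0 ?mulr_ge0 // ltW.
have C0 : 0 <= C.
  by apply: sumr_ge0 => i _; rewrite addr_ge0 ?divr_ge0 ?mulr_ge0 // ltW.
have ds j (t : R) : 0 <= t <= 1 ->
    is_derive t 1 (s j) (<|l, ('D_v (X j) (p + t *: v)).1.2|>).
  move=> ht; have Oq := (seg t ht).1.
  have [d1 e1] := derive_u v (dX j _ Oq).
  have lL : linear (fun u : galpha R n => <|l, u|>).
    by move=> a x y; rewrite dot_galphaDr dot_galphaZr.
  have cL : continuous (fun u : galpha R n => <|l, u|>).
    by move=> u; apply: cont_dot; [exact: cst_continuous|exact: cvg_id].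
  have [d2 e2] := derive_lin v lL cL d1.
  have D := derive_line d2; rewrite e2 e1 in D; exact: D.
have bs j (t : R) : 0 <= t <= 1 ->
    `|<|l, ('D_v (X j) (p + t *: v)).1.2|>| <= C * \sum_i `|s i t|.
  move=> ht; have [Oq Qq] := seg t ht; set q := p + t *: v.
  have [c hc] := model_mlc (delta_mx 0 j) v Oq.
  have E := mlc_center_dot l hc.
  have bsum u : `|<|l, (frame G u q).1.2|>| <= `|u| * \sum_i `|s i t|.
    rewrite (sumX _ _ Oq) mulr_sumr; apply: (le_trans (ler_norm_sum _ _ _)).
    by apply: ler_sum => i _; rewrite normrM ler_wpM2r // coord_norm_le.
  have bc : `|c| <= `|KY j| / k.
    rewrite ler_pdivlMr // mulrC; apply: (le_trans (Qq c)).
    rewrite -hc; apply: (le_trans (hKY j t ht)); exact: ler_norm.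
  have ba : `|(X j q).1.1| <= `|KA j| by apply: (le_trans (hKA j t ht)); exact: ler_norm.
  rewrite E; apply: (le_trans (ler_normD _ _)).
  have S0 : 0 <= \sum_i `|s i t| by apply: sumr_ge0.
  have h1 : `|<|l, (frame G c q).1.2|>| <= `|KY j| / k * \sum_i `|s i t|.
    by apply: (le_trans (bsum c)); rewrite ler_wpM2r.
  have h2 : `|2^-1 * (X j q).1.1 * <|l, (frame G v q).1.2|>| <= `|KA j| * `|v| * \sum_i `|s i t|.
    rewrite normrM -mulrA; apply: ler_pM => //.
    rewrite normrM ger0_norm ?invr_ge0 //; apply: le_trans ba.
    by rewrite ler_piMl // invf_le1 ?ler1n.
  apply: (le_trans (lerD h1 h2)); rewrite -mulrDl ler_wpM2r //.
have s0 j : s j 0 = 0.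
  have e : p + 0 *: v = p by rewrite scale0r addr0.
  by rewrite /s e; exact: (hp _ (ex_intro _ (delta_mx 0 j) erefl)).
have seg0 := gronwall_system_all C0 ds bs s0.
have fr0 (t : R) u : 0 <= t <= 1 -> <|l, (frame G u (p + t *: v)).1.2|> = 0.
  move=> ht; rewrite (sumX _ _ (seg t ht).1) big1 // => j _.
  by have e : <|l, (X j (p + t *: v)).1.2|> = 0 := seg0 t ht j; rewrite e mulr0.
split.
  move=> x [u ->]; have := fr0 1 u; rewrite scale1r; apply.
  by rewrite ler01 lexx.
have lL : linear (fun u : galpha R n => <|l, u|>).
  by move=> a x y; rewrite dot_galphaDr dot_galphaZr.
have cL : continuous (fun u : galpha R n => <|l, u|>).
  by move=> u; apply: cont_dot; [exact: cst_continuous|exact: cvg_id].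
have D q : O q -> differentiable (fun q => <|l, (G q).1.2|>) q /\
    'D_v (fun q => <|l, (G q).1.2|>) q = <|l, ('D_v G q).1.2|>.
  move=> Oq; have [d1 e1] := derive_u v (smooth_on_diff sG Oq).
  have [d2 e2] := derive_lin v lL cL d1; split; first exact: d2.
  by apply: (etrans e2); rewrite e1.
(* The derivative of the pairing of l with the g_alpha coordinate of G is a positive multiple of its
   pairing with the frame, which has just been shown to vanish. *)
have [c hc] := @MVT_line R _ (fun q => <|l, (G q).1.2|>) p v 1 ler01
  (fun t ht => (D _ (seg t ht).1).1).
rewrite scale1r mul1r; have [_ ->] := D _ (seg c hc).1.
have -> : 'D_v G (p + c *: v) = lft (G (p + c *: v)) (frame G v (p + c *: v)) by rewrite /frame
  mctK.
rewrite lft.unlock /= dot_galphaZr (fr0 c v hc) mulr0 => /eqP.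
by rewrite subr_eq0 => /eqP.
Qed.

End InChart.

Lemma normal_direction_constant (l : galpha R n) q0 :
  (forall x, model_tangent q0 x -> <|l, x.1.2|> = 0) ->
  forall q, (forall x, model_tangent q x -> <|l, x.1.2|> = 0) /\
    <|l, (f (iota q)).1.2|> = <|l, (f (iota q0)).1.2|>.
Proof.
move=> l0; apply: (connected_all (q0 := q0) cM) => // q.
case: (chart subM q) => D [h [x [hO Ox <-]]].
have [Q nQ hQ] := normal_direction_chart hO l Ox.
apply: (local_segment hO Ox nQ) => p v seg [].
have Op : D p by have := (seg 0); rewrite scale0r addr0 lexx ler01 => /(_ isT)[].
have Opv : D (p + v) by have := (seg 1); rewrite scale1r lexx ler01 => /(_ isT)[].
rewrite (model_tangentE hO Op) (model_tangentE hO Opv) => h1 h2.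
have [h3 h4] := hQ p v seg h1; split=> //; exact: (etrans h4 h2).
Qed.

End Transported.

(** * The group S *)

Section VspaceProjectable.
Variables (R : realType) (n : nat).
Local Notation galpha := (galpha R n).
Local Notation CH := (CH R n).
Local Notation "<| u , v |>" := (dot_galpha u v).

Lemma dot_galpha_inner : inner_product (@dot_galpha R n).
Proof.
split; [exact: dot_galphaC| |exact: dot_galpha_ge0|exact: dot_galpha_eq0].
by move=> a x y z; rewrite dot_galphaDl dot_galphaZl.
Qed.

Lemma vspace_projectable (w : {vspace galpha}) :
  projectable (@dot_galpha R n) [set` w].
Proof.
have span_lspan (s : seq galpha) x : x \in span s -> lspan s x.
  elim: s x => [|a s IH] x; first by rewrite span_nil memv0 => /eqP.
  rewrite span_cons => /memv_addP[_ /vlineP[c ->] [y sy ->]].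
  by exists c, y; split=> //; exact: IH.
apply: (projectable_fin dot_galpha_inner (s := vbasis w)) => /=.
- exact: mem0v.
- by move=> a x y wx wy; rewrite memvD // memvZ.
- by move=> x; exact: vbasis_mem.
- by move=> x wx; apply: span_lspan; rewrite (span_basis (vbasisP w)).
Qed.

Lemma vspace_orth (w : {vspace galpha}) u :
  (forall l, (forall v, v \in w -> <|l, v|> = 0) -> <|l, u|> = 0) -> u \in w.
Proof.
move=> h; apply: (orth_orth dot_galpha_inner (vspace_projectable w)) => l hl.
by rewrite dot_galphaC; exact: h.
Qed.

(** Pairing a one-parameter group with a vector l orthogonal to w gives a scalar function whose
    derivative vanishes at 0, hence everywhere by the group law. This avoids the exponential map. *)
Lemma one_param_u (w : {vspace galpha}) c (X : CH) : one_param c X -> X.1.2 \in w ->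
  forall t, (c t).1.2 \in w.
Proof.
move=> [cD dc] wX t; have u0 : (c 0).1.2 = 0.
  have := congr1 (fun p : CH => p.1.2) (cD 0 0); rewrite addr0 /=.
  move=> /esym /eqP; rewrite -subr_eq0 addrAC subrr add0r scaler_eq0 => /orP[|/eqP //].
  by rewrite gt_eqF ?expR_gt0.
apply: vspace_orth => l hl.
pose psi (r : R) := <|l, (c r).1.2|>.
have dpsi : is_derive (0 : R) 1 psi 0.
  have dc0 : differentiable c 0 by apply/derivable1_diffP; case: dc.
  have [d1 e1] := derive_u (1 : R^o) dc0.
  have lL : linear (fun u : galpha => <|l, u|>).
    by move=> a x y; rewrite dot_galphaDr dot_galphaZr.
  have cL : continuous (fun u : galpha => <|l, u|>).
    by move=> u; apply: cont_dot; [exact: cst_continuous|exact: cvg_id].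
  have [d2 e2] := derive_lin (1 : R^o) lL cL d1.
  apply: DeriveDef; first exact: diff_derivable.
  by apply: (etrans e2); rewrite e1; case: dc => _ ->; exact: hl.
have Dpsi (s : R) : is_derive s 1 psi 0.
  (* The group law read in the g_alpha coordinate: near s, psi is an affine image of psi near 0. *)
  have E : psi = (fun r : R => psi s + expR ((c s).1.1 / 2) * psi (r - s)).
    apply/funext => r; rewrite {1}/psi -{1}(subrK s r) addrC cD /=.
    by rewrite dot_galphaDr dot_galphaZr.
  have d1 : is_derive s 1 (fun r : R => r - s) 1.
    by apply: is_derive_eq; rewrite subr0.
  have d0 : is_derive (s - s) 1 psi 0 by rewrite subrr.
  have d2 := @is_derive1_comp _ psi (fun r : R => r - s) s _ _ d0 d1.
  rewrite E; have d3 := is_deriveD (is_derive_cst (psi s) s (1 : R)) (is_deriveZ (expR ((c s).1.1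
    / 2)) d2).
  by move: d3; rewrite mul0r scaler0 addr0.
have := @is_derive_0_is_cst _ psi t 0 Dpsi; rewrite /psi u0 => ->.
by rewrite dot_galpha0r.
Qed.

(** The right-hand side is a subgroup containing the one-parameter groups in question. Conversely
    each of its points is a product of three elements lying on straight lines that are one-parameter
    groups. *)
Lemma W_subE (w : {vspace galpha}) : W_sub w = [set p | p.1.2 \in w].
Proof.
rewrite /W_sub; apply/seteqP; split=> [_ [p hp <-]|p wp].
  rewrite mul_AN0 /=; apply: (hp [set p | p.1.2 \in w]) => [|c X].
    split=> /= [|q r wq wr|q wq]; first exact: mem0v.
      by rewrite memvD // memvZ.
    by rewrite memvN memvZ.
  exact: one_param_u.
exists p; last by rewrite mul_AN0.
move=> H [H0 HM HV] hc.
have line (X : CH) : (forall s t : R, (s + t) *: X = mul_AN (s *: X) (t *: X)) -> X.1.2 \in w ->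
  H X.
  move=> h wX; rewrite -(scale1r X); apply: (hc (fun t => t *: X) X) => //; split=> //.
  have di : differentiable (@id CH) (0 + (0 : R) *: X).
    exact: (smooth_on_diff (smooth_on_id openT) (I : setT _)).
  have := derive_line di; rewrite derive_id.
  have -> : (fun s : R => id (0 + s *: X)) = (fun t : R => t *: X) by apply/funext => t; rewrite
    add0r.
  exact.
(* The factors lie in w, g_2alpha and a, in this order, as in the chart
   [exp(u + b Z_0) exp(a B)]. *)
have -> : p = mul_AN (mul_AN (0, p.1.2, 0) (0, 0, p.2)) (p.1.1, 0, 0).
  case: p {wp} => [[a u] b]; rewrite /mul_AN /= !mul0r expR0 !scale1r !scaler0.
  by rewrite ?(dot_galpha0r, mulr0, mul1r, addr0, add0r).
apply: (HM); first apply: (HM); apply: line => //; try exact: mem0v.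
- move=> s t; rewrite /mul_AN /= !scaler0 mul0r expR0 scale1r !addr0 mulr0 add0r.
  by rewrite J_galphaZ dot_galphaZl dot_galphaZr dot_galphaJ !mulr0; congr (_, _, _); rewrite /=
    ?scaler0 ?scalerDl ?addr0.
- move=> s t; rewrite /mul_AN /= !scaler0 mul0r expR0 !addr0 dot_galpha0r !mulr0 mul1r !addr0.
  by congr (_, _, _); rewrite /= ?scaler0 ?scalerDl ?addr0 ?mul1r.
- move=> s t; rewrite /mul_AN /= !scaler0 dot_galpha0r !mulr0 !addr0.
  by congr (_, _, _); rewrite /= ?scaler0 ?scalerDl ?addr0.
Qed.

End VspaceProjectable.

(** * Open images *)

Section LocalSurjectivity.
Variables (R : realType) (n m : nat).
Local Notation CH := (CH R n).
Local Notation "<< x , y >>" := (dot_an x y).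

Lemma dot_an_triangle (x y z : CH) :
  << x - y, x - y >> <= 2 * << x - z, x - z >> + 2 * << z - y, z - y >>.
Proof.
have -> : x - y = (x - z) + (z - y) by rewrite addrA subrK.
move: (x - z) (z - y) => a b; have := dot_an_ge0 (a - b).
rewrite !dot_anE (dot_anC b a); lra.
Qed.

Lemma dot_anBC (x y : CH) : << x - y, x - y >> = << y - x, y - x >>.
Proof. by rewrite -(opprB y x) dot_anNl dot_anNr opprK. Qed.

Lemma norm_ball_compact (x : 'rV[R]_m) (r : R) (P : R -> Prop) :
  closed [set s | P s] -> (forall s, P s -> s <= r) ->
  compact [set y : 'rV[R]_m | P `|y - x|].
Proof.
move=> cP Pr; apply: bounded_closed_compact.
  exists (`|x| + r); split; first exact: num_real.
  move=> s xs y /= /Pr h; apply: (le_trans _ (ltW xs)).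
  by rewrite -(subrK x y) addrC (le_trans (ler_normD _ _)) // lerD2l.
apply: (@preimage_closed _ _ (fun y : 'rV[R]_m => `|y - x|) [set s | P s]); last exact: cP.
move=> y _; apply: (@cont_comp _ _ _ y (fun y : 'rV[R]_m => y - x)); last exact: norm_continuous.
by apply: cont_add; [exact: cvg_id|exact: cst_continuous].
Qed.

(* At a minimum of the distance from [q] to the image, the difference vector is
   orthogonal to the velocities, which span everything the difference lies in. *)
Lemma local_surj (O : set 'rV[R]_m) (G : 'rV[R]_m -> CH) x (w : {vspace galpha R n}) :
  open O -> smooth_on O G -> O x ->
  (forall y z, O y -> O z -> G y = G z -> y = z) ->
  (forall y, O y -> (G y).1.2 \in w) ->
  (forall y e, O y -> e.1.2 \in w -> exists v, e = 'D_v G y) ->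
  exists U : set CH, [/\ open U, U (G x) &
    forall q, U q -> q.1.2 \in w -> exists2 y, O y & q = G y].
Proof.
move=> oO sG Ox inj Gw surj.
have nO : nbhs x O := open_nbhs_nbhs (conj oO Ox).
have /nbhs_ballP[r /= r0 hr] := nO.
pose r2 := r / 2; have r20 : 0 < r2 by rewrite divr_gt0.
pose B := [set y : 'rV[R]_m | `|y - x| <= r2].
pose S := [set y : 'rV[R]_m | `|y - x| = r2].
have BO : B `<=` O.
  move=> y By; apply: hr; rewrite -ball_normE /ball_ /= distrC.
  by apply: (le_lt_trans By); rewrite /r2 ltr_pdivrMr // ltr_pMr // ltr1n.
have SB : S `<=` B by move=> y; rewrite /S /B /= => ->.
have cB : compact B by apply: (@norm_ball_compact x r2 (fun s => s <= r2)); [exact: closed_le|].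
have cS : compact S by apply: (@norm_ball_compact x r2 (fun s => s = r2)); [exact:
  closed_eq|move=> s ->].
pose N q y := << G y - q, G y - q >>.
have sN q : smooth_on O (N q).
  by apply: smooth_dot_an => //; apply: smooth_on_sub_fun => //; exact: smooth_on_cst.
have cN q (A : set 'rV[R]_m) : A `<=` O -> {within A, continuous (N q)}.
  move=> AO; apply: continuous_in_subspaceT => y; rewrite inE => /AO Oy.
  exact: (differentiable_continuous (smooth_on_diff (sN q) Oy)).
(* By injectivity of G the sphere S stays at a positive distance from [G x]; c is a lower bound for
   its square. *)
have [c c0 hc] : exists2 c, 0 < c & forall y, S y -> c <= N (G x) y.
  have [S0|S0] := pselect (S !=set0); last first.
    by exists 1 => // y Sy; case: S0; exists y.
  have [y Sy hy] := EVT_min_rV S0 cS (cN (G x) S (fun y Sy => BO y (SB y Sy))).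
  exists (N (G x) y); last by move=> z Sz; apply: hy; rewrite inE.
  rewrite inE in Sy; rewrite lt_def dot_an_ge0 andbT; apply/eqP => /dot_an_eq0 /eqP.
  rewrite subr_eq0 => /eqP e; have yx := inj y x (BO y (SB y Sy)) Ox e.
  by move: Sy; rewrite /S /= yx subrr normr0 => r2e; rewrite -r2e ltxx in r20.
(* With c/4 the minimum cannot lie on S: its squared distances to q and from q to [G x] would both
   be below c/4, and [dot_an_triangle], with its factor 2, would put it closer to [G x] than c
   allows. *)
exists [set q | << q - G x, q - G x >> < c / 4]; split.
- pose h (q : CH) := << q - G x, q - G x >>.
  suff : open (h @^-1` [set s | s < c / 4]) by [].
  apply: open_comp; last exact: open_lt.
  move=> q _; have sid := @smooth_on_id R CH setT openT.
  have sq : smooth_on setT h.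
    apply: smooth_dot_an; [exact: openT| |]; apply: smooth_on_sub_fun => //; first exact: openT.
    + exact: smooth_on_cst.
    + exact: openT.
    + exact: smooth_on_cst.
  exact: (differentiable_continuous (smooth_on_diff sq (I : setT q))).
- by rewrite /= subrr dot_an0l divr_gt0.
move=> q /= Uq wq.
have Bx : B x by rewrite /B /= subrr normr0 ltW.
have [y0 By0 hy0] := EVT_min_rV (ex_intro _ x Bx) cB (cN q B BO).
rewrite inE in By0; have Oy0 := BO _ By0.
have My y : B y -> N q y0 <= N q y by move=> By; apply: hy0; rewrite inE.
have Nx : N q x < c / 4.
  by rewrite /N dot_anBC.
have ltB : `|y0 - x| < r2.
  rewrite lt_neqAle By0 andbT; apply/eqP => e.
  have h1 := hc y0 e; have h2 := dot_an_triangle (G y0) (G x) q; have h3 := My _ Bx.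
  by move: h1 h2 h3 Uq; rewrite -/(N q y0) -/(N (G x) y0); lra.
exists y0 => //; apply/eqP; rewrite eq_sym -subr_eq0; apply/eqP; apply: dot_an_eq0.
have We : (G y0 - q).1.2 \in w by rewrite /= memvB // Gw.
have [v ev] := surj y0 _ Oy0 We.
pose d := (r2 - `|y0 - x|) / (`|v| + 1).
have v1 : 0 < `|v| + 1 by rewrite ltr_wpDl.
have d0 : 0 < d by rewrite divr_gt0 // subr_gt0.
have Bt (t : R) : t \in `]- d, d[ -> B (y0 + t *: v).
  rewrite in_itv /= -ltr_norml => td; rewrite /B /= addrAC.
  apply: (le_trans (ler_normD _ _)); rewrite normrZ -lerBrDl.
  apply: (@le_trans _ _ (d * (`|v| + 1))); first by rewrite ler_pM // ?ltW // ltrDl.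
  by rewrite /d divfK // gt_eqF.
have dline (t : R) : t \in `]- d, d[ -> is_derive t 1 (fun s : R => N q (y0 + s *: v)) ('D_v (N
  q) (y0 + t *: v)).
  by move=> ht; apply: derive_line; exact: (smooth_on_diff (sN q) (BO _ (Bt t ht))).
have z0 : (0 : R) \in `]- d, d[ by rewrite in_itv /= oppr_lt0 d0.
have dm : is_derive (0 : R) 1 (fun s : R => N q (y0 + s *: v)) 0.
  apply: (@derive1_at_min _ _ (- d) d); [by rewrite ge0_cp // ltW|by move=> t /dline[]|exact: z0|].
  by move=> t ht; rewrite scale0r addr0; apply: My; exact: Bt.
have e1 : 'D_v (N q) y0 = 0.
  have [_ e] := dline 0 z0; have [_ e'] := dm.
  by rewrite scale0r addr0 in e; rewrite -e e'.
have dG : differentiable (fun y => G y - q) y0.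
  by apply: (smooth_on_diff _ Oy0); apply: smooth_on_sub_fun => //; exact: smooth_on_cst.
have [_ e2] := derive_bil v (bb_dot_an R n) dG dG.
have e3 : 'D_v (fun y => G y - q) y0 = G y0 - q.
  rewrite [RHS]ev; have dG0 := smooth_on_diff sG Oy0.
  have h := deriveB (@diff_derivable _ _ _ G y0 v dG0) (@derivable_cst _ _ _ q y0 v).
  apply: (etrans h); rewrite derive_cst; exact: subr0.
have e4 : << G y0 - q, G y0 - q >> + << G y0 - q, G y0 - q >> = 0.
  apply: (etrans _ e1); apply: (etrans _ (esym e2)).
  exact: (congr1 (fun t => << t, G y0 - q >> + << G y0 - q, t >>) (esym e3)).
by move: e4; move: << _, _ >> => a; lra.
Qed.

End LocalSurjectivity.

(** * Unitary equivalence of subspaces of constant Kaehler angle *)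

Section UnitaryGroup.
Variables (R : realType) (n : nat).
Local Notation galpha := (galpha R n).
Local Notation Jg := (@J_galpha R n).
Local Notation "<| u , v |>" := (dot_galpha u v).

Definition unitary_pair (U U' : galpha -> galpha) :=
  [/\ unitary_galpha U /\ unitary_galpha U', continuous U, continuous U',
      cancel U U' & cancel U' U].

Lemma unitary_pair_id : unitary_pair id id.
Proof. by split; [split; split|move=> x; exact: cvg_id|move=> x; exact: cvg_id|by []|by []]. Qed.

Lemma unitary_pair_comp U U' V V' : unitary_pair U U' -> unitary_pair V V' ->
  unitary_pair (V \o U) (U' \o V').
Proof.
move=> [[[lU dU JU] [lU' dU' JU']] cU cU' K K'] [[[lV dV JV] [lV' dV' JV']] cV cV' L L'].
split.
- split; split.
  + by move=> a x y; rewrite /= lU lV.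
  + by move=> x y; rewrite /= dV dU.
  + by move=> x; rewrite /= JU JV.
  + by move=> a x y; rewrite /= lV' lU'.
  + by move=> x y; rewrite /= dU' dV'.
  + by move=> x; rewrite /= JV' JU'.
- by move=> x; exact: (@cont_comp _ _ _ x U V (cU x) cV).
- by move=> x; exact: (@cont_comp _ _ _ x V' U' (cV' x) cU').
- by move=> x; rewrite /= L K.
- by move=> x; rewrite /= K' L'.
Qed.

(* [v - c H(v, z) z] for the Hermitian form H and [c = al + i be]. *)
Definition creflection (al be : R) (z v : galpha) : galpha :=
  v - (<|v, z|> * al - <|v, Jg z|> * be) *: z - (<|v, z|> * be + <|v, Jg z|> * al) *: Jg z.

Lemma creflection_linear al be z : linear (creflection al be z).
Proof.
move=> a x y; apply: dot_galpha_ext => t.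
by rewrite /creflection ?(dot_galphaE, J_galphaE) /=; ring.
Qed.

(** For nonzero z the hypothesis, [2 Re c = |c|^2 |z|^2], says that the eigenvalue [1 - c |z|^2] on
    the complex line of z has modulus one. *)
Lemma creflection_unitary al be z : al = <|z, z|> / 2 * (al ^+ 2 + be ^+ 2) ->
  unitary_galpha (creflection al be z).
Proof.
move=> h; split; first exact: creflection_linear.
  move=> u v; rewrite /creflection ?(dot_galphaE, J_galphaE).
  rewrite (dot_galphaC z v) (dot_galphaC (Jg z) v) (dot_galphaC z (Jg z)) dot_galphaJJ dot_galphaJ.
  have h2 : <|z, z|> * (al ^+ 2 + be ^+ 2) = 2 * al by rewrite {2}h; field.
  move: h2; move: <|z, z|> <|u, z|> <|v, z|> <|u, Jg z|> <|v, Jg z|> <|u, v|> => N a b c d e h2.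
  have h3 : (a * b + c * d) * (N * (al ^+ 2 + be ^+ 2) - 2 * al) = 0 by rewrite h2; ring.
  rewrite -[RHS]addr0 -[X in _ = _ + X]h3; ring.
move=> u; apply: dot_galpha_ext => t; rewrite /creflection ?(dot_galphaE, J_galphaE).
have e : <|Jg u, z|> = - <|u, Jg z|> by rewrite dot_galphaJr opprK.
by rewrite e dot_galphaJJ; ring.
Qed.

Lemma creflection_cont al be z : continuous (creflection al be z).
Proof.
have si : smooth_on setT (@id galpha) by exact: smooth_on_id openT.
have sc (W : normedModType R) (a : W) : smooth_on setT (fun _ : galpha => a).
  exact: smooth_on_cst.
have s u a : smooth_on setT (fun v : galpha => <|v, u|> * a).
  by apply: smooth_on_mul => //; [exact: openT|apply: smooth_dot_galpha => //; exact: openT].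
have sr : smooth_on setT (creflection al be z).
  apply: smooth_on_sub_fun; [exact: openT|apply: smooth_on_sub_fun; [exact: openT|exact: si|]|].
    apply: smooth_on_scale; [exact: openT| |exact: sc].
    by apply: smooth_on_sub_fun; [exact: openT|exact: s|exact: s].
  apply: smooth_on_scale; [exact: openT| |exact: sc].
  by apply: smooth_on_add; [exact: openT|exact: s|exact: s].
by move=> x; exact: (differentiable_continuous (smooth_on_diff sr (I : setT x))).
Qed.

Lemma creflectionK al be z : al = <|z, z|> / 2 * (al ^+ 2 + be ^+ 2) ->
  cancel (creflection al be z) (creflection al (- be) z).
Proof.
move=> h v; apply: dot_galpha_ext => t; rewrite /creflection ?(dot_galphaE, J_galphaE).
rewrite (dot_galphaC z (Jg z)) dot_galphaJJ dot_galphaJ.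
have h2 : <|z, z|> * (al ^+ 2 + be ^+ 2) = 2 * al by rewrite {2}h; field.
move: h2; move: <|z, z|> <|v, z|> <|v, Jg z|> <|z, t|> <|Jg z, t|> <|v, t|> => N a b c d e h2.
have h3 : (a * c + b * d) * (N * (al ^+ 2 + be ^+ 2) - 2 * al) = 0 by rewrite h2; ring.
rewrite -[RHS]addr0 -[X in _ = _ + X]h3; ring.
Qed.

Lemma creflection_pair al be z : al = <|z, z|> / 2 * (al ^+ 2 + be ^+ 2) ->
  unitary_pair (creflection al be z) (creflection al (- be) z).
Proof.
move=> h; have h' : al = <|z, z|> / 2 * (al ^+ 2 + (- be) ^+ 2) by rewrite sqrrN.
split; [split; exact: creflection_unitary|exact: creflection_cont|exact: creflection_cont| |].
  exact: creflectionK.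
by have := creflectionK h'; rewrite opprK.
Qed.

Definition same_gram (s : seq (galpha * galpha)) := forall p q, p \in s -> q \in s ->
  <|p.1, q.1|> = <|p.2, q.2|> /\ <|Jg p.1, q.1|> = <|Jg p.2, q.2|>.

(** The reflection along [z = a - b] with [c = 1 / (p + i q)], chosen so that exactly z is
    subtracted from a; [|z|^2 = 2 p] makes it unitary. Vectors having the same products with a and b
    are orthogonal to z over the complex numbers, hence fixed. *)
Lemma witt_step (a b : galpha) (s : seq galpha) : <|a, a|> = <|b, b|> ->
  (forall y, y \in s -> <|a, y|> = <|b, y|> /\ <|Jg a, y|> = <|Jg b, y|>) ->
  exists U U', [/\ unitary_pair U U', U a = b & forall y, y \in s -> U y = y].
Proof.
move=> ab h; have [e|ne] := eqVneq a b.
  by exists id, id; rewrite e; split=> //; exact: unitary_pair_id.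
pose z := a - b; pose p := <|a, z|>; pose q := <|a, Jg z|>.
have zz : <|z, z|> = 2 * p.
  by rewrite /p /z ?dot_galphaE ab (dot_galphaC b a); ring.
have p0 : p != 0.
  apply/eqP => p0; move: ne; rewrite -subr_eq0 => /eqP; apply.
  by apply: dot_galpha_eq0; rewrite zz p0 mulr0.
have D0 : p ^+ 2 + q ^+ 2 != 0 by rewrite gt_eqF // ltr_pwDl ?sqr_ge0 // exprn_even_gt0.
pose al := p / (p ^+ 2 + q ^+ 2); pose be := - (q / (p ^+ 2 + q ^+ 2)).
exists (creflection al be z), (creflection al (- be) z); split.
- by apply: creflection_pair; rewrite zz /al /be; field.
- rewrite /creflection -/p -/q.
  have -> : p * al - q * be = 1 by rewrite /al /be; field.
  have -> : p * be + q * al = 0 by rewrite /al /be; field.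
  by rewrite scale1r scale0r subr0 /z opprB addrC subrK.
- move=> y sy; have [h1 h2] := h y sy; rewrite /creflection.
  have -> : <|y, z|> = 0 by rewrite dot_galphaC /z dot_galphaDl dot_galphaNl h1 subrr.
  have -> : <|y, Jg z|> = 0.
    by rewrite dot_galphaC /z J_galphaD J_galphaN dot_galphaDl dot_galphaNl h2 subrr.
  by rewrite !mul0r subr0 addr0 !scale0r !subr0.
Qed.

(** The map obtained for the tail is followed by one that corrects the image of the head while
    fixing the images of the tail. *)
Lemma witt (s : seq (galpha * galpha)) : same_gram s ->
  exists U U', unitary_pair U U' /\ forall p, p \in s -> U p.1 = p.2.
Proof.
elim: s => [|a s IH] gs; first by exists id, id; split=> //; exact: unitary_pair_id.
have [|U [U' [UP Us]]] := IH.
  by move=> p q sp sq; apply: gs; rewrite inE ?sp ?sq orbT.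
have [[[lU dU JU] _] _ _ _ _] := UP.
have a0 : a \in a :: s by rewrite inE eqxx.
have [||V [V' [VP Va Vs]]] := @witt_step (U a.1) a.2 [seq p.2 | p <- s].
- by rewrite dU; have [] := gs a a a0 a0.
- move=> y /mapP[p sp ->]; rewrite -(Us p sp) -JU !dU (Us p sp).
  by apply: gs; rewrite // inE sp orbT.
exists (V \o U), (U' \o V'); split; first exact: unitary_pair_comp.
move=> p; rewrite inE => /orP[/eqP -> //|sp] /=.
by rewrite (Us p sp) Vs //; exact: map_f.
Qed.

Lemma unitary_span U U' (s : seq (galpha * galpha)) : unitary_pair U U' ->
  (forall p, p \in s -> U p.1 = p.2) ->
  \dim (span [seq p.1 | p <- s]) = \dim (span [seq p.2 | p <- s]) /\
  forall x, x \in span [seq p.1 | p <- s] <-> U x \in span [seq p.2 | p <- s].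
Proof.
move=> [[[lU dU JU] [lU' _ _]] _ _ K K'] h.
pose L : {linear galpha -> galpha} := HB.pack U (GRing.isLinear.Build _ _ _ _ _ lU).
pose f := linfun L; have fE x : f x = U x by rewrite lfunE.
have e : (f @: span [seq p.1 | p <- s])%VS = span [seq p.2 | p <- s].
  rewrite limg_span -map_comp; congr span; apply/eq_in_map => p sp /=.
  by rewrite fE h.
have ker0 : lker f = 0%VS by apply/eqP/lker0P => x y; rewrite !fE; exact: (can_inj K).
split; first by rewrite -e limg_dim_eq // ker0 capv0.
move=> x; split=> [sx|]; first by rewrite -e -fE memv_img.
rewrite -e => /memv_imgP[y sy]; rewrite fE => /(can_inj K) ->; exact: sy.
Qed.

End UnitaryGroup.

Section KahlerSubspaces.
Variables (R : realType) (n : nat) (phi : R).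
Local Notation galpha := (galpha R n).
Local Notation Jg := (@J_galpha R n).
Local Notation "<| u , v |>" := (dot_galpha u v).
Hypothesis cphi : 0 <= cos phi.

Section OneSubspace.
Variable u : {vspace galpha}.
Hypothesis angle : const_kahler_angle (@dot_galpha R n) Jg [set` u] phi.

Definition kproj x := orth_proj (@dot_galpha R n) [set` u] (Jg x).

Lemma kproj_mem x : kproj x \in u.
Proof. exact: (orth_projS (vspace_projectable u) (Jg x)). Qed.

Lemma kprojK x : x \in u -> kproj (kproj x) = - (cos phi ^+ 2 *: x).
Proof.
have /(const_kahler_angleP (dot_galpha_inner R n) (@J_galpha_linear R n)
  (@dot_galphaJC R n) (vspace_projectable u) cphi) h := angle.
exact: h.
Qed.

Lemma dot_kproj x y : y \in u -> <|kproj x, y|> = <|Jg x, y|>.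
Proof. exact: (ip_orth_proj (dot_galpha_inner R n) (vspace_projectable u)). Qed.

Lemma unit_orth (L : {vspace galpha}) : (L <= u)%VS -> (\dim L < \dim u)%N ->
  exists e, [/\ e \in u, <|e, e|> = 1 & forall l, l \in L -> <|e, l|> = 0].
Proof.
move=> Lu d; have /subvPn[x ux nx] : ~~ (u <= L)%VS.
  by apply/negP => uL; move: d; rewrite ltnNge dimvS.
have LP := vspace_projectable L.
pose y := x - orth_proj (@dot_galpha R n) [set` L] x.
have Py := orth_projS LP x.
have y0 : y != 0.
  by apply: contra nx; rewrite subr_eq0 => /eqP ->.
have N0 : 0 < <|y, y|> := ip_gt0 (dot_galpha_inner R n) y0.
pose c := (Num.sqrt <|y, y|>)^-1.
exists (c *: y); split.
- by apply: memvZ; apply: memvB => //; apply: (subvP Lu).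
- rewrite dot_galphaZl dot_galphaZr /c mulrA -invfM -expr2 sqr_sqrtr ?ltW //.
  by rewrite mulVf // gt_eqF.
- move=> l Ll; rewrite dot_galphaZl /y (orth_proj_orth LP) ?mulr0 //.
Qed.

(* The Hermitian Gram matrix of a list extended by [e] and [kproj e]. *)
Lemma kahler_products e l : e \in u -> l \in u -> <|e, e|> = 1 -> <|e, l|> = 0 ->
  <|e, kproj l|> = 0 ->
  [/\ <|Jg e, l|> = 0, <|kproj e, l|> = 0, <|Jg (kproj e), l|> = 0,
      <|kproj e, e|> = 0 & <|kproj e, kproj e|> = cos phi ^+ 2].
Proof.
move=> ue ul ee el ekl.
have Jel : <|Jg e, l|> = 0 by rewrite dot_galphaJC -(dot_kproj l ue) dot_galphaC ekl oppr0.
split; first exact: Jel.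
- by rewrite (dot_kproj e ul).
- by rewrite -(dot_kproj _ ul) kprojK // dot_galphaNl dot_galphaZl el mulr0 oppr0.
- by rewrite (dot_kproj e ue) dot_galphaJ.
- rewrite (dot_kproj e (kproj_mem e)) dot_galphaJC -(dot_kproj _ ue) kprojK //.
  by rewrite dot_galphaNl dot_galphaZl ee mulr1 opprK.
Qed.

End OneSubspace.

Variables (u u' : {vspace galpha}).
Hypothesis angle : const_kahler_angle (@dot_galpha R n) Jg [set` u] phi.
Hypothesis angle' : const_kahler_angle (@dot_galpha R n) Jg [set` u'] phi.
Hypothesis dimE : \dim u = \dim u'.

(** A partial Hermitian isometry between u and u', kept stable under the projected J so that the
    orthogonal complements of the spans are stable as well. *)
Definition kahler_list (s : seq (galpha * galpha)) := same_gram s /\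
  forall p, p \in s -> [/\ p.1 \in u, p.2 \in u',
    kproj u p.1 \in span [seq q.1 | q <- s] & kproj u' p.2 \in span [seq q.2 | q <- s]].

Lemma span_sub1 s : kahler_list s -> (span [seq p.1 | p <- s] <= u)%VS.
Proof. by move=> [_ h]; apply/span_subvP => _ /mapP[p sp ->]; case: (h p sp). Qed.

Lemma span_sub2 s : kahler_list s -> (span [seq p.2 | p <- s] <= u')%VS.
Proof. by move=> [_ h]; apply/span_subvP => _ /mapP[p sp ->]; case: (h p sp). Qed.

(** By [kahler_products] the Hermitian products of a new unit vector e and of [kproj e], with each
    other and with the old vectors, depend only on phi. So e may be chosen freely on both sides. If
    [cos phi = 0] the second vector is zero, which does no harm: only growth of the dimension is
    claimed. *)
Lemma kahler_list_extend s : kahler_list s ->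
  (\dim (span [seq p.1 | p <- s]) < \dim u)%N ->
  exists2 s', kahler_list s' &
    (\dim (span [seq p.1 | p <- s]) < \dim (span [seq p.1 | p <- s']))%N.
Proof.
move=> hs lt; have [gs ms] := hs.
have [U [U' [UP Us]]] := witt gs; have [dE _] := unitary_span UP Us.
have [e [ue ee el]] := unit_orth (span_sub1 hs) lt.
have [|e' [ue' ee' el']] := @unit_orth u' (span [seq p.2 | p <- s]) (span_sub2 hs).
  by rewrite -dE -dimE.
pose f := kproj u e; pose f' := kproj u' e'.
pose s' := (e, e') :: (f, f') :: s.
have in1 p : p \in s -> p.1 \in span [seq q.1 | q <- s] by move=> sp; apply: memv_span; exact:
  map_f.
have in2 p : p \in s -> p.2 \in span [seq q.2 | q <- s] by move=> sp; apply: memv_span; exact: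
  map_f.
have sub1 x : x \in span [seq q.1 | q <- s] -> x \in span [seq q.1 | q <- s'].
  by apply: subvP; apply: sub_span => y; rewrite /= !inE => ->; rewrite !orbT.
have sub2 x : x \in span [seq q.2 | q <- s] -> x \in span [seq q.2 | q <- s'].
  by apply: subvP; apply: sub_span => y; rewrite /= !inE => ->; rewrite !orbT.
have ke : e \in span [seq q.1 | q <- s'] by apply: memv_span; rewrite /= inE eqxx.
have ke' : e' \in span [seq q.2 | q <- s'] by apply: memv_span; rewrite /= inE eqxx.
have A p : p \in s -> [/\ <|e, p.1|> = 0, <|Jg e, p.1|> = 0, <|f, p.1|> = 0 & <|Jg f, p.1|> = 0].
  move=> sp; have [u1 _ k1 _] := ms p sp; have o1 := el _ (in1 p sp).
  by have [a b c _ _] := kahler_products angle ue u1 ee o1 (el _ k1).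
have A' p : p \in s -> [/\ <|e', p.2|> = 0, <|Jg e', p.2|> = 0, <|f', p.2|> = 0 & <|Jg f', p.2|>
  = 0].
  move=> sp; have [_ u1 _ k1] := ms p sp; have o1 := el' _ (in2 p sp).
  by have [a b c _ _] := kahler_products angle' ue' u1 ee' o1 (el' _ k1).
have z0 (v : {vspace galpha}) x : <|x, (0 : galpha)|> = 0 by rewrite dot_galpha0r.
have k0 (v : {vspace galpha}) : const_kahler_angle (@dot_galpha R n) Jg [set` v] phi -> kproj v 0
  = 0.
  move=> _; apply: (orth_proj_eq (dot_galpha_inner R n) (vspace_projectable v)); first exact: mem0v.
  by move=> s0 _; rewrite subr0 dot_galphaC -(scale0r (0 : galpha)) J_galphaZ scale0r dot_galpha0r.
(* With [l = 0] only the last two products, those of e and f among themselves, are of interest. *)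
have [_ _ _ fe ff] := kahler_products angle ue (mem0v u) ee (z0 u e) (etrans (congr1 _ (k0 u
  angle)) (z0 u e)).
have [_ _ _ fe' ff'] := kahler_products angle' ue' (mem0v u') ee' (z0 u' e') (etrans (congr1 _
  (k0 u' angle')) (z0 u' e')).
have Jef : <|Jg e, f|> = cos phi ^+ 2 by rewrite -ff -(dot_kproj e (kproj_mem u e)).
have Jef' : <|Jg e', f'|> = cos phi ^+ 2 by rewrite -ff' -(dot_kproj e' (kproj_mem u' e')).
have C := @dot_galphaC R n; have CJ := @dot_galphaJC R n.
have gs' : same_gram s'.
  have sym p q : (<|p.1, q.1|> = <|p.2, q.2|> /\ <|Jg p.1, q.1|> = <|Jg p.2, q.2|>) ->
      (<|q.1, p.1|> = <|q.2, p.2|> /\ <|Jg q.1, p.1|> = <|Jg q.2, p.2|>).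
    by move=> [a b]; rewrite C (C q.2) CJ (CJ q.2) a b.
  have ee2 : <|e, e|> = <|e', e'|> /\ <|Jg e, e|> = <|Jg e', e'|> by rewrite ee ee' !dot_galphaJ.
  have ff2 : <|f, f|> = <|f', f'|> /\ <|Jg f, f|> = <|Jg f', f'|> by rewrite ff ff' !dot_galphaJ.
  have ef2 : <|e, f|> = <|e', f'|> /\ <|Jg e, f|> = <|Jg e', f'|>.
    by rewrite C fe C fe' Jef Jef'.
  have es p : p \in s -> <|e, p.1|> = <|e', p.2|> /\ <|Jg e, p.1|> = <|Jg e', p.2|>.
    by move=> sp; have [-> -> _ _] := A p sp; have [-> -> _ _] := A' p sp.
  have fs p : p \in s -> <|f, p.1|> = <|f', p.2|> /\ <|Jg f, p.1|> = <|Jg f', p.2|>.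
    by move=> sp; have [_ _ -> ->] := A p sp; have [_ _ -> ->] := A' p sp.
  move=> p q; rewrite !inE => /orP[/eqP ->|/orP[/eqP ->|sp]] /orP[/eqP ->|/orP[/eqP ->|sq]] //=.
  - exact: es.
  - exact: (sym (e, e') (f, f')).
  - exact: fs.
  - exact: (sym (e, e') p (es p sp)).
  - exact: (sym (f, f') p (fs p sp)).
  - exact: gs.
exists s'.
  split=> // p; rewrite !inE => /orP[/eqP ->|/orP[/eqP ->|sp]] /=.
  - by split=> //; apply: memv_span; rewrite /= !inE eqxx orbT.
  - split; [exact: kproj_mem|exact: kproj_mem| |].
      by rewrite (kprojK angle ue) memvN memvZ.
    by rewrite (kprojK angle' ue') memvN memvZ.
  - by have [a b c d] := ms p sp; split=> //; [exact: sub1|exact: sub2].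
rewrite (ltn_leqif (dimv_leqif_sup _)); last by apply/subvP.
apply/negP => /subvP /(_ e ke) h; have := el e h.
by rewrite ee => /eqP; rewrite oner_eq0.
Qed.

Lemma kahler_subspaces_unitary : exists U U', unitary_pair U U' /\
  forall x, x \in u <-> U x \in u'.
Proof.
have ex j : (j <= \dim u)%N -> exists2 s, kahler_list s & (j <= \dim (span [seq p.1 | p <- s]))%N.
  elim: j => [_|j IH lj]; first by exists [::].
  have [s hs js] := IH (ltnW lj).
  have [lt|ge] := ltnP (\dim (span [seq p.1 | p <- s])) (\dim u); last first.
    by exists s => //; exact: leq_trans ge.
  by have [s' hs' lt'] := kahler_list_extend hs lt; exists s' => //; exact: leq_ltn_trans lt'.
have [s hs ds] := ex _ (leqnn _).
have [U [U' [UP Us]]] := witt hs.1; have [dE mE] := unitary_span UP Us.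
have e1 : span [seq p.1 | p <- s] = u.
  by apply/eqP; rewrite eqEdim span_sub1.
have e2 : span [seq p.2 | p <- s] = u'.
  by apply/eqP; rewrite eqEdim span_sub2 //= -dimE -dE.
by exists U, U'; split=> // x; have := mE x; rewrite e1 e2.
Qed.

End KahlerSubspaces.

Import VectorInternalTheory.

(** * The submanifold W *)

Section ModelChart.
Variables (R : realType) (n : nat) (w : {vspace galpha R n}) (W : set (CH R n)).
Hypothesis WE : W = [set p | p.1.2 \in w].
Local Notation iota := (set_val : W -> CH R n).
Local Notation T := (R^o * subvs_of w * R^o)%type.
Local Notation m := (dim T).

(** In the chart W is a linear subspace, so a linear isomorphism from its coordinate space is a
    global parametrization. *)
Definition model_lin (v : 'rV[R]_m) : CH R n :=
  let t : T := r2v v in (t.1.1, vsval t.1.2, t.2).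

Lemma model_lin_linear : linear model_lin.
Proof.
move=> a x y; have e : r2v (a *: x + y) = a *: r2v x + r2v y :> T by rewrite linearP.
rewrite /model_lin e; apply: (congr2 pair (congr2 pair _ _) _); [by []| |by []].
exact: (linearP (@vsval _ _ w)).
Qed.

Lemma model_lin_mem v : (model_lin v).1.2 \in w.
Proof. exact: subvsP. Qed.

Lemma model_lin_inj : injective model_lin.
Proof.
move=> x y [e1 e2 e3]; apply: (@r2v_inj _ T).
move: e1 e2 e3; rewrite /=; case: (r2v x) (r2v y) => [[a s] b] [[a' s'] b'] /= -> e ->.
by congr (_, _, _); exact: val_inj.
Qed.

Lemma model_lin_surj p : p.1.2 \in w -> exists v, model_lin v = p.
Proof.
move=> wp; exists (v2r ((p.1.1, vsproj w p.1.2, p.2) : T)).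
by rewrite /model_lin v2rK /= vsprojK //; case: p {wp} => [[]].
Qed.

Lemma model_lin_cont : continuous model_lin.
Proof. exact: (linear_row_continuous model_lin_linear). Qed.

Lemma model_mem v : model_lin v \in W.
Proof. by rewrite inE WE; exact: model_lin_mem. Qed.

Definition model_chart (v : 'rV[R]_m) : W := SigSub (model_mem v).

Lemma model_chartE : iota \o model_chart = model_lin.
Proof. by []. Qed.

Lemma model_chart_surj (q : W) : exists v, model_chart v = q.
Proof.
have WS : W `<=` [set p | p.1.2 \in w] by rewrite WE.
have wq := WS _ (set_valP q).
by have [v hv] := model_lin_surj wq; exists v; exact: val_inj.
Qed.

Lemma model_derive x v : 'D_v (iota \o model_chart) x = model_lin v.
Proof.
rewrite model_chartE; apply: (@derive_affine _ _ _ _ model_lin) => h.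
by rewrite model_lin_linear addrK.
Qed.

Lemma model_param : local_param iota setT model_chart.
Proof.
have lc := model_lin_cont.
have sL : smooth_on setT model_lin.
  apply: (@smooth_on_lin _ _ _ _ _ model_lin id) => //; first exact: openT.
  + exact: model_lin_linear.
  + exact: smooth_on_id openT.
split; first exact: openT.
- by move=> x y _ _ e; apply: model_lin_inj; rewrite -!model_chartE /= e.
- by move=> x _; move: x; exact: (@continuous_comp_initial W _ _ set_val model_chart lc).
- move=> O' oO' _.
  have [k k0 hk] := injective_lower_bound model_lin_linear lc model_lin_inj.
  (* W carries the induced topology, so an ambient open set is required. A ball of radius r in O'
     gives the ambient ball of radius [k * r], since [model_lin] shrinks distances at most by k. *)
  exists (\bigcup_(i in [set i : R * 'rV[R]_m | 0 < i.1 /\ ball i.2 i.1 `<=` O'])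
    ((fun p : CH R n => `|p - model_lin i.2|) @^-1` [set s | s < k * i.1])).
    apply: bigcup_open => i _; apply: open_comp; last exact: open_lt.
    move=> p _; apply: (@cont_comp _ _ _ p (fun p : CH R n => p - model_lin i.2)); last exact:
      norm_continuous.
    have s : smooth_on setT (fun p : CH R n => p - model_lin i.2).
      apply: smooth_on_sub_fun; [exact: openT|exact: (smooth_on_id openT)|exact: smooth_on_cst].
    exact: (differentiable_continuous (smooth_on_diff s (I : setT p))).
  apply/seteqP; split=> [q [[r v] [/= r0 vO hp]]|_ [v vO <-]].
    have [v' hv'] := model_chart_surj q; exists v' => //; apply: vO.
    rewrite -ball_normE /ball_ /= -(ltr_pM2l k0); apply: le_lt_trans hp.
    apply: (le_trans (hk _)); rewrite -hv' distrC.
    rewrite -[v - v']addrC -scaleN1r model_lin_linear scaleN1r addrC distrC; exact: lexx.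
  have /nbhs_ballP[r /= r0 hr] : nbhs v O' by exact: open_nbhs_nbhs.
  by exists (r, v) => //=; rewrite subrr normr0 mulr_gt0.
- split; first exact: sL.
  move=> x _ a b; have dL := smooth_on_diff sL (I : setT x).
  rewrite -!deriveE // => e; apply: model_lin_inj.
  by rewrite -(model_derive x a) -(model_derive x b).
Qed.

Lemma model_submanifold : submanifold m iota.
Proof.
split=> [p q|q]; first exact: val_inj.
by have [v <-] := model_chart_surj q; exists setT, model_chart, v; split=> //; exact: model_param.
Qed.

Lemma model_tangent_space q : tangent iota q = [set v | v.1.2 \in w].
Proof.
have [x <-] := model_chart_surj q; rewrite (tangent_range model_param (I : setT x)).
apply/seteqP; split=> v.
  by move=> [u ->]; rewrite model_derive; exact: model_lin_mem.
by move=> /model_lin_surj[u <-]; exists u; rewrite model_derive.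
Qed.

End ModelChart.

Lemma lftN (R : realType) n (p x : CH R n) : lft p (- x) = - lft p x.
Proof. by rewrite -scaleN1r lftZ scaleN1r. Qed.

(** * The second fundamental form of W *)

Section ModelGeometry.
Variables (R : realType) (n : nat) (w wperp : {vspace galpha R n}) (W : set (CH R n)).
Variable phi : R.
Hypothesis WE : W = [set p | p.1.2 \in w].
Hypothesis perpP : forall u, u \in wperp <-> forall v, v \in w -> dot_galpha u v = 0.
Hypothesis cphi : 0 <= cos phi.
Hypothesis angle : const_kahler_angle (@dot_galpha R n) (@J_galpha R n) [set` wperp] phi.
Local Notation iota := (set_val : W -> CH R n).
Local Notation g := (@metric R n).
Local Notation J := (@J_an R n).
Local Notation Jg := (@J_galpha R n).
Local Notation "<< x , y >>" := (dot_an x y).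
Local Notation "<| u , v |>" := (dot_galpha u v).
Local Notation m := (dim (R^o * subvs_of w * R^o)%type).
Local Notation T := (tangent iota).
Local Notation Pp := (orth_proj (@dot_galpha R n) [set` wperp]).
Local Notation nu q := (orth (g (iota q)) (T q)).

Definition horizontal (u : galpha R n) : CH R n := (0, u, 0).

Lemma dot_horizontal u (x : CH R n) : << horizontal u, x >> = <|u, x.1.2|>.
Proof. by rewrite /dot_an /horizontal /= !mul0r add0r addr0. Qed.

Lemma model_tangentP (q : W) v : T q v <-> (mct (iota q) v).1.2 \in w.
Proof.
rewrite (model_tangent_space WE) mct.unlock /=; split; first exact: memvZ.
move=> /(memvZ (expR ((iota q).1.1 / 2))); rewrite scalerA -expRD mulNr addrN expR0 scale1r.
by [].
Qed.

Lemma model_tangent_lft (q : W) x : T q (lft (iota q) x) <-> x.1.2 \in w.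
Proof. by rewrite model_tangentP lftK. Qed.

Lemma model_tangent_projectable (q : W) : projectable (g (iota q)) (T q).
Proof. exact: (tangent_projectable_at (model_submanifold WE)). Qed.

(** The translated tangent spaces of W contain B and [Z_0], so normal vectors have only a g_alpha
    part. *)
Lemma model_normalE (q : W) xi : orth (g (iota q)) (T q) xi <->
  exists2 u, u \in wperp & mct (iota q) xi = horizontal u.
Proof.
split=> [h|[u wu e] s /model_tangentP ws]; last first.
  by rewrite metricE e dot_horizontal; have /perpP -> := wu.
have h' x : x.1.2 \in w -> << mct (iota q) xi, x >> = 0.
  move=> wx; have := h (lft (iota q) x); rewrite metricE lftK; apply.
  exact/model_tangent_lft.
have a0 := h' (1, 0, 0) (mem0v _); have b0 := h' (0, 0, 1) (mem0v _).
exists (mct (iota q) xi).1.2.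
  by apply/perpP => v wv; have := h' (horizontal v) wv; rewrite dot_anC dot_horizontal dot_galphaC.
move: a0 b0; case: (mct (iota q) xi) => [[a u] b].
rewrite /dot_an /= !mulr0 !mulr1 dot_galpha0r !addr0 !add0r => -> ->.
by [].
Qed.

Lemma model_normal_proj (q : W) x :
  orth_proj (g (iota q)) (nu q) (lft (iota q) x) = lft (iota q) (horizontal (Pp x.1.2)).
Proof.
have NP := orth_projectable (metric_inner (iota q)) (model_tangent_projectable q).
have PP := vspace_projectable wperp.
apply: (orth_proj_eq (metric_inner (iota q)) NP).
  by apply/model_normalE; exists (Pp x.1.2); rewrite ?lftK //; exact: (orth_projS PP).
move=> s /model_normalE[u wu e].
have h := orth_proj_orth PP x.1.2 wu.
rewrite (ipDl (metric_inner _)) (ipNl (metric_inner _)) !metricE !lftK e.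
by rewrite !(dot_anC _ (horizontal u)) !dot_horizontal /= -h dot_galphaDl dot_galphaNl
  !(dot_galphaC u).
Qed.

Lemma model_tangential_J (q : W) xi u : mct (iota q) xi = horizontal u ->
  mct (iota q) (tangential_J g (@cplx R n) iota q xi) = horizontal (Jg u - Pp (Jg u)).
Proof.
move=> e; rewrite /tangential_J cplxE e.
have TP := model_tangent_projectable q.
have := orth_proj_compl (metric_inner (iota q)) (lft (iota q) (J (horizontal u))) TP.
rewrite model_normal_proj => h.
have -> : orth_proj (g (iota q)) (T q) (lft (iota q) (J (horizontal u))) =
  lft (iota q) (J (horizontal u)) - lft (iota q) (horizontal (Pp (J (horizontal u)).1.2)).
  by rewrite h opprB addrC subrK.
rewrite -lftN -lftD lftK /J_an /horizontal; by congr (_, _, _); rewrite /= ?oppr0 ?addr0 ?subr0.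
Qed.

Lemma model_const_kahler : const_kahler_normal g (@cplx R n) iota phi.
Proof.
move=> q; rewrite normal_orth => v Nv v0; have [u wu e] := (model_normalE q v).1 Nv.
rewrite cplxE e model_normal_proj /ip_norm !metricE lftK e !dot_horizontal /=.
apply: angle => //; apply: contra v0 => /eqP u0; rewrite u0 in e.
by apply/eqP; apply: (@mct_inj _ _ (iota q)); rewrite mct0 e.
Qed.

Definition model_Z (q : W) : CH R n := lft (iota q) (center_vec R n).

Lemma model_unit_field : unit_complex_field m g (@cplx R n) iota model_Z.
Proof.
split.
- move=> q _; have [x <-] := model_chart_surj WE q.
  exists setT, (model_chart WE), x; split=> //; first exact: model_param.
  rewrite /model_Z; apply: (@smooth_lft R n _ setT openT (iota \o model_chart WE) (fun=>
    center_vec R n)).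
    exact: (param_smooth (model_param WE)).
  exact: smooth_on_cst.
- move=> q; split; first by apply/model_tangent_lft; exact: mem0v.
  exists (lft (iota q) (1, 0, 0)); first by apply/model_tangent_lft; exact: mem0v.
  by rewrite cplxE lftK /J_an /= oppr0; congr lft; congr (_, _, _); rewrite /J_galpha /= oppr0.
- by move=> q; rewrite metricE lftK dot_an_center.
Qed.

Lemma model_proj_w u : u \in w -> Pp u = 0.
Proof.
move=> wu; apply: (orth_proj_eq (dot_galpha_inner R n) (vspace_projectable wperp)); first exact:
  mem0v.
by move=> s /perpP hs; rewrite subr0 dot_galphaC; exact: hs.
Qed.

Definition model_II (q : W) (v y : CH R n) : CH R n :=
  orth_proj (g (iota q)) (nu q)
    (lft (iota q) (lc (mct (iota q) v) (mct (iota q) y))).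

(** The trivialization of a tangent field has its g_alpha part in the fixed subspace w, and so has
    its derivative. Hence only the [lc] term of the covariant derivative has a normal part, which is
    why [model_II] consists of it. *)
Lemma model_II_secondff : is_second_ff m g iota model_II.
Proof.
move=> U Y oU sY TY q c v a Uq [c0 cc dc] da.
have NP := orth_projectable (metric_inner (iota q)) (model_tangent_projectable q).
rewrite /model_II christoffelE.
pose YY (t : R^o) := mct (iota (c t)) (Y (c t)).
have d1 : differentiable (iota \o c) 0 by apply/derivable1_diffP; case: dc.
have d2 : differentiable (Y \o c) 0 by apply/derivable1_diffP; case: da.
have [dY eY] := @derive_mc R n R^o (iota \o c) (Y \o c) 0 1 d1 d2.
have ev : 'D_1 (iota \o c) 0 = v by case: dc.
have ea : 'D_1 (Y \o c) 0 = a by case: da.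
have wa : (dmc (mct (iota q) v) (mct (iota q) (Y q)) + mct (iota q) a).1.2 \in w.
  have eY' : 'D_1 YY 0 = dmc (mct (iota q) v) (mct (iota q) (Y q)) + mct (iota q) a.
    by apply: (etrans eY); rewrite ev ea /= c0.
  rewrite -eY'; apply: vspace_orth => l hl.
  have [d3 e3] := derive_u (1 : R^o) dY.
  have lL : linear (fun u : galpha R n => <|l, u|>).
    by move=> b x y; rewrite dot_galphaDr dot_galphaZr.
  have cL : continuous (fun u : galpha R n => <|l, u|>).
    by move=> u; apply: cont_dot; [exact: cst_continuous|exact: cvg_id].
  have [d4 e4] := derive_lin (1 : R^o) lL cL d3.
  apply: (etrans (esym (congr1 (fun u => <|l, u|>) e3))); apply: (etrans (esym e4)).
  apply: (etrans _ (derive_cst (0 : R) (0 : R^o) (1 : R^o))).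
  apply: near_eq_derive.
  have nU : nbhs (c 0) U by rewrite c0; exact: open_nbhs_nbhs.
  have nU0 : nbhs (0 : R^o) (c @^-1` U) := cc U nU.
  apply: (@filterS _ _ (nbhs_filter (0 : R^o)) _ _ _ nU0) => t Ut.
  apply: hl; apply/model_tangentP; exact: TY.
set x := mct (iota q) v in wa *; set y := mct (iota q) (Y q) in wa *.
have e : a + lft (iota q) (dmc x y + lc x y) =
    lft (iota q) (dmc x y + mct (iota q) a) + lft (iota q) (lc x y).
  by rewrite !lftD mctK addrA (addrC a).
have z : orth_proj (g (iota q)) (nu q) (lft (iota q) (dmc x y + mct (iota q) a)) = 0.
  rewrite model_normal_proj model_proj_w //.
  by apply: (@mct_inj _ _ (iota q)); rewrite lftK mct0.
apply: esym; apply: (etrans (congr1 (orth_proj _ _) e)).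
apply: (etrans (orth_projD (metric_inner _) NP _ _)).
apply: (etrans (congr1 (fun t => t + _) z)); exact: add0r.
Qed.

(** [J J u] contributes -1 and [(P J)^2] contributes [cos^2 phi]. *)
Lemma model_proj_J u : u \in wperp ->
  Pp (Jg (Jg u - Pp (Jg u))) = - (sin phi ^+ 2 *: u).
Proof.
move=> wu; have /(const_kahler_angleP (dot_galpha_inner R n) (@J_galpha_linear R n)
  (@dot_galphaJC R n) (vspace_projectable wperp) cphi) h := angle.
have PI := dot_galpha_inner R n; have PP := vspace_projectable wperp.
rewrite J_galphaD J_galphaK J_galphaN (orth_projD PI PP) (orth_projN PI PP).
rewrite (orth_projN PI PP) (h u wu) opprK (orth_proj_id PI PP wu).
by rewrite -{1}(scale1r u) -(cos2Dsin2 phi) scalerDl opprD addrAC addNr add0r.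
Qed.

Lemma model_proj_compl u : u - Pp u \in w.
Proof.
apply: vspace_orth => l /perpP wl; rewrite dot_galphaC.
exact: (orth_proj_orth (vspace_projectable wperp)).
Qed.

(** Of the three terms of [lc] in g_alpha the first is tangent; the other two contain J and are
    evaluated by [model_proj_J]. *)
Lemma model_proj_lc (X Y : CH R n) (x y : R) (u v a b : galpha R n) :
  u \in wperp -> v \in wperp -> a \in w -> b \in w -> Jg a \in w -> Jg b \in w ->
  X.2 = x -> Y.2 = y -> X.1.2 = a + (Jg u - Pp (Jg u)) -> Y.1.2 = b + (Jg v - Pp (Jg v)) ->
  Pp (lc X Y).1.2 = (2^-1 * sin phi ^+ 2) *: (y *: u + x *: v).
Proof.
move=> wu wv wa wb wJa wJb X2 Y2 X1 Y1.
have PI := dot_galpha_inner R n; have PP := vspace_projectable wperp.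
have PD := orth_projD PI PP; have PZ := orth_projZ PI PP; have PN := orth_projN PI PP.
have e1 : Pp (a + (Jg u - Pp (Jg u))) = 0.
  by apply: model_proj_w; rewrite memvD // model_proj_compl.
have e2 : Pp (Jg (a + (Jg u - Pp (Jg u)))) = - (sin phi ^+ 2 *: u).
  by rewrite J_galphaD PD model_proj_J // model_proj_w // add0r.
have e3 : Pp (Jg (b + (Jg v - Pp (Jg v)))) = - (sin phi ^+ 2 *: v).
  by rewrite J_galphaD PD model_proj_J // model_proj_w // add0r.
have -> : (lc X Y).1.2 = - (2^-1 *: (Y.1.1 *: X.1.2 + Y.2 *: Jg X.1.2 + X.2 *: Jg Y.1.2)) by [].
rewrite -X1 in e1 e2; rewrite -Y1 in e3.
move: PD PZ PN e1 e2 e3; move: Pp (Jg X.1.2) (Jg Y.1.2) X.1.2 Y.1.1 => P a' b' c r PD PZ PN e1 e2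
  e3.
rewrite X2 Y2 PN PZ PD PD !PZ e1 e2 e3 scaler0 add0r !scalerN -opprD scalerN opprK.
by rewrite !scalerDr !scalerA; congr (_ *: _ + _ *: _); ring.
Qed.

Lemma model_trivial_extension : trivial_extension g (@cplx R n) iota phi model_Z model_II.
Proof.
move=> q x y U V' xi eta [TU [U1 TU1 eU]] UZ [TV [V1 TV1 eV]] VZ.
rewrite normal_orth => Nxi Neta.
have [u wu exi] := (model_normalE q xi).1 Nxi.
have [v wv eeta] := (model_normalE q eta).1 Neta.
have mJ A A1 : T q A1 -> cplx (iota q) A1 = A -> T q A ->
    (mct (iota q) A).1.2 \in w /\ Jg (mct (iota q) A).1.2 \in w.
  move=> /model_tangentP w1 eA /model_tangentP wA; split=> //.
  by rewrite -eA mct_cplx /J_an /= J_galphaK memvN.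
have [w1 w2] := mJ _ _ TU1 eU TU; have [w3 w4] := mJ _ _ TV1 eV TV.
have z2 A : g (iota q) A (model_Z q) = 0 -> (mct (iota q) A).2 = 0.
  by rewrite metricE lftK /dot_an /= dot_galpha0r !mulr0 mulr1 !add0r.
have E r A z t : mct (iota q) z = horizontal t -> (mct (iota q) A).2 = 0 ->
    [/\ (mct (iota q) (r *: model_Z q + A + tangential_J g (@cplx R n) iota q z)).2 = r &
     (mct (iota q) (r *: model_Z q + A + tangential_J g (@cplx R n) iota q z)).1.2 =
     (mct (iota q) A).1.2 + (Jg t - Pp (Jg t))].
  move=> ez A2; rewrite mctD mctD mctZ lftK (model_tangential_J ez).
  move: (mct (iota q) A) A2 (Jg t - _) => [[a1 a2] a3] /= -> p.
  by rewrite scaler0 add0r /GRing.scale /= mulr1 !addr0.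
have [E1 E2] := E x U xi u exi (z2 U UZ); have [E3 E4] := E y V' eta v eeta (z2 V' VZ).
rewrite /model_II model_normal_proj (model_proj_lc wu wv w1 w3 w2 w4 E1 E3 E2 E4).
rewrite -[xi](mctK (iota q)) -[eta](mctK (iota q)) exi eeta -!lftZ -lftD -lftZ; congr lft.
by rewrite /horizontal; congr (_, _, _); rewrite /= ?scaler0 ?addr0 ?scaler0.
Qed.

End ModelGeometry.

(** * Congruence *)

Section OpenPart.
Variables (R : realType) (n m : nat) (M : topologicalType) (iota : M -> CH R n).
Hypothesis subM : submanifold m iota.
Variables (f : CH R n -> CH R n) (w : {vspace galpha R n}).
Hypothesis fiso : an_isometry f.
Hypothesis f_mem : forall q, (f (iota q)).1.2 \in w.
Hypothesis f_tangent : forall q, model_tangent iota f q = [set x | x.1.2 \in w].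

(** After shrinking the chart into A, the composite with f is an injective map into W whose
    differential is onto the tangent space of W, as [local_surj] requires. *)
Lemma open_part_local A q : open A -> A q -> exists U : set (CH R n),
  [/\ open U, U (f (iota q)) & forall p, U p -> p.1.2 \in w -> ((f \o iota) @` A) p].
Proof.
move=> oA Aq; case: (chart subM q) => D [h [x [hO Dx hx]]].
have oD := param_open hO; case: (hO) => _ hinj hc _ _.
have sF := param_smooth hO; have [sf _] := isometryP fiso.
pose D' := [set y | D y /\ A (h y)].
have D'x : D' x by rewrite /D' /= hx.
have D'D : D' `<=` D by move=> y [].
have oD' : open D'.
  rewrite openE => y [Dy Ay].
  have n1 : nbhs y D by exact: open_nbhs_nbhs.
  have n2 : nbhs y (h @^-1` A) by apply: (hc y Dy); exact: open_nbhs_nbhs.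
  exact: (@filterI _ _ (nbhs_filter y) _ _ n1 n2).
pose G y := f (iota (h y)).
have sG : smooth_on D' G := smooth_on_sub D'D (sf _ _ _ oD sF).
have Ginj y z : D' y -> D' z -> G y = G z -> y = z.
  move=> [Dy _] [Dz _] e; apply: hinj => //; case: subM => ii _; apply: ii.
  by have [f' [_ _ ff' _ _]] := fiso; exact: (can_inj ff').
have Gw y : D' y -> (G y).1.2 \in w by move=> _; exact: f_mem.
have Gs y e : D' y -> e.1.2 \in w -> exists v, e = 'D_v G y.
  move=> [Dy _] we.
  have : model_tangent iota f (h y) (mct (G y) e).
    rewrite f_tangent mct.unlock /=; exact: memvZ.
  rewrite (model_tangentE fiso hO Dy) => -[v hv]; exists v.
  exact: (mct_inj hv).
have [U [oU Ux hU]] := local_surj oD' sG D'x Ginj Gw Gs.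
exists U; split=> //; first by rewrite -hx.
by move=> p Up wp; have [y [Dy Ay] ->] := hU p Up wp; exists (h y).
Qed.

Lemma open_part : congruent_to_open_part (@metric R n) (@cplx R n) iota (W_sub w).
Proof.
exists f; split; first exact: an_isometry_holomorphic.
move=> A oA.
pose B := \bigcup_(U in [set U : set (CH R n) | open U /\
  forall p, U p -> p.1.2 \in w -> ((f \o iota) @` A) p]) U.
exists B; split; first by apply: bigcup_open => U [].
apply/seteqP; split=> [_ [q Aq <-]|p [[U [oU hU] Up]]].
  split; last by rewrite W_subE; exact: f_mem.
  by have [U [oU Uq hU]] := open_part_local oA Aq; exists U.
by rewrite W_subE => /= wp; exact: hU.
Qed.

End OpenPart.

Lemma inj_onto (K : fieldType) (vT wT : vectType K) (f : vT -> wT) : linear f ->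
  injective f -> (dim wT <= dim vT)%N -> forall y, exists x, f x = y.
Proof.
move=> lf sf d; pose f' : {linear vT -> wT} := HB.pack f (GRing.isLinear.Build _ _ _ _ _ lf).
pose L := linfun f'.
have k0 : lker L = 0%VS by apply/eqP/lker0P => x y; rewrite !lfunE; exact: sf.
have e : (L @: fullv)%VS = fullv.
  apply/eqP; rewrite eqEdim subvf /=; have := limg_ker_dim L fullv.
  by rewrite capfv k0 dimv0 add0n => ->; rewrite !dimvf.
move=> y; have : y \in (L @: fullv)%VS by rewrite e memvf.
by move=> /memv_imgP[x _ ->]; exists x; rewrite lfunE.
Qed.

(** * Codimension zero *)

Section FullDimension.
Variables (R : realType) (n : nat) (M : topologicalType) (iota : M -> CH R n).
Hypotheses (n0 : (0 < n)%N) (subM : submanifold (2 * n) iota).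

Lemma full_tangent q v : tangent iota q v.
Proof.
case: (chart subM q) => D [h [x [hO Dx <-]]]; rewrite (tangent_range hO Dx).
have dF := smooth_on_diff (param_smooth hO) Dx; case: hO => _ _ _ _ [_ iF].
pose f (u : 'rV[R]_(2 * n)) : (R^o * galpha R n * R^o)%type := 'd (iota \o h) x u.
have [||u <-] := @inj_onto _ _ _ f _ (iF x Dx) _ v.
- by move=> a y z; rewrite /f linearP.
- by rewrite dim_CH // /dim /= mul1n.
by exists u; rewrite deriveE.
Qed.

Lemma full_open_part (w : {vspace galpha R n}) : (forall u, u \in w) ->
  congruent_to_open_part (@metric R n) (@cplx R n) iota (W_sub w).
Proof.
move=> wT; apply: (open_part subM (@an_isometry_id R n)) => [q|q]; first exact: wT.
apply/seteqP; split=> x _; first exact: wT.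
exists (lft (iota q) x); split; first exact: full_tangent.
rewrite /triv_diff lftK; apply: esym.
by apply: (etrans (congr1 (mct (iota q)) (derive_id _ _))); rewrite lftK.
Qed.

End FullDimension.

Section Complement.
Variables (R : realType) (n : nat) (w : {vspace galpha R n}).
Local Notation "<| u , v |>" := (dot_galpha u v).
Local Notation P := (orth_proj (@dot_galpha R n) [set` w]).

Lemma perp_exists : exists wperp : {vspace galpha R n},
  (forall u, u \in wperp <-> forall v, v \in w -> <|u, v|> = 0) /\
  (\dim wperp + \dim w)%N = (2 * n.-1)%N.
Proof.
have PI := dot_galpha_inner R n; have PP := vspace_projectable w.
have lP : linear P by move=> a x y; exact: (orth_proj_lin PI PP).
pose P' : {linear galpha R n -> galpha R n} := HB.pack P (GRing.isLinear.Build _ _ _ _ _ lP).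
pose L := linfun P'; have LE x : L x = P x by rewrite lfunE.
exists (lker L); split=> [u|].
  rewrite memv_ker LE; split=> [/eqP e v wv|h].
    by have := orth_proj_orth PP u wv; rewrite e subr0.
  by apply/eqP; apply: (orth_proj_eq PI PP); [exact: mem0v|move=> s ws; rewrite subr0; exact: h].
have <- : (L @: fullv)%VS = w.
  apply/eqP; rewrite eqEsubv; apply/andP; split; apply/subvP => x.
    by move=> /memv_imgP[y _ ->]; rewrite LE; exact: (orth_projS PP).
  by move=> wx; rewrite -(orth_proj_id PI PP wx) -LE memv_img // memvf.
have := limg_ker_dim L fullv; rewrite capfv => ->.
have -> : \dim {:galpha R n} = (1 * n.-1 + 1 * n.-1)%N by rewrite dimvf.
by rewrite !mul1n mul2n addnn.
Qed.

End Complement.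

Lemma triv_diff_extend (R : realType) n (U : galpha R n -> galpha R n) q x :
  unitary_galpha U -> triv_diff (extend_galpha U) q x = extend_galpha U x.
Proof.
move=> [lU dU JU]; rewrite /triv_diff.
have UZ a u : U (a *: u) = a *: U u.
  have U0 : U 0 = 0 by have := lU (-1) 0 0; rewrite scaler0 addr0 scaleN1r addNr.
  by have := lU a u 0; rewrite U0 !addr0.
have -> : 'D_(lft q x) (extend_galpha U) q = extend_galpha U (lft q x).
  apply: (@derive_affine _ _ _ _ (extend_galpha U)) => h.
  rewrite /extend_galpha; congr (_, _, _) => /=; rewrite ?addrK //.
  by rewrite lU addrK.
have -> : extend_galpha U (lft q x) = lft (extend_galpha U q) (extend_galpha U x).
  by rewrite lft.unlock /extend_galpha /= UZ -JU dU.
by rewrite lftK.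
Qed.

Lemma vsproj_triple_inj (R : realType) n (V : {vspace galpha R n}) (x y : CH R n) :
  x.1.2 \in V -> y.1.2 \in V ->
  (x.1.1, vsproj V x.1.2, x.2) = (y.1.1, vsproj V y.1.2, y.2) -> x = y.
Proof.
case: x y => [[a u] b] [[a' u'] b'] /= Vu Vu' [-> e ->].
by congr (_, _, _); rewrite -(vsprojK Vu) -(vsprojK Vu') e.
Qed.

Section Congruence.
Variables (R : realType) (n m : nat) (M : topologicalType) (iota : M -> CH R n).
Variables (phi : R) (Z : M -> CH R n) (II : M -> CH R n -> CH R n -> CH R n).
Hypotheses (sphi : sin phi != 0) (cphi : 0 <= cos phi).
Local Notation J := (@J_an R n).
Local Notation "<< x , y >>" := (dot_an x y).
Local Notation "<| u , v |>" := (dot_galpha u v).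
Local Notation g := (@metric R n).
Local Notation Jg := (@J_galpha R n).
Hypothesis subM : submanifold m iota.
Hypotheses (n0 : (0 < n)%N) (mn : (m < 2 * n)%N) (cM : connected [set: M]).
Hypothesis angle : const_kahler_normal g (@cplx R n) iota phi.
Hypothesis ZF : unit_complex_field m g (@cplx R n) iota Z.
Hypothesis IIP : is_second_ff m g iota II.
Hypothesis IIZ : trivial_extension g (@cplx R n) iota phi Z II.
Variable q0 : M.

Section WithIsometry.
Variable f : CH R n -> CH R n.
Hypothesis fiso : an_isometry f.
Hypothesis zc : forall q, triv_diff f (iota q) (mct (iota q) (Z q)) = center_vec R n.
Local Notation A := (triv_diff f).
Local Notation T' := (model_tangent iota f).

Lemma model_tangent_lin q a x y : T' q x -> T' q y -> T' q (a *: x + y).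
Proof.
case: (chart subM q) => D [h [p [hO Dp <-]]].
have [sf _] := isometryP fiso.
have sG := sf _ _ _ (param_open hO) (param_smooth hO).
rewrite (model_tangentE fiso hO Dp); exact: (tangent_frame_lin sG).
Qed.

Lemma model_tangent_Z q : T' q (center_vec R n).
Proof. by have [_ ZC _] := ZF; exists (Z q); split; [case: (ZC q)|rewrite zc]. Qed.

Lemma model_tangent_JZ q : T' q (J (center_vec R n)).
Proof.
have [_ ZC _] := ZF; exists (cplx (iota q) (Z q)).
split; last by rewrite mct_cplx (triv_diff_JE fiso) zc.
case: (chart subM q) => D [h [p [hO Dp <-]]]; exact: (z_cplx_tangent hO ZC Dp).
Qed.

(** The translated tangent space contains [Z_0] and [J Z_0 = - B], so it is determined by its
    projection V to g_alpha and exceeds V by two dimensions. *)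
Lemma model_vspace q : exists V : {vspace galpha R n},
  [/\ forall x, T' q x <-> x.1.2 \in V & m = (\dim V).+2].
Proof.
case: (chart subM q) => D [h [p [hO Dp hp]]].
have [sf _] := isometryP fiso.
have sG := sf _ _ _ (param_open hO) (param_smooth hO).
have E := model_tangentE fiso hO Dp; rewrite hp in E.
pose X v := frame (fun p => f ((iota \o h) p)) v p.
have lX : linear X := frame_linear sG Dp.
have iX : injective X := model_frame_inj fiso hO Dp.
pose Xu v : galpha R n := (X v).1.2.
have lXu : linear Xu by move=> a v w; rewrite /Xu lX.
pose L : {linear 'rV[R]_m -> galpha R n} := HB.pack Xu (GRing.isLinear.Build _ _ _ _ _ lXu).
pose V := (linfun L @: fullv)%VS.
have VP x : T' q x <-> x.1.2 \in V.
  rewrite E; split=> [[v ->]|/memv_imgP[v _]].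
    by have -> : (frame (fun p => f ((iota \o h) p)) v p).1.2 = linfun L v; [rewrite
      lfunE|rewrite memv_img // memvf].
  rewrite lfunE /= => e.
  have Tv : T' q (X v) by rewrite E; exists v.
  rewrite -E; have Z1 := model_tangent_Z q; have Z2 := model_tangent_JZ q.
  have T0 : T' q 0 by have := model_tangent_lin (-1) Z1 Z1; rewrite scaleN1r addNr.
  (* Multiples of [Z_0] and [J Z_0] adjust the two outer coordinates of [X v] to those of x; as
     [J Z_0 = - B], the second coefficient has the opposite sign. *)
  have T1 := model_tangent_lin (x.2 - (X v).2) Z1 (model_tangent_lin ((X v).1.1 - x.1.1) Z2 Tv).
  apply: (eq_ind _ (T' q) T1).
  move: e; rewrite /Xu; case: x (X v) {Tv T1} => [[a u] b] [[a' u'] b'] /= ->.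
  rewrite /center_vec /J_an /=; congr (_, _, _) => /=.
  - by rewrite /GRing.scale /=; ring.
  - by rewrite (_ : J_galpha 0 = 0) ?scaler0 ?add0r //; congr (_, _); rewrite /= oppr0.
  - by rewrite /GRing.scale /=; ring.
exists V; split; first exact: VP.
pose Y v : (R^o * subvs_of V * R^o)%type := ((X v).1.1, vsproj V (X v).1.2, (X v).2).
have memV v : (X v).1.2 \in V by apply/VP; rewrite E; exists v.
have lY : linear Y.
  move=> a v w; rewrite /Y lX; apply: (congr2 pair (congr2 pair _ _) _); [by []| |by []].
  exact: (linearP (vsproj V)).
have iY : injective Y.
  by move=> v w e; apply: iX; exact: (vsproj_triple_inj (memV v) (memV w) e).
have d1 := inj_dim lY iY.
have sY y : exists v, Y v = y.
  case: y => [[a u] b]; have : T' q (a, vsval u, b) by apply/VP; exact: subvsP.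
  rewrite E => -[v hv]; exists v; rewrite /Y /X -hv /=.
  by apply: (congr2 pair (congr2 pair _ _) _) => //; exact: vsvalK.
have d2 := surj_dim lY sY.
have e : dim (R^o * subvs_of V * R^o)%type = (\dim V).+2.
  by rewrite -[LHS]/(1 + \dim V + 1)%N add1n addn1.
have e' : dim 'rV[R]_m = m by rewrite /dim /= mul1n.
by rewrite e e' in d1 d2; apply/eqP; rewrite eqn_leq d1 d2.
Qed.

(** Annihilators propagate from q0 to q and from q to q0, so both subspaces have the same
    annihilator. It also sees no change of the g_alpha coordinate along M. *)
Lemma model_tangent_constant (V : {vspace galpha R n}) :
  (forall x, T' q0 x <-> x.1.2 \in V) ->
  (forall q, T' q = [set x | x.1.2 \in V]) /\
  forall q, (f (iota q)).1.2 - (f (iota q0)).1.2 \in V.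
Proof.
move=> V0; have ND l q := @normal_direction_constant _ _ _ _ _ _ _ _ sphi cphi subM cM angle ZF
  IIP IIZ f fiso zc l q.
split=> q.
  have [W [WP _]] := model_vspace q.
  suff -> : V = W by apply/seteqP; split=> x; [move/WP|move=> h; apply/WP].
  apply/vspaceP => u; apply/idP/idP => hu; apply: vspace_orth => l hl.
    have h x : T' q x -> <|l, x.1.2|> = 0 by move=> /WP; exact: hl.
    by have [h' _] := ND l q h q0; apply: (h' (horizontal u)); apply/V0.
  have h x : T' q0 x -> <|l, x.1.2|> = 0 by move=> /V0; exact: hl.
  by have [h' _] := ND l q0 h q; apply: (h' (horizontal u)); apply/WP.
apply: vspace_orth => l hl.
have h x : T' q0 x -> <|l, x.1.2|> = 0 by move=> /V0; exact: hl.
have [_ e] := ND l q0 h q.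
by rewrite dot_galphaDr -scaleN1r dot_galphaZr mulN1r e subrr.
Qed.

(* The differential of [f] carries the normal space of M onto [wperp]. *)
Lemma model_angle (V wperp : {vspace galpha R n}) :
  (forall x, T' q0 x <-> x.1.2 \in V) ->
  (forall u, u \in wperp <-> forall v, v \in V -> <|u, v|> = 0) ->
  const_kahler_angle (@dot_galpha R n) Jg [set` wperp] phi.
Proof.
move=> VP pP u wu u0; set c := iota q0.
have PI := dot_galpha_inner R n; have PP := vspace_projectable wperp.
have gP := metric_inner c; have TP := tangent_projectable_at subM q0.
have NP := orth_projectable gP TP.
have [k [ik fk kf]] := an_isometry_inv fiso.
have AK y : exists x, A c (mct c x) = y.
  by have [x hx] := an_isometry_surj c y fiso; exists (lft c x); rewrite lftK.
have gE x y : g c x y = << A c (mct c x), A c (mct c y) >>.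
  by rewrite (triv_diff_dotE fiso) metricE.
have NE x : orth (g c) (tangent iota q0) x <-> exists2 v, v \in wperp & A c (mct c x) =
  horizontal v.
  split=> [h|[v wv e] s Ts].
    have h' y : y.1.2 \in V -> << A c (mct c x), y >> = 0.
      move=> /VP[s [Ts ->]]; rewrite (triv_diff_dotE fiso) -metricE; exact: h.
    have a0 := h' (1, 0, 0) (mem0v _); have b0 := h' (0, 0, 1) (mem0v _).
    exists (A c (mct c x)).1.2.
      by apply/pP => v Vv; have := h' (horizontal v) Vv; rewrite dot_anC dot_horizontal dot_galphaC.
    move: a0 b0; case: (A c (mct c x)) => [[a v] b].
    rewrite /dot_an /= !mulr0 !mulr1 dot_galpha0r !addr0 !add0r => -> ->.
    by [].
  rewrite metricE -(triv_diff_dotE fiso c) e dot_horizontal; move/pP: wv; apply.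
  by apply/VP; exists s.
have [xi hxi] := AK (horizontal u).
have Nxi : orth (g c) (tangent iota q0) xi by apply/NE; exists u.
have xi0 : xi != 0.
  apply: contra u0 => /eqP e; move: hxi; rewrite e mct0 (triv_diff0 fiso) => h.
  by apply/eqP; have := congr1 (fun x : CH R n => x.1.2) h.
have := const_kahler_normal_orth angle Nxi xi0; rewrite /ip_norm.
set P1 := orth_proj (g c) _ _; set P2 := orth_proj _ _ _.
have NP1 : orth (g c) (tangent iota q0) P1 := orth_projS NP _.
have [v wv hv] := (NE P1).1 NP1.
have e2 : P2 = v.
  apply: (orth_proj_eq PI PP) => // s ws.
  have [y hy] := AK (horizontal s).
  have Ny : orth (g c) (tangent iota q0) y by apply/NE; exists s.
  have h0 : g c (cplx c xi - P1) y = 0 := orth_proj_orth NP (cplx c xi) Ny.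
  have a1 : g c (cplx c xi) y = <|Jg u, s|>.
    apply: (etrans (gE _ _)); rewrite hy mct_cplx (triv_diff_JE fiso) hxi.
    by rewrite dot_anC dot_horizontal dot_galphaC.
  have a2 : g c P1 y = <|v, s|>.
    by apply: (etrans (gE _ _)); rewrite hy hv dot_horizontal.
  have h1 : g c (cplx c xi) y - g c P1 y = 0.
    by apply: (etrans _ h0); apply: esym; apply: (etrans (ipDl gP _ _ _)); congr (_ + _); exact:
      (ipNl gP).
  by rewrite dot_galphaDl dot_galphaNl -a1 -a2.
have b1 : g c P1 P1 = <|v, v|>.
  by apply: (etrans (gE _ _)); rewrite hv dot_horizontal.
have b2 : g c xi xi = <|u, u|>.
  by apply: (etrans (gE _ _)); rewrite hxi dot_horizontal.
by rewrite e2 b1 b2.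
Qed.

End WithIsometry.

Lemma center_isometry : exists f, an_isometry f /\
  forall q, triv_diff f (iota q) (mct (iota q) (Z q)) = center_vec R n.
Proof.
have [_ _ ZZ] := ZF.
have [|f [fi f0]] := @an_isometry_center R n (iota q0) (mct (iota q0) (Z q0)).
  by rewrite -metricE; exact: ZZ.
exists f; split; first exact: fi.
exact: (center_constant sphi cphi subM n0 mn cM angle ZF IIP IIZ fi f0).
Qed.

Lemma perp_eq (w wp : {vspace galpha R n}) :
  (forall u, u \in wp <-> forall v, v \in w -> <|u, v|> = 0) ->
  forall u, u \in w <-> forall l, l \in wp -> <|l, u|> = 0.
Proof.
move=> pP u; split=> [wu l /pP h|h]; first exact: h.
by apply: vspace_orth => l /pP; exact: h.
Qed.

(** Existence of an admissible subspace keeps the universal statement from being vacuous; V is the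
    witness. For another admissible w, a unitary map between the complements takes V to w and
    extends to an isometry of CH^n. *)
Lemma congruence k : m = (2 * n - k)%N -> (k <= 2 * n)%N ->
  (exists w : {vspace galpha R n}, admissible k phi w) /\
  (forall w : {vspace galpha R n}, admissible k phi w ->
    congruent_to_open_part g (@cplx R n) iota (W_sub w)).
Proof.
move=> mE hk; have [f [fi zc]] := center_isometry.
have [V [VP dV]] := model_vspace fi zc q0.
have [Tc uc] := model_tangent_constant fi zc VP.
have [wp [pP dp]] := perp_exists V.
have ap := model_angle fi VP pP.
(* V has dimension m - 2 and g_alpha has dimension 2n - 2, so the complement again has dimension
   k. *)
have dk : \dim wp = k.
  have e : (2 * n = (2 * n.-1).+2)%N by case: (n) n0 => // n' _; rewrite mulnS.
  by rewrite mE -(subnK hk) in dV; move: dV dp hk mE; rewrite e; lia.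
split; first by exists V, wp.
move=> w [wp' [pP' dp' ap']].
have [U [U' [[[UU UU'] cU cU' K K'] Uw]]] := kahler_subspaces_unitary cphi ap ap' (etrans dk
  (esym dp')).
have VU u : u \in V <-> U u \in w.
  have [lU dU JU] := UU.
  rewrite (perp_eq pP) (perp_eq pP'); split=> h l hl.
    by rewrite -(K' l) dU; apply: h; apply/Uw; rewrite K'.
  by rewrite -dU; apply: h; apply/Uw.
(* Left translation by this element brings the g_alpha coordinate of the base point to 0; the
   coordinates simply add since [expR 0 = 1]. *)
pose t : CH R n := (0, - (f (iota q0)).1.2, 0).
pose f1 := mul_AN t \o f.
have fi1 : an_isometry f1 := an_isometry_comp fi (an_isometry_mul_AN t).
pose f2 := extend_galpha U \o f1.
have fiU := an_isometry_extend UU UU' cU cU' K K'.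
have fi2 : an_isometry f2 := an_isometry_comp fi1 fiU.
have td q x : triv_diff f2 q x = extend_galpha U (triv_diff f q x).
  apply: (etrans (triv_diff_comp _ _ fi1 fiU)); apply: (etrans (triv_diff_extend _ _ UU)).
  apply: (congr1 (extend_galpha U)).
  apply: (etrans (triv_diff_comp _ _ fi (an_isometry_mul_AN t))); exact: triv_diff_mul_AN.
apply: (open_part subM fi2) => q.
  rewrite /f2 /extend_galpha /=; apply/VU.
  by rewrite mul0r expR0 scale1r addrC; exact: uc.
apply/seteqP; split=> x.
  move=> [v [Tv ->]]; rewrite td /=; apply/VU.
  have : model_tangent iota f q (triv_diff f (iota q) (mct (iota q) v)) by exists v.
  by rewrite Tc.
move=> /= wx; have : model_tangent iota f q (x.1.1, U' x.1.2, x.2).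
  by rewrite Tc /=; apply/VU; rewrite K'.
move=> [v [Tv e]]; exists v; split; first exact: Tv.
have e' : extend_galpha U (x.1.1, U' x.1.2, x.2) = x.
  by rewrite /extend_galpha /= K'; case: (x) => [[]].
exact: (etrans (esym e') (etrans (congr1 (extend_galpha U) e) (esym (td _ _)))).
Qed.

End Congruence.

Lemma admissible_dim (R : realType) (n k : nat) (phi : R) (w : {vspace galpha R n}) :
  (0 < n)%N -> admissible k phi w -> dim (R^o * subvs_of w * R^o)%type = (2 * n - k)%N.
Proof.
move=> n0 [wp [pP dp _]]; have [wp' [pP' dp']] := perp_exists w.
have e : wp' = wp.
  by apply/vspaceP => u; apply/idP/idP => [/pP' h|/pP h]; [apply/pP|apply/pP'].
have -> : dim (R^o * subvs_of w * R^o)%type = (1 + \dim w + 1)%N by [].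
by move: dp' n0; rewrite e dp; move: (\dim w) => d; clear; case: n => // n' h _; lia.
Qed.

Theorem theorem3p5 (R : realType) (n k : nat) (phi : R)
    (hn : (2 <= n)%N) (hk : (k <= 2 * n)%N) (hphi0 : 0 < phi) (hphi : phi <= pi / 2) :
  (forall (M : topologicalType) (iota : M -> CH R n),
     [set: M] !=set0 -> connected [set: M] ->
     submanifold (2 * n - k) iota ->
     const_kahler_normal (@metric R n) (@cplx R n) iota phi ->
     second_ff_of_this_form (2 * n - k) (@metric R n) (@cplx R n) iota phi ->
     (exists w : {vspace galpha R n}, admissible k phi w) /\
     (forall w : {vspace galpha R n}, admissible k phi w ->
        congruent_to_open_part (@metric R n) (@cplx R n) iota (W_sub w)))
  /\
  (forall w : {vspace galpha R n}, admissible k phi w ->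
     let iota := set_val : W_sub w -> CH R n in
     [/\ submanifold (2 * n - k) iota,
         const_kahler_normal (@metric R n) (@cplx R n) iota phi &
         second_ff_of_this_form (2 * n - k) (@metric R n) (@cplx R n) iota phi]).
Proof.
have n0 : (0 < n)%N by exact: ltnW.
have sphi : sin phi != 0.
  rewrite gt_eqF // sin_gt0_pi // hphi0 /=; apply: (le_lt_trans hphi).
  by rewrite ltr_pdivrMr // ltr_pMr ?pi_gt0 // ltr1n.
have cphi : 0 <= cos phi.
  by rewrite cos_ge0_pihalf // hphi andbT (le_trans _ (ltW hphi0)) // oppr_le0 divr_ge0 // pi_ge0.
split=> [M iota [q0 _] cM subM angle [Z [II [ZF IIP IIZ]]]|w aw iota].
  (* For k = 0 there is no nonzero normal vector, and II says nothing about Z. But then the only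
     admissible w is all of g_alpha, W is CH^n, and it is enough that M is open. *)
  case: (posnP k) => [k0|k0]; last first.
    apply: (congruence sphi cphi subM n0 _ cM angle ZF IIP IIZ q0 (erefl _) hk).
    by rewrite -subn_gt0 subKn.
  rewrite k0 subn0 in subM *; split.
    exists fullv, 0%VS; split=> [u||u /=]; last 2 first.
    - by rewrite dimv0.
    - by rewrite memv0 => /eqP ->; rewrite eqxx.
    rewrite memv0; split=> [/eqP -> v _|h]; last by apply/eqP/dot_galpha_eq0/h/memvf.
    by rewrite dot_galphaC dot_galpha0r.
  move=> w [wp [pP dp _]]; apply: full_open_part => // u; apply: vspace_orth => l /pP.
  have /eqP := dp; rewrite dimv_eq0 => /eqP ->; rewrite memv0 => /eqP ->.
  by rewrite dot_galphaC dot_galpha0r.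
have WE := W_subE w; have [wp [pP dp ap]] := aw.
rewrite -(admissible_dim n0 aw); split.
- exact: (model_submanifold WE).
- exact: (model_const_kahler WE pP ap).
- exists (@model_Z R n (W_sub w)), (@model_II R n (W_sub w)); split.
  + exact: (model_unit_field WE).
  + exact: (model_II_secondff WE pP).
  + exact: (model_trivial_extension WE pP cphi ap).
Qed.
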